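(* Let $n\ge 1$ and let $M$ be a connected qc-hypersurface of the flat quaternionic space $\mathbb{R}^{4n+4}\cong\mathbb{H}^{n+1}$. Then there is a quaternionic affine transformation $F$ of $\mathbb{H}^{n+1}$ such that $F(M)$ is contained in one of the following three hyperquadrics: $$|q_1|^2+\dots+|q_n|^2+\mathrm{Re}(p)=0,\qquad |q_1|^2+\dots+|q_n|^2+|p|^2=1,\qquad |q_1|^2+\dots+|q_n|^2-|p|^2=-1,$$ where $(q_1,\dots,q_n,p)$ denote the standard quaternionic coordinates of $\mathbb{H}^{n+1}$. In particular, if $M$ is in addition compact, then there is a quaternionic affine transformation $F$ such that $F(M)$ is the standard (3-Sasakian) sphere $|q_1|^2+\dots+|q_n|^2+|p|^2=1$.
   Context: QC manifolds. A quaternionic contact (qc) manifold is a $(4n+3)$-dimensional manifold $M$ with a codimension three distribution $H$ (the horizontal space), a positive definite symmetric tensor $g$ on $H$ (the horizontal metric) and a rank three bundle $\mathbb{Q}$ of endomorphisms of $H$ such that locally there are a 1-form $\eta=(\eta_1,\eta_2,\eta_3)$ with values in $\mathbb{R}^3$ with $H=\bigcap_{s}\ker\eta_s$, and almost complex structures $I_1,I_2,I_3$ on $H$ generating $\mathbb{Q}$, with $I_1I_2=-I_2I_1=I_3$, $I_1I_2I_3=-\mathrm{id}_H$, $g(I_s\cdot,I_s\cdot)=g(\cdot,\cdot)$ and $2g(I_sX,Y)=d\eta_s(X,Y)$ for all $X,Y\in H$, $s=1,2,3$. If $n=1$ (dimension 7) one requires in addition the (local) existence of Reeb vector fields $\xi_1,\xi_2,\xi_3$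 with $\eta_s(\xi_t)=\delta_{st}$, $(\xi_s\lrcorner d\eta_s)|_H=0$, $(\xi_s\lrcorner d\eta_t)|_H=-(\xi_t\lrcorner d\eta_s)|_H$. QC-hypersurfaces. Let $K$ be a hyper-Kähler manifold of real dimension $4n+4$ with parallel complex structures $J_1,J_2,J_3$ satisfying the quaternion relations. An embedded hypersurface $M\subset K$ (of dimension $4n+3$) is a qc-hypersurface if $M$ carries a qc structure whose horizontal space $H$ is a $J_s$-invariant ($s=1,2,3$) subbundle of $TM$ of codimension four in $TK|_M$ (so $H$ is the maximal subspace of $TM$ invariant under $J_1,J_2,J_3$), and the restrictions of $J_1,J_2,J_3$ to $H$ are elements of the quaternionic structure $\mathbb{Q}$ of $M$. (Equivalently, the second fundamental form of $M$ restricted to $H$ is definite and $J_s$-invariant.) The space $\mathbb{H}^{n+1}$ is regarded as a flat hyper-Kähler manifold with metric $\langle q,q'\rangle=\mathrm{Re}\sum_a q_a\overline{q'_a}$ and complex structures $J_1,J_2,J_3$ given by multiplication on the right by $-i,-j,-k$. A quaternionic affine transformation of $\mathbb{H}^{n+1}$ is a map $F(x)=Ax\bar\omega+q_0$ with $A\in GL(n+1,\mathbb{H})$, $\omega\in Sp(1)$ (unit quaternions), $q_0\in\mathbb{H}^{n+1}$. *)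

(* Defs.v *)
From HB Require Import structures.
From mathcomp Require Import all_boot all_order all_algebra.
From mathcomp Require Import ring.
From mathcomp Require Import all_classical all_reals all_analysis.

Set Implicit Arguments.
Unset Strict Implicit.
Unset Printing Implicit Defensive.

Import Order.TTheory GRing.Theory Num.Theory.
Import numFieldNormedType.Exports.

Local Open Scope classical_set_scope.
Local Open Scope ring_scope.

Definition quat (R : realType) : Type := 'rV[R]_4.

Section Quaternions.
Variable R : realType.

HB.instance Definition _ := GRing.Zmodule.on (quat R).

(* a + b i + c j + d k *)
Definition mkquat (a b c d : R) : quat R :=
  \row_(k < 4) [:: a; b; c; d]`_k.

Definition Req (q : quat R) : R := q 0 (@Ordinal 4 0 isT).
Definition Imi (q : quat R) : R := q 0 (@Ordinal 4 1 isT).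
Definition Imj (q : quat R) : R := q 0 (@Ordinal 4 2 isT).
Definition Imk (q : quat R) : R := q 0 (@Ordinal 4 3 isT).

Definition quat_one : quat R := mkquat 1 0 0 0.

Definition quat_mul (p q : quat R) : quat R :=
  mkquat
    (Req p * Req q - Imi p * Imi q - Imj p * Imj q - Imk p * Imk q)
    (Req p * Imi q + Imi p * Req q + Imj p * Imk q - Imk p * Imj q)
    (Req p * Imj q - Imi p * Imk q + Imj p * Req q + Imk p * Imi q)
    (Req p * Imk q + Imi p * Imj q - Imj p * Imi q + Imk p * Req q).

Lemma quatP (p q : quat R) :
  Req p = Req q -> Imi p = Imi q -> Imj p = Imj q -> Imk p = Imk q -> p = q.
Proof.
move=> h0 h1 h2 h3; apply/rowP => -[[|[|[|[|//]]]] lt_k].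
- by rewrite (_ : Ordinal lt_k = @Ordinal 4 0 isT) //; apply: val_inj.
- by rewrite (_ : Ordinal lt_k = @Ordinal 4 1 isT) //; apply: val_inj.
- by rewrite (_ : Ordinal lt_k = @Ordinal 4 2 isT) //; apply: val_inj.
- by rewrite (_ : Ordinal lt_k = @Ordinal 4 3 isT) //; apply: val_inj.
Qed.

Lemma mkquatE (a b c d : R) :
  (Req (mkquat a b c d) = a) * (Imi (mkquat a b c d) = b) *
  (Imj (mkquat a b c d) = c) * (Imk (mkquat a b c d) = d).
Proof. by rewrite /Req /Imi /Imj /Imk !mxE. Qed.

Lemma quat_addE (p q : quat R) :
  (Req (p + q) = Req p + Req q) * (Imi (p + q) = Imi p + Imi q) *
  (Imj (p + q) = Imj p + Imj q) * (Imk (p + q) = Imk p + Imk q).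
Proof. by rewrite /Req /Imi /Imj /Imk !mxE. Qed.

Lemma quat_mulA : associative quat_mul.
Proof. by move=> p q r; apply: quatP; rewrite !mkquatE; ring. Qed.

Lemma quat_mul1r : left_id quat_one quat_mul.
Proof. by move=> p; apply: quatP; rewrite !mkquatE; ring. Qed.

Lemma quat_mulr1 : right_id quat_one quat_mul.
Proof. by move=> p; apply: quatP; rewrite !mkquatE; ring. Qed.

Lemma quat_mulDl : left_distributive quat_mul +%R.
Proof. by move=> p q r; apply: quatP; rewrite !(mkquatE, quat_addE); ring. Qed.

Lemma quat_mulDr : right_distributive quat_mul +%R.
Proof. by move=> p q r; apply: quatP; rewrite !(mkquatE, quat_addE); ring. Qed.

Lemma quat_one_neq0 : quat_one != 0.
Proof.
apply/eqP => /(congr1 Req); rewrite mkquatE /Req mxE => /eqP.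
by rewrite oner_eq0.
Qed.

HB.instance Definition _ := GRing.Zmodule_isNzRing.Build (quat R)
  quat_mulA quat_mul1r quat_mulr1 quat_mulDl quat_mulDr quat_one_neq0.

Definition conjq (q : quat R) : quat R :=
  mkquat (Req q) (- Imi q) (- Imj q) (- Imk q).

Definition normsq (q : quat R) : R :=
  Req q ^+ 2 + Imi q ^+ 2 + Imj q ^+ 2 + Imk q ^+ 2.

(* i, j, k for s = 0, 1, 2 *)
Definition imunit (s : 'I_3) : quat R := delta_mx 0 (lift ord0 s).

End Quaternions.

(* H^{n+1} as the real normed space R^{4n+4}: row [a] holds the four real
   components of the quaternionic coordinate [a]. *)
Notation Hspace R n := 'M[R]_(n.+1, 4).

Section FlatSpace.
Variables (R : realType) (n : nat).

Definition coordq (x : Hspace R n) (a : 'I_n.+1) : quat R := row a x.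

Definition colq (x : Hspace R n) : 'cV[quat R]_n.+1 := \col_a coordq x a.

Definition J (s : 'I_3) (x : Hspace R n) : Hspace R n :=
  \matrix_(a < n.+1) (coordq x a * - imunit R s : quat R).

(* F(x) = A x \bar{omega} + q0; as [quat R] is not commutative, [A] is required
   to have a two-sided inverse instead of being in [unitmx] *)
Definition quaternionic_affine (F : Hspace R n -> Hspace R n) : Prop :=
  exists (A : 'M[quat R]_n.+1) (omega : quat R) (q0 : Hspace R n),
    [/\ exists B : 'M[quat R]_n.+1, A *m B = 1%:M /\ B *m A = 1%:M,
        normsq omega = 1
      & forall x, colq (F x) =
          map_mx (fun q => q * conjq omega) (A *m colq x) + colq q0 ].

Definition q_ (x : Hspace R n) (a : 'I_n) : quat R :=
  coordq x (widen_ord (leqnSn n) a).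
Definition p_ (x : Hspace R n) : quat R := coordq x ord_max.

Definition quadric_parabolic : set (Hspace R n) :=
  [set x | \sum_(a < n) normsq (q_ x a) + Req (p_ x) = 0].
Definition quadric_sphere : set (Hspace R n) :=
  [set x | \sum_(a < n) normsq (q_ x a) + normsq (p_ x) = 1].
Definition quadric_hyperbolic : set (Hspace R n) :=
  [set x | \sum_(a < n) normsq (q_ x a) - normsq (p_ x) = - 1].

End FlatSpace.

Section Smooth.
Variables (R : realType) (V W : normedModType R).

Fixpoint Ck (k : nat) (U : set V) (f : V -> W) : Prop :=
  if k is k'.+1 then
    (forall x, U x -> differentiable f x) /\
    (forall v, Ck k' U (fun x => 'D_v f x))
  else forall x, U x -> {for x, continuous f}.

(* C^infinity on [U]; meaningful only for open [U], where only the values of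
   [f] on [U] matter *)
Definition smooth (U : set V) (f : V -> W) : Prop := forall k, Ck k U f.

(* smoothness along an arbitrary subset, by local smooth extension *)
Definition smooth_along (S : set V) (f : V -> W) : Prop :=
  forall x, S x -> exists (U : set V) (F : V -> W),
    [/\ open U, U x, smooth U F & forall y, S y -> U y -> f y = F y].

End Smooth.

Section Hypersurface.
Variables (R : realType) (n : nat).
Local Notation V := (Hspace R n).

Definition defining_function (M U : set V) (rho : V -> R^o) : Prop :=
  [/\ open U, smooth U rho, (forall y, U y -> (M y <-> rho y = 0))
    & forall y, U y -> M y -> exists v, 'D_v rho y != 0].

Definition embedded_hypersurface (M : set V) : Prop :=
  forall x, M x -> exists U rho, defining_function M U rho /\ U x.

(* T_x M is the kernel of d rho_x, which does not depend on the choice of the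
   local defining function rho *)
Definition tangent (M : set V) (x : V) : set V :=
  [set v | exists U rho,
     [/\ defining_function M U rho, U x & 'D_v rho x = 0] ].

(* d eta (u, v) = u (eta v) - v (eta u), for constant fields u and v *)
Definition dform (eta : V -> 'Hom(V, R^o)) (x u v : V) : R^o :=
  'D_u (fun y => eta y v) x - 'D_v (fun y => eta y u) x.

Section Frame.
Variables (M : set V) (H : V -> {vspace V}).
Variable g : forall x, subvs_of (H x) -> subvs_of (H x) -> R^o.
Variable Q : forall x, {vspace 'End(subvs_of (H x))}.

(* A section is smooth when it is so as a map into the ambient space. *)
Definition smooth_section (S : set V) (X : forall x, subvs_of (H x)) : Prop :=
  smooth_along S (fun x => vsval (X x)).

(* Local 1-forms on [M] are given by ambient extensions to the open set [U];
   as exterior differentiation commutes with restriction to [M], evaluating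
   [dform] on vectors tangent to [M] yields the differential on [M]. *)
Definition contact_frame (U : set V) (eta : 'I_3 -> V -> 'Hom(V, R^o))
    (I : 'I_3 -> forall x, 'End(subvs_of (H x))) : Prop :=
  [/\ forall s v, smooth U (fun x => eta s x v : R^o),
      forall x, M x -> U x -> forall v,
        v \in H x <-> tangent M x v /\ forall s, eta s x v = 0,
      forall s O (X : forall x, subvs_of (H x)), open O ->
        smooth_section (M `&` U `&` O) X ->
        smooth_section (M `&` U `&` O) (fun x => I s x (X x))
    & forall x, M x -> U x ->
      [/\ forall s, (I s x \o I s x)%VF = - \1%VF,
          [/\ (I 0%R x \o I 1%R x)%VF = I 2 x,
              (I 1%R x \o I 0%R x)%VF = - I 2 x
            & (I 0%R x \o (I 1%R x \o I 2%R x))%VF = - \1%VF],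
          Q x = <<[:: I 0%R x; I 1%R x; I 2%R x]>>%VS,
          forall s X Y, g (I s x X) (I s x Y) = g X Y
        & forall s X Y,
            2 * g (I s x X) Y = dform (eta s) x (vsval X) (vsval Y)] ].

Definition reeb_fields (U : set V) (eta : 'I_3 -> V -> 'Hom(V, R^o))
    (xi : 'I_3 -> V -> V) : Prop :=
  [/\ forall s, smooth_along (M `&` U) (xi s),
      forall s x, M x -> U x -> tangent M x (xi s x),
      forall s t x, M x -> U x -> eta s x (xi t x) = (s == t)%:R,
      forall s x, M x -> U x -> forall X, X \in H x ->
        dform (eta s) x (xi s x) X = 0
    & forall s t x, M x -> U x -> forall X, X \in H x ->
        dform (eta t) x (xi s x) X = - dform (eta s) x (xi t x) X].

End Frame.

(* The values of [qc_H], [qc_g], [qc_Q] outside [M] are irrelevant. Smoothness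
   of the distribution [qc_H] and of the bundle [qc_Q] is contained in the
   existence of the smooth local frames of [qc_frame]. *)
Record qc_structure (M : set V) := QCStructure {
  qc_H : V -> {vspace V};
  qc_g : forall x, subvs_of (qc_H x) -> subvs_of (qc_H x) -> R^o;
  qc_Q : forall x, {vspace 'End(subvs_of (qc_H x))};
  qc_H_tangent : forall x, M x -> forall v, v \in qc_H x -> tangent M x v;
  qc_H_dim : forall x, M x -> \dim (qc_H x) = (4 * n)%N;
  qc_g_linear : forall x, M x -> forall a (X Y Z : subvs_of (qc_H x)),
    qc_g (a *: X + Y) Z = a * qc_g X Z + qc_g Y Z;
  qc_g_sym : forall x, M x -> forall X Y : subvs_of (qc_H x),
    qc_g X Y = qc_g Y X;
  qc_g_pos : forall x, M x -> forall X : subvs_of (qc_H x),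
    X != 0 -> 0 < qc_g X X;
  qc_g_smooth : forall O (X Y : forall x, subvs_of (qc_H x)), open O ->
    smooth_section (M `&` O) X -> smooth_section (M `&` O) Y ->
    smooth_along (M `&` O) (fun x => qc_g (X x) (Y x));
  qc_Q_dim : forall x, M x -> \dim (qc_Q x) = 3%N;
  qc_frame : forall x, M x -> exists U eta I,
    [/\ open U, U x, contact_frame M qc_g qc_Q U eta I
      & n = 1%N -> exists xi, reeb_fields M qc_H U eta xi]
}.

(* The existence of [f] includes the J_s-invariance of the horizontal space. *)
Definition qc_hypersurface (M : set V) : Prop :=
  embedded_hypersurface M /\
  exists S : qc_structure M, forall x, M x -> forall s : 'I_3,
    exists2 f, f \in qc_Q S x &
      forall X : subvs_of (qc_H S x), vsval (f X) = J s (vsval X).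

End Hypersurface.

(* Main.v *)
Require Import Defs.
From HB Require Import structures.
From mathcomp Require Import all_boot all_order all_algebra.
From mathcomp Require Import ring lra.
From mathcomp Require Import all_classical all_reals all_analysis.
Set Implicit Arguments.
Unset Strict Implicit.
Unset Printing Implicit Defensive.
Import Order.TTheory GRing.Theory Num.Theory.
Import numFieldNormedType.Exports.
Local Open Scope classical_set_scope.
Local Open Scope ring_scope.

(** Let rho be a defining function of M, with differential N and Hessian h, and
    let the horizontal space at a point be the common kernel of N, N o J_1,
    N o J_2, N o J_3.

    The qc structure enters only through second order information
    ([qc_umbilic]): on the horizontal space h is definite and h(X, J_s X) = 0,
    so that h is J_s-invariant there.  Indeed the contact forms are
    combinations of the N o J_t, whence their differentials on the horizontal
    space are combinations of the three Levi forms; being also the three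
    fundamental forms of the qc metric up to a change of basis, they force the
    Levi forms to be proportional to these.

    The theorem is then a rigidity statement.  The invariance of h holds along
    all of M, so it can be differentiated, and the symmetry of the third
    derivative of rho turns the result into new identities for h.  Two such
    rounds ([mixed_form_invariant], [normal_umbilic]) extend the invariance from
    the horizontal space to the tangent space, and show that
      h = B + N (x) theta + theta (x) N
    with B invariant under J_1, J_2, J_3 on the whole space ([hessian_form]).
    A third round shows that C_Y = D_Y B - theta(Y) B, for Y tangent, is
    invariant, and symmetric in its three arguments when they are tangent.  Such a C is zero
    ([prolongation_eq0]): on a trilinear form with these symmetries J_s can be
    moved around the arguments and returns with the opposite sign.  Thus B is
    constant up to a factor along M, the conormal N divided by that factor is an
    affine function of the point, and integrating once more exhibits M near each
    point as a piece of a quadric with invariant quadratic part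
    ([local_quadric]).

    Such a quadric is determined by any germ of M up to a factor
    ([quadric_unique]), so connectedness gives one quadric for all of M
    ([global_quadric]).  Its quadratic part is positive on a quaternionic
    hyperplane; a quaternionic Gram-Schmidt process diagonalises it there
    ([normal_coordinates]) and completing the square in the last coordinate
    leaves three cases according to the sign of the last coefficient
    ([quadric_normal_form]).

    If M is compact, every real linear function attains its maximum on the
    image of M, at a point where it is critical along the quadric.  The
    paraboloid and the hyperboloid carry linear functions without critical
    points.  On the sphere the critical points of the function <., s> are s and
    -s; the maximum is attained at s, because M is not a single point, so the
    image of M contains every point s of the sphere. *)

(** * Differentials of real functions *)

Section HasDiff.
Variables (R : realType) (V : normedModType R).
Implicit Types (F G : V -> R^o) (x : V).

(** The differential is a bare function, so that it can be given by a formula;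
    linearity is never part of the data. *)
Definition has_diff F x (dF : V -> R) : Prop :=
  differentiable F x /\ forall Y, 'D_Y F x = dF Y.

Lemma has_diff_derive F x : differentiable F x ->
  has_diff F x (fun Y => 'D_Y F x).
Proof. by []. Qed.

Lemma eq_has_diff F x dF dF' : dF =1 dF' -> has_diff F x dF -> has_diff F x dF'.
Proof. by move=> e [d h]; split=> // Y; rewrite h e. Qed.

Lemma has_diff_cst x (a : R) : has_diff (fun=> a) x (fun=> 0).
Proof.
by split=> [|Y]; [exact: differentiable_cst | rewrite derive_cst].
Qed.

Lemma has_diffD F G x dF dG : has_diff F x dF -> has_diff G x dG ->
  has_diff (fun y => F y + G y) x (fun Y => dF Y + dG Y).
Proof.
move=> [dfF eF] [dfG eG]; split=> [|Y]; first exact: differentiableD.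
by rewrite (_ : (fun y => _) = F + G) // deriveD ?eF ?eG //; exact: diff_derivable.
Qed.

Lemma has_diffM F G x dF dG : has_diff F x dF -> has_diff G x dG ->
  has_diff (fun y => F y * G y) x (fun Y => dF Y * G x + F x * dG Y).
Proof.
move=> [dfF eF] [dfG eG]; split=> [|Y]; first exact: (differentiableM dfF dfG).
rewrite (_ : (fun y => _) = (F : V -> R) * G) // deriveM ?eF ?eG //; last 2 first.
- exact: diff_derivable.
- exact: diff_derivable.
by rewrite addrC /GRing.scale /= [G x * _]mulrC.
Qed.

Lemma has_diffZ F x dF (a : R) : has_diff F x dF ->
  has_diff (fun y => a * F y) x (fun Y => a * dF Y).
Proof.
move=> hF; apply: eq_has_diff (has_diffM (has_diff_cst x a) hF) => Y.
by rewrite mul0r add0r.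
Qed.

Lemma has_diffN F x dF : has_diff F x dF ->
  has_diff (fun y => - F y) x (fun Y => - dF Y).
Proof.
move=> /(@has_diffZ _ _ _ (-1)) hF.
rewrite (_ : (fun y => - F y) = fun y => -1 * F y); last first.
  by apply/funext => y; rewrite mulN1r.
by apply: eq_has_diff hF => Y; rewrite mulN1r.
Qed.

Lemma has_diffB F G x dF dG : has_diff F x dF -> has_diff G x dG ->
  has_diff (fun y => F y - G y) x (fun Y => dF Y - dG Y).
Proof. by move=> hF /has_diffN hG; exact: has_diffD. Qed.

Lemma has_diff_sum (I : finType) (F : I -> V -> R^o) x dF :
  (forall i, has_diff (F i) x (dF i)) ->
  has_diff (fun y => \sum_i F i y) x (fun Y => \sum_i dF i Y).
Proof.
move=> h; elim: (index_enum I) => [|i s ih].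
  have -> : (fun y => \sum_(i <- [::]) F i y) = (fun=> 0 : R).
    by apply/funext => y; rewrite big_nil.
  by apply: eq_has_diff (has_diff_cst x 0) => Y; rewrite big_nil.
have -> : (fun y => \sum_(i <- i :: s) F i y) =
    (fun y => F i y + \sum_(i <- s) F i y).
  by apply/funext => y; rewrite big_cons.
by apply: eq_has_diff (has_diffD (h i) ih) => Y; rewrite big_cons.
Qed.

Lemma has_diffV F x dF : F x != 0 -> has_diff F x dF ->
  has_diff (fun y => (F y)^-1) x (fun Y => - (F x)^-2 * dF Y).
Proof.
move=> F0 [dfF eF]; split=> [|Y]; first exact: (differentiableV dfF F0).
rewrite -eF (@deriveV _ _ (F : V -> R)) //; exact: diff_derivable.
Qed.

(** The derivative of the factor G drops out, so G may be any differentiable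
    function: the unknown coefficients in the expressions for the Hessian and
    for the contact forms are treated in this way. *)
Lemma has_diffM0 F G x dF : has_diff F x dF -> F x = 0 -> differentiable G x ->
  has_diff (fun y => F y * G y) x (fun Y => dF Y * G x).
Proof.
move=> hF F0 /has_diff_derive hG.
by apply: eq_has_diff (has_diffM hF hG) => Y; rewrite F0 mul0r addr0.
Qed.

Lemma derive_linear F x : differentiable F x ->
  forall a u v, 'D_(a *: u + v) F x = a * 'D_u F x + 'D_v F x.
Proof. by move=> d a u v; rewrite !deriveE // linearP. Qed.

Lemma has_diff_continuous F x dF : has_diff F x dF -> {for x, continuous F}.
Proof. by case=> d _; exact: differentiable_continuous. Qed.

Lemma has_diff_curve F (c : R -> V) t v dF : has_diff F (c t) dF ->
  is_derive t (1 : R) c v -> is_derive t (1 : R) (fun s => F (c s)) (dF v).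
Proof.
move=> [dfF eF] [cd cv].
have dc : differentiable c t by exact/derivable1_diffP.
have dFc : differentiable (F \o c) t by exact: differentiable_comp.
apply: DeriveDef; first exact/derivable1_diffP.
rewrite (_ : (fun s => _) = F \o c) // deriveE // diff_comp //=.
by rewrite -eF deriveE // -cv deriveE.
Qed.

End HasDiff.

Section SmoothFunctions.
Variables (R : realType) (V : normedModType R) (U : set V) (f : V -> R^o).

Lemma smooth_differentiable : smooth U f -> forall x, U x -> differentiable f x.
Proof. by move=> /(_ 1%N) [] . Qed.

Lemma smooth_derive v : smooth U f -> smooth U (fun x => 'D_v f x : R^o).
Proof. by move=> sf k; have [_] := sf k.+1; exact. Qed.

End SmoothFunctions.

Section Lines.
Variables (R : realType) (V : normedModType R).

Lemma is_derive_scalel (s : R -> R) (t ds : R) (w : V) :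
  is_derive t (1 : R) s ds ->
  is_derive t (1 : R) (fun r => s r *: w) (ds *: w).
Proof.
move=> [sd sv]; have d : differentiable s t by exact/derivable1_diffP.
have dw : differentiable (fun r => s r *: w) t by exact: differentiableZl.
apply: DeriveDef; first exact/derivable1_diffP.
by rewrite deriveE // diffZl //= -sv deriveE.
Qed.

Lemma is_derive_line (x u : V) (t : R) :
  is_derive t (1 : R) (fun s => x + s *: u) u.
Proof.
have h : is_derive t (1 : R) (fun s : R => s *: u) (1 *: u).
  by apply: is_derive_scalel; exact: is_derive_id.
have := is_deriveD (is_derive_cst x t (1 : R)) h.
by rewrite add0r scale1r.
Qed.

Lemma is_derive_comp_line (f : V -> R^o) x u (t : R) :
  differentiable f (x + t *: u) ->
  is_derive t (1 : R) (fun s => f (x + s *: u)) ('D_u f (x + t *: u)).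
Proof.
move=> d; apply: has_diff_curve (is_derive_line x u t).
exact: has_diff_derive.
Qed.

Lemma MVT_line (f : V -> R^o) x u (t : R) : 0 < t ->
  (forall s, 0 <= s <= t -> differentiable f (x + s *: u)) ->
  exists2 s, 0 <= s <= t & f (x + t *: u) - f x = t * 'D_u f (x + s *: u).
Proof.
move=> t0 df.
have dd s : 0 <= s <= t ->
    is_derive s (1 : R) (fun s => f (x + s *: u)) ('D_u f (x + s *: u)).
  by move=> hs; apply: is_derive_comp_line; exact: df.
have [||s] := @MVT_segment _ (fun s => f (x + s *: u))
  (fun s => 'D_u f (x + s *: u)) 0 t (ltW t0).
- by move=> s; rewrite in_itv /= => /andP[a b]; apply: dd; rewrite !ltW.
- apply: derivable_within_continuous => s; rewrite in_itv /= => hs.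
  by case: (dd _ hs).
rewrite in_itv /= scale0r addr0 subr0 => hs e; exists s => //.
by rewrite e mulrC.
Qed.

End Lines.

Section Schwarz.
Variables (R : realType) (V : normedModType R) (U : set V) (f : V -> R^o).

(** Both mixed derivatives are limits of the same second difference. *)
Lemma schwarz u v x : open U -> smooth U f -> U x ->
  'D_u (fun y => 'D_v f y : R^o) x = 'D_v (fun y => 'D_u f y : R^o) x.
Proof.
move=> oU sf Ux.
pose D2 u v y := 'D_u (fun y => 'D_v f y : R^o) y.
have cD2 u' v' : {for x, continuous (D2 u' v')}.
  apply: differentiable_continuous; apply: smooth_differentiable Ux.
  exact/smooth_derive/smooth_derive.
apply/eqP; rewrite -subr_eq0 -normr_le0; apply/ler_addgt0Pl => e e0; rewrite addr0.
have e2 : 0 < e / 2 by rewrite divr_gt0.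
have nearD u' v' : \forall y \near x, `|D2 u' v' y - D2 u' v' x| <= e / 2.
  exact: (cvgr_distC_le _ _ (cD2 u' v') _ e2).
have nU : \forall y \near x, U y by apply: open_nbhs_nbhs.
have : \forall y \near x, [/\ U y, `|D2 u v y - D2 u v x| <= e / 2
    & `|D2 v u y - D2 v u x| <= e / 2].
  by apply: filterS3 nU (nearD u v) (nearD v u) => y a b c; split.
move=> /nbhs_ballP[r /= r0 br].
pose k := 1 + `|u| + `|v|.
have k0 : 0 < k by rewrite ltr_pwDl// ltr_pwDl.
pose t := r / 2 / k.
have t0 : 0 < t by rewrite !divr_gt0.
have inb a b : 0 <= a <= t -> 0 <= b <= t -> ball x r (x + a *: u + b *: v).
  move=> /andP[a0 at_] /andP[b0 bt]; rewrite -ball_normE /ball_ /=.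
  rewrite -addrA opprD addrA subrr add0r normrN.
  rewrite (le_lt_trans (ler_normD _ _))// !normrZ !ger0_norm//.
  apply: (@le_lt_trans _ _ (t * k)); last first.
    by rewrite divfK ?gt_eqF// ltr_pdivrMr// ltr_pMr// ltr1n.
  have au : a * `|u| <= t * `|u| by apply: ler_wpM2r.
  have bv : b * `|v| <= t * `|v| by apply: ler_wpM2r.
  rewrite /k; lra.
have dU y : U y -> differentiable f y by exact: smooth_differentiable.
have key u' v' : (forall a b, 0 <= a <= t -> 0 <= b <= t ->
      ball x r (x + a *: u' + b *: v')) ->
    exists2 y, ball x r y &
    f (x + t *: u' + t *: v') - f (x + t *: u') - f (x + t *: v') + f x
      = t * (t * D2 v' u' y).
  move=> inb'.
  pose g := fun y => f (y + t *: v') - f y : R^o.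
  have hg y : U y -> U (y + t *: v') ->
      has_diff g y (fun Y => 'D_Y f (y + t *: v') - 'D_Y f y).
    move=> Uy Uy'; apply: has_diffB; last by apply: has_diff_derive; apply: dU.
    split=> [|Y].
      apply: (@differentiable_comp _ _ _ _ (fun y => y + t *: v') f) => //.
        exact: dU.
    rewrite (@deriveE _ _ _ (fun y0 => f (y0 + t *: v'))); last first.
      apply: (@differentiable_comp _ _ _ _ (fun y => y + t *: v') f) => //.
        exact: dU.
    rewrite (@diff_comp _ _ _ _ (fun y => y + t *: v') f) //; last exact: dU.
    by rewrite deriveE ?diff_val /= ?addr0//; exact: dU.
  have tt : 0 <= t <= t by rewrite lexx ltW.
  have z0 : 0 <= (0 : R) <= t by rewrite lexx ltW.
  have [s hs es] : exists2 s, 0 <= s <= t &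
      g (x + t *: u') - g x = t * 'D_u' g (x + s *: u').
    apply: MVT_line => // s hs.
    have [] // := hg (x + s *: u').
    - by have := inb' s 0 hs z0; rewrite scale0r addr0 => /br[].
    - by have := inb' s t hs tt => /br[].
  have {es} es : g (x + t *: u') - g x =
     t * ('D_u' f (x + s *: u' + t *: v') - 'D_u' f (x + s *: u')).
    rewrite es; congr (_ * _); have [| |_ -> //] := hg (x + s *: u').
    - by have := inb' s 0 hs z0; rewrite scale0r addr0 => /br[].
    - by have := inb' s t hs tt => /br[].
  have [s' hs' es'] : exists2 s', 0 <= s' <= t &
      'D_u' f (x + s *: u' + t *: v') - 'D_u' f (x + s *: u') =
      t * 'D_v' (fun y => 'D_u' f y : R^o) (x + s *: u' + s' *: v').
    apply: (@MVT_line _ _ (fun y => 'D_u' f y : R^o)) => // s' hs'.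
    apply: smooth_differentiable (smooth_derive u' sf) _ _.
    by have /br[] := inb' s s' hs hs'.
  exists (x + s *: u' + s' *: v'); first exact: inb'.
  rewrite /D2 -es' -es /g opprB addrA.
  by rewrite addrAC.
have [y by_ ey] := key _ _ inb.
have [|y' by'_ ey'] := key v u.
  by move=> a b ha hb; rewrite addrAC; exact: inb.
have e1 : D2 v u y = D2 u v y'.
  have : t * (t * D2 v u y) = t * (t * D2 u v y').
    move: ey ey'; rewrite (addrAC x (t *: v) (t *: u)).
    move: (f (x + t *: u + t *: v)) (f (x + t *: u)) (f (x + t *: v)) (f x).
    move: (D2 v u y) (D2 u v y') => d1 d2 p q r' s <- <-.
    by rewrite (addrAC p (- q) (- r')).
  by move/(mulfI (lt0r_neq0 t0))/(mulfI (lt0r_neq0 t0)).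
have [_ _ h1] := br _ by_; have [_ h2 _] := br _ by'_.
rewrite -/(D2 u v x) -/(D2 v u x).
move: h1 h2; rewrite e1; move: (D2 u v y') (D2 v u x) (D2 u v x) => a b c.
rewrite !ler_norml => /andP[a1 a2] /andP[b1 b2]; apply/andP.
by move: a1 a2 b1 b2; clear; split; lra.
Qed.

End Schwarz.

(** * Curves in a level set *)

(** The increment form of the derivative, without division, which composes well
    with the linear estimate of [level_growth]. *)
Lemma is_derive_eps (R : realType) (f : R -> R) (t d : R) :
  is_derive t (1 : R) f d <->
  forall e, 0 < e -> \forall q \near (0 : R),
    `|f (q + t) - f t - q * d| <= e * `|q|.
Proof.
have E q : q != 0 -> forall e, (`|d - q^-1 *: ((f \o shift t) (q *: (1 : R)) - f t)| <= e)
   = (`|f (q + t) - f t - q * d| <= e * `|q|).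
  move=> q0 e; have q1 : 0 < `|q| by rewrite normr_gt0.
  rewrite -(ler_pM2r q1) -normrM -[in RHS]normrN; congr (`|_| <= _).
  by rewrite /= /GRing.scale /= mulr1; field.
split=> [[dv dd] e e0|h].
  have /cvgrPdist_le /(_ e e0) : h^-1 *: ((f \o shift t) (h *: (1 : R)) - f t) @[h --> 0^'] --> d.
    by rewrite -dd; exact: dv.
  rewrite near_withinE; apply: filterS => q hq.
  have [->|q0] := eqVneq q 0; first by rewrite add0r subrr mul0r subr0 normr0 mulr0.
  by rewrite -E //; exact: hq.
have cl : h^-1 *: ((f \o shift t) (h *: (1 : R)) - f t) @[h --> 0^'] --> d.
  apply/cvgrPdist_le => e e0; rewrite near_withinE.
  by apply: filterS (h e e0) => q hq q0; rewrite E.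
by apply: DeriveDef; [apply: cvgP cl | exact: cvg_lim cl].
Qed.

Section LevelCurve.
Variables (R : realType) (V : normedModType R) (U : set V) (rho : V -> R^o).
Variables (x0 w : V).
Hypotheses (oU : open U) (srho : smooth U rho) (Ux0 : U x0).

Let drho y : U y -> differentiable rho y.
Proof. exact: smooth_differentiable. Qed.

(** On lines parallel to w the function grows at least linearly, by the mean
    value theorem.  This one estimate gives uniqueness and differentiability of
    the implicit function in [level_curves_pos]. *)
Lemma level_growth (m : R) (B : set V) :
    (forall y, B y -> U y /\ m <= 'D_w rho y) ->
    (forall y (s : R) (t : R), B y -> B (y + s *: w) -> 0 <= t <= s ->
      B (y + t *: w)) ->
  forall y (s : R), 0 < m -> B y -> B (y + s *: w) ->
    m * `|s| <= `|rho (y + s *: w) - rho y|.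
Proof.
move=> hB conv.
have pos y s : 0 < m -> 0 < s -> B y -> B (y + s *: w) ->
    m * s <= rho (y + s *: w) - rho y.
  move=> m0 s0 By Bs.
  have [|t ht ->] := @MVT_line _ _ rho y w s s0.
  - by move=> t ht; apply: drho; case: (hB _ (conv _ _ _ By Bs ht)).
  - have [_] := hB _ (conv _ _ _ By Bs ht).
    by move=> h; rewrite mulrC; apply: ler_wpM2l => //; exact: ltW.
move=> y s m0 By Bs; have [s0|s0|->] := ltgtP s 0; last first.
- by rewrite normr0 mulr0.
- by rewrite gtr0_norm //; exact: le_trans (pos _ _ m0 s0 By Bs) (ler_norm _).
- have e : y + s *: w + (- s) *: w = y by rewrite scaleNr addrK.
  have := pos (y + s *: w) (- s) m0; rewrite e oppr_gt0 => /(_ s0 Bs By) h.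
  by rewrite ltr0_norm // distrC; exact: le_trans h (ler_norm _).
Qed.

(** For v small the line through x0 + t v parallel to w meets the level set
    exactly once near x0, by the intermediate value theorem and [level_growth];
    the point of intersection is c(t).  Comparing c(q + t) with the tangent
    c(t) + q v' of the level set, whose value under rho is o(q), shows that c
    is differentiable.  A curve instead of a chart suffices: it realises any
    given tangent vector at x0 and joins x0 to any nearby point of the level
    set. *)
Lemma level_curves_pos : rho x0 = 0 -> 0 < 'D_w rho x0 ->
  exists2 r : R, 0 < r & forall v, `|v| < r -> exists c : R -> V,
    [/\ c 0 = x0,
        forall t, -1 <= t <= 1 -> [/\ U (c t), rho (c t) = 0
          & exists2 v', is_derive t (1 : R) c v' & 'D_v' rho (c t) = 0],
        'D_v rho x0 = 0 -> is_derive 0 (1 : R) c v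
      & rho (x0 + v) = 0 -> c 1 = x0 + v].
Proof.
move=> r0 Dw; pose m := 'D_w rho x0 / 2.
have m0 : 0 < m by rewrite divr_gt0.
have cD : {for x0, continuous (fun y => 'D_w rho y : R^o)}.
  apply: differentiable_continuous.
  by apply: smooth_differentiable Ux0; exact: smooth_derive.
have nm : \forall y \near x0, m <= 'D_w rho y.
  have : \forall y \near x0, m < ('D_w rho y : R^o).
    apply: (cvgr_gt _ cD); rewrite /m; move: Dw; lra.
  by apply: filterS => y /ltW.
have nU : \forall y \near x0, U y by apply: open_nbhs_nbhs.
have [k k0 hk] : exists2 k : R, 0 < k & forall y, `|y - x0| < k ->
    U y /\ m <= 'D_w rho y.
  have : \forall y \near x0, U y /\ m <= 'D_w rho y.
    by apply: filterS2 nU nm.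
  move=> /nbhs_ballP[k /= k0 bk].
  exists k => // y hy; apply: bk.
  by rewrite -ball_normE /ball_ /= distrC.
pose B : set V := fun y => `|y - x0| < k.
have grow y s : B y -> B (y + s *: w) ->
    m * `|s| <= `|rho (y + s *: w) - rho y|.
  move=> By Bs; apply: (level_growth (B := B)) => // {y s By Bs} y s t By Bs ht.
  have [s0|s0] := eqVneq s 0.
    have -> : t = 0 by apply/eqP; rewrite eq_le -{1}s0 andbC.
    by rewrite scale0r addr0.
  have sp : 0 < s by rewrite lt_neqAle eq_sym s0 /=; case/andP: ht => a; exact: le_trans.
  have -> : y + t *: w = (1 - t / s) *: y + (t / s) *: (y + s *: w).
    rewrite scalerBl scalerDr scalerA divfK // scale1r.
    by rewrite addrA subrK.
  rewrite /B (_ : _ - x0 = (1 - t / s) *: (y - x0) + (t / s) *: (y + s *: w - x0)).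
    have ts : 0 <= t / s <= 1.
      case/andP: ht => a b; apply/andP; split; first by rewrite divr_ge0 // ltW.
      by rewrite ler_pdivrMr // mul1r.
    move: (t / s) ts => q /andP[q0 q1'].
    have q1 : 0 <= 1 - q by lra.
    rewrite (le_lt_trans (ler_normD _ _))// !normrZ.
    rewrite (ger0_norm q1) (ger0_norm q0).
    move: By Bs; rewrite /B.
    move: `|y - x0| `|y + s *: w - x0| => a b ak bk.
    have h1 : 0 <= (1 - q) * (k - a) by apply: mulr_ge0; lra.
    have h2 : 0 <= q * (k - b) by apply: mulr_ge0; lra.
    have [q2|q2] := leP q (1 / 2).
      have h3 : 0 < (1 - q) * (k - a) by apply: mulr_gt0; lra.
      lra.
    have h3 : 0 < q * (k - b) by apply: mulr_gt0; lra.
    lra.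
  rewrite !scalerBr !scalerBl !scale1r.
  by rewrite addrACA -opprD subrK.
pose d := k / 2 / (1 + `|w|).
have w1 : 0 < 1 + `|w| by rewrite ltr_pwDl.
have d0 : 0 < d by rewrite !divr_gt0.
have inB p s : `|p| < k / 2 -> `|s| <= d -> B (x0 + p + s *: w).
  move=> hp hs; rewrite /B addrAC (addrAC x0) subrr add0r.
  rewrite (le_lt_trans (ler_normD _ _))// normrZ.
  have : `|s| * `|w| <= k / 2.
    apply: (@le_trans _ _ (d * (1 + `|w|))).
      by apply: ler_pM => //; rewrite ler_wpDl.
    by rewrite divfK // gt_eqF.
  by move: hp; lra.
have B0 : B x0 by rewrite /B subrr normr0.
have inB0 s : `|s| <= d -> B (x0 + s *: w).
  by move=> hs; have := inB 0 s; rewrite addr0 normr0 divr_gt0 //; exact.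
have dd : `|d| <= d by rewrite gtr0_norm.
have ndd : `|- d| <= d by rewrite normrN.
have up : 0 < rho (x0 + d *: w).
  have Bd := inB0 _ dd; have := @MVT_line _ _ rho x0 w d d0.
  case=> [t /andP[t0 td]|t /andP[t0 td]].
    by apply: drho; case: (hk (x0 + t *: w)) => //; apply: inB0; rewrite ger0_norm.
  rewrite r0 subr0 => ->; rewrite mulr_gt0 //.
  have [_] : U (x0 + t *: w) /\ m <= 'D_w rho (x0 + t *: w).
    by apply: hk; apply: inB0; rewrite ger0_norm.
  exact: lt_le_trans.
have dn : rho (x0 + (- d) *: w) < 0.
  have Bd := inB0 _ ndd; have := @MVT_line _ _ rho (x0 + (- d) *: w) w d d0.
  have e t : x0 + (- d) *: w + t *: w = x0 + (t - d) *: w.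
    by rewrite -addrA -scalerDl addrC [- d + t]addrC addrC.
  have td0 t : 0 <= t <= d -> `|t - d| <= d.
    by rewrite ler_norml => /andP[a b]; apply/andP; split; lra.
  case=> [t ht|t ht].
    by rewrite e; apply: drho; case: (hk (x0 + (t - d) *: w)) => //; apply/inB0/td0.
  rewrite !e subrr scale0r addr0 r0 sub0r => eq.
  rewrite -oppr_gt0 eq mulr_gt0 //.
  have [_] : U (x0 + (t - d) *: w) /\ m <= 'D_w rho (x0 + (t - d) *: w).
    by apply: hk; apply/inB0/td0.
  exact: lt_le_trans.
have cont y : U y -> {for y, continuous rho}.
  by move=> Uy; apply: differentiable_continuous; exact: drho.
have nup : \forall y \near x0 + d *: w, 0 < rho y.
  have := cvgr_gt _ (cont _ (proj1 (hk _ (inB0 _ dd)))) _ up; exact.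
have ndn : \forall y \near x0 + (- d) *: w, rho y < 0.
  have := cvgr_lt _ (cont _ (proj1 (hk _ (inB0 _ ndd)))) _ dn; exact.
move: nup ndn => /nbhs_ballP[ku /= ku0 bku] /nbhs_ballP[kd /= kd0 bkd].
pose r := Num.min (k / 2) (Num.min ku kd).
have rp : 0 < r by rewrite !lt_min divr_gt0 //= ku0.
have sol p : `|p| < r -> exists s : R, `|s| <= d /\ rho (x0 + p + s *: w) = 0.
  rewrite !lt_min => /and3P[p1 p2 p3].
  have dle : - d <= d by rewrite ge0_cp // ltW.
  have cw : {within `[- d, d], continuous (fun s : R => rho (x0 + p + s *: w))}.
    apply: derivable_within_continuous => s; rewrite in_itv /= -ler_norml => hs.
    have [] // : is_derive s (1 : R) (fun s => rho (x0 + p + s *: w))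
       ('D_w rho (x0 + p + s *: w)).
    by apply: is_derive_comp_line; apply: drho; case: (hk _ (inB _ _ p1 hs)).
  have lo : rho (x0 + p + (- d) *: w) < 0.
    by apply: bkd; rewrite -ball_normE /ball_ /= [x0 + p + _]addrAC opprD addrA subrr add0r normrN.
  have hi : 0 < rho (x0 + p + d *: w).
    by apply: bku; rewrite -ball_normE /ball_ /= [x0 + p + _]addrAC opprD addrA subrr add0r normrN.
  have [|s] := IVT dle cw (v := 0).
    by rewrite ge_min le_max (ltW lo) (ltW hi) /= orbT.
  by rewrite in_itv /= -ler_norml => hs e; exists s.
exists r => // v hv.
have tv (t : R) : -1 <= t <= 1 -> `|t *: v| < r.
  rewrite -ler_norml => ht; rewrite normrZ (le_lt_trans _ hv) //.
  by rewrite ler_piMl.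
pose s t := if pselect (`|t *: v| < r) is left h then projT1 (cid (sol _ h)) else 0.
have sP t : `|t *: v| < r ->
    `|s t| <= d /\ rho (x0 + t *: v + s t *: w) = 0.
  by move=> ht; rewrite /s; case: pselect => // h; case: cid.
have rk t : `|t *: v| < r -> `|t *: v| < k / 2.
  by rewrite lt_min => /andP[].
have Bs t : `|t *: v| < r -> B (x0 + t *: v + s t *: w).
  by move=> h; apply: inB; [exact: rk | case: (sP t h)].
have uniq t s' : `|t *: v| < r -> `|s'| <= d -> rho (x0 + t *: v + s' *: w) = 0 ->
    s' = s t.
  move=> ht hs' e; have [hs es] := sP t ht.
  have e' : x0 + t *: v + s' *: w + (s t - s') *: w = x0 + t *: v + s t *: w.
    by rewrite -addrA -scalerDl addrCA subrr addr0.
  have := grow (x0 + t *: v + s' *: w) (s t - s').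
  rewrite e' e es subrr normr0 => /(_ (inB _ _ (rk _ ht) hs') (Bs _ ht)).
  rewrite pmulr_rle0 // normr_le0 subr_eq0 => /eqP; exact: esym.
pose c t := x0 + t *: v + s t *: w.
have s0 : s 0 = 0.
  by apply: esym; apply: uniq; rewrite ?scale0r ?normr0 ?addr0 ?ltW.
have c0 : c 0 = x0 by rewrite /c s0 !scale0r !addr0.
have ds (t : R) : -1 <= t <= 1 ->
    is_derive t (1 : R) s (- 'D_v rho (c t) / 'D_w rho (c t)).
  move=> ht; have htv := tv t ht; have Bz := Bs _ htv.
  have [Uz mz] := hk _ Bz; have [_ rz] := sP t htv.
  rewrite -/(c t) in Bz Uz mz rz.
  set ds := _ / _; pose v' := v + ds *: w.
  have Dv' : 'D_v' rho (c t) = 0.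
    rewrite /v' addrC derive_linear; last exact: drho.
    by rewrite divfK ?addNr // gt_eqF // (lt_le_trans m0).
  have dg : is_derive 0 (1 : R) (fun q => rho (c t + q *: v')) 0.
    have := @is_derive_comp_line _ _ rho (c t) v' 0.
    by rewrite scale0r addr0 Dv'; apply; exact: drho.
  apply/is_derive_eps => e e0.
  have nB : \forall q \near (0 : R), B (c t + q *: v').
    have cb : {for (0 : R), continuous (fun q : R => `|c t + q *: v' - x0| : R)}.
      apply: continuous_comp; last exact: norm_continuous.
      apply: continuousB; last exact: cst_continuous.
      have [dl _] := is_derive_line (c t) v' 0.
      exact/differentiable_continuous/derivable1_diffP.
    by apply: (cvgr_lt _ cb); rewrite scale0r addr0.
  have nr : \forall q \near (0 : R), `|(q + t) *: v| < r.
    have cb : {for (0 : R), continuous (fun q : R => `|(q + t) *: v| : R)}.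
      apply: continuous_comp; last exact: norm_continuous.
      have e1 : (fun q => (q + t) *: v) = (fun q => t *: v + q *: v).
        by apply/funext => q; rewrite scalerDl addrC.
      rewrite e1; have [dl _] := is_derive_line (t *: v) v 0.
      exact/differentiable_continuous/derivable1_diffP.
    by apply: (cvgr_lt _ cb); rewrite add0r.
  have em : 0 < m * e by rewrite mulr_gt0.
  have ng := (is_derive_eps _ _ _).1 dg (m * e) em.
  apply: filterS3 nB nr ng => q qB qr.
  rewrite scale0r !addr0 rz subr0 mulr0 subr0 => hq.
  have e1 : c t + q *: v' + (s (q + t) - s t - q * ds) *: w = c (q + t).
    rewrite /c /v' scalerDr scalerA !scalerBl scalerDl.
    move: (t *: v) (q *: v) (s (q + t) *: w) (s t *: w) => A A' S S'.
    rewrite -[S - S' - _]addrA -opprD [x0 + A + S' + _]addrACA [LHS]addrACA subrr addr0.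
    by rewrite -[x0 + A + _]addrA [A + _]addrC.
  have := grow (c t + q *: v') (s (q + t) - s t - q * ds) qB.
  rewrite e1 => /(_ (Bs _ qr)).
  have [_ ->] := sP _ qr; rewrite sub0r normrN => h.
  by rewrite -(ler_pM2l m0) (mulrA m e); exact: le_trans h hq.
have dc (t : R) : -1 <= t <= 1 -> is_derive t (1 : R) c
    (v + (- 'D_v rho (c t) / 'D_w rho (c t)) *: w).
  move=> ht; apply: is_deriveD; first exact: is_derive_line.
  exact/is_derive_scalel/ds.
have z01 : -1 <= (0 : R) <= 1 by rewrite lerN10 ler01.
exists c; split => //.
- move=> t ht; have Ut : U (c t) by case: (hk _ (Bs _ (tv t ht))).
  have [_ ect] := sP t (tv t ht); split=> //.
  have Dw0 : 'D_w rho (c t) != 0.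
    by case: (hk _ (Bs _ (tv t ht))) => _ /(lt_le_trans m0) /lt0r_neq0.
  exists (v + (- 'D_v rho (c t) / 'D_w rho (c t)) *: w); first exact: dc.
  rewrite addrC derive_linear; last exact: drho.
  by rewrite divfK // addNr.
- move=> Dv; have := dc 0 z01.
  by rewrite c0 Dv oppr0 mul0r scale0r addr0.
- move=> e; rewrite /c; have t1 : `|1 *: v| < r by rewrite scale1r.
  rewrite -(uniq 1 0) ?scale1r ?scale0r ?addr0 ?normr0 ?ltW //.
Unshelve. all: by end_near. Qed.
End LevelCurve.

Lemma level_curves (R : realType) (V : normedModType R) (U : set V)
    (rho : V -> R^o) (x0 w : V) :
  open U -> smooth U rho -> U x0 -> rho x0 = 0 -> 'D_w rho x0 != 0 ->
  exists2 r : R, 0 < r & forall v, `|v| < r -> exists c : R -> V,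
    [/\ c 0 = x0,
        forall t, -1 <= t <= 1 -> [/\ U (c t), rho (c t) = 0
          & exists2 v', is_derive t (1 : R) c v' & 'D_v' rho (c t) = 0],
        'D_v rho x0 = 0 -> is_derive 0 (1 : R) c v
      & rho (x0 + v) = 0 -> c 1 = x0 + v].
Proof.
move=> oU srho Ux0 r0; rewrite neq_lt => /orP[Dw|]; last exact: level_curves_pos.
apply: (@level_curves_pos _ _ _ _ _ (- w)) => //.
have := derive_linear (smooth_differentiable srho Ux0) (-1) w 0.
by rewrite addr0 scaleN1r derive0 addr0 mulN1r => ->; rewrite oppr_gt0.
Qed.

Lemma exchange_big_pairs (R : realType) (m p : nat)
    (F : 'I_m -> 'I_p -> 'I_m -> 'I_p -> R) :
  \sum_i \sum_j \sum_k \sum_l F i j k l =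
  \sum_k \sum_l \sum_i \sum_j F i j k l.
Proof.
rewrite (eq_bigr (fun i => \sum_k \sum_j \sum_l F i j k l)); last first.
  by move=> i _; exact: exchange_big.
rewrite exchange_big; apply: eq_bigr => k _.
rewrite (eq_bigr (fun i => \sum_l \sum_j F i j k l)); last first.
  by move=> i _; exact: exchange_big.
exact: exchange_big.
Qed.

Lemma smooth_subset (R : realType) (V W : normedModType R) (U U' : set V)
    (f : V -> W) : U' `<=` U -> smooth U f -> smooth U' f.
Proof.
move=> UU' sf k; move: f {sf}(sf k); elim: k => [|k ih] f /=.
  by move=> h x /UU'; exact: h.
by move=> [h1 h2]; split=> [x /UU'|v]; [exact: h1 | exact: ih].
Qed.

Lemma derive_at_max (R : realType) (f : R -> R) (t d : R) :
  is_derive t (1 : R) f d -> (\forall s \near t, f s <= f t) -> d = 0.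
Proof.
move=> /is_derive_eps df /nbhs_ballP[r /= r0 br].
apply/eqP; apply/negPn/negP => d0.
have e0 : 0 < `|d| / 2 by rewrite divr_gt0 // normr_gt0.
have /nbhs_ballP[r' /= r'0 br'] := df _ e0.
pose m := Num.min r r' / 2.
have m0 : 0 < m by rewrite divr_gt0 // lt_min r0.
have mr : m < r /\ m < r'.
  have : m < Num.min r r' by rewrite ltr_pdivrMr // ltr_pMr ?ltr1n // lt_min r0.
  by rewrite lt_min => /andP.
pose q := Num.sg d * m.
have qn : `|q| = m by rewrite normrM normr_sg d0 mul1r gtr0_norm.
have h1 : f (q + t) <= f t.
  by apply: br; rewrite -ball_normE /ball_ /= opprD addrCA subrr addr0 normrN qn; case: mr.
have : `|f (q + t) - f t - q * d| <= `|d| / 2 * `|q|.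
  by apply: br'; rewrite -ball_normE /ball_ /= sub0r normrN qn; case: mr.
have -> : q * d = `|d| * m by rewrite /q mulrAC -normrEsg.
rewrite qn ler_norml => /andP[h2 _].
have : 0 < `|d| * m by rewrite mulr_gt0 // normr_gt0.
by move: h1 h2; lra.
Qed.

(** * The jet of a defining function along the hypersurface *)

Section Jets.
Variables (R : realType) (n : nat).
Local Notation V := (Hspace R n).
Local Notation dmx i j := (delta_mx i j : V).

(** N, h and T are the first three differentials of a defining function.
    [jet_max] and [jet_const] are the two ways in which M being a hypersurface
    is used: at a maximum along M the differential vanishes on tangent vectors,
    and a function whose differential vanishes on all tangent vectors is
    constant along M near x.  In [jet_const] the neighbourhood depends on O
    only, so that it serves a whole family of functions F. *)
Record hypersurface_jet (M U : set V) (N : V -> V -> R)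
    (h : V -> V -> V -> R) (T : V -> V -> V -> V -> R) : Prop := {
  jet_open : open U;
  jet_Nlin : forall y a u v, N y (a *: u + v) = a * N y u + N y v;
  jet_hlin : forall y a u v w, h y (a *: u + v) w = a * h y u w + h y v w;
  jet_hlinr : forall y a u v w, h y w (a *: u + v) = a * h y w u + h y w v;
  jet_hsym : forall y, U y -> forall u v, h y u v = h y v u;
  jet_Tsym : forall y, U y -> forall u v w, T y u v w = T y v u w;
  jet_Tsymr : forall y, U y -> forall u v w, T y u v w = T y u w v;
  jet_dN : forall y, U y -> forall v,
    has_diff (fun y => N y v) y (fun Y => h y Y v);
  jet_dh : forall y, U y -> forall u v,
    has_diff (fun y => h y u v) y (fun Y => T y Y u v);
  jet_neq0 : forall y, M y -> U y -> exists v, N y v != 0;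
  jet_max : forall x, M x -> U x -> forall (F : V -> R^o) dF Y,
    has_diff F x dF -> (\forall y \near x, M y -> F y <= F x) -> N x Y = 0 ->
    dF Y = 0;
  jet_const : forall x, M x -> U x -> forall O : set V, nbhs x O ->
    \forall y \near x, M y -> forall (F : V -> R^o) dF,
      (forall z, M z -> O z -> has_diff F z (dF z) /\
         forall Y, N z Y = 0 -> dF z Y = 0) -> F y = F x
}.

(** Hence an identity that holds only along M may be differentiated in tangent
    directions. *)
Lemma jet_tangent M U N h T x : hypersurface_jet M U N h T -> M x -> U x ->
  forall (F : V -> R^o) dF Y, has_diff F x dF ->
    (\forall y \near x, M y -> F y = 0) -> N x Y = 0 -> dF Y = 0.
Proof.
move=> jet Mx Ux F dF Y hF F0; apply: (jet_max jet Mx Ux hF).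
have Fx := nbhs_singleton F0 Mx.
by apply: filterS F0 => y F0y /F0y ->; rewrite Fx.
Qed.

Variable rho : V -> R^o.

(** The differentials are expanded in coordinates, which makes them multilinear
    at every point, including those where rho is not differentiable. *)
Definition jetN y (v : V) : R := \sum_i \sum_j v i j * 'D_(dmx i j) rho y.
Definition jeth y (u v : V) : R := \sum_i \sum_j \sum_k \sum_l
  u i j * v k l * 'D_(dmx i j) (fun y => 'D_(dmx k l) rho y : R^o) y.
Definition jetT y (Y u v : V) : R := \sum_i \sum_j \sum_k \sum_l
  u i j * v k l * 'D_Y
   (fun y => 'D_(dmx i j) (fun y => 'D_(dmx k l) rho y : R^o) y : R^o) y.

Lemma derive_coord (F : V -> R^o) y v : differentiable F y ->
  'D_v F y = \sum_i \sum_j v i j * 'D_(dmx i j) F y.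
Proof.
move=> d; rewrite deriveE // [X in 'd F y X]matrix_sum_delta linear_sum.
apply: eq_bigr => i _; rewrite linear_sum; apply: eq_bigr => j _.
by rewrite linearZ /= deriveE.
Qed.

Variables (M U : set V).
Hypothesis def : defining_function M U rho.

Let oU : open U. Proof. by case: def. Qed.
Let srho : smooth U rho. Proof. by case: def. Qed.
Let drho y : U y -> differentiable rho y. Proof. exact: smooth_differentiable. Qed.
Let s1 v : smooth U (fun y => 'D_v rho y : R^o). Proof. exact: smooth_derive. Qed.
Let s2 u v : smooth U (fun y => 'D_u (fun y => 'D_v rho y : R^o) y : R^o).
Proof. exact/smooth_derive/s1. Qed.
Let d1 v y : U y -> differentiable (fun y => 'D_v rho y : R^o) y.
Proof. exact/smooth_differentiable/s1. Qed.
Let d2 u v y : U y ->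
  differentiable (fun y => 'D_u (fun y => 'D_v rho y : R^o) y : R^o) y.
Proof. exact/smooth_differentiable/s2. Qed.

Lemma jetNE y v : U y -> jetN y v = 'D_v rho y.
Proof. by move=> Uy; rewrite /jetN -derive_coord //; exact: drho. Qed.

Lemma jet_defining : hypersurface_jet M U jetN jeth jetT.
Proof.
have hE y u v : U y -> jeth y u v =
    \sum_i \sum_j v i j * 'D_u (fun y => 'D_(dmx i j) rho y : R^o) y.
  move=> Uy; rewrite /jeth exchange_big_pairs.
  apply: eq_bigr => k _; apply: eq_bigr => l _.
  rewrite (derive_coord _ (d1 _ Uy)) mulr_sumr; apply: eq_bigr => i _.
  by rewrite mulr_sumr; apply: eq_bigr => j _; rewrite mulrCA mulrA.
split; first exact: oU.
- move=> y a u v; rewrite /jetN mulr_sumr -big_split /=; apply: eq_bigr => i _.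
  rewrite mulr_sumr -big_split /=; apply: eq_bigr => j _.
  by rewrite !mxE mulrDl mulrA.
- move=> y a u v w; rewrite /jeth mulr_sumr -big_split /=; apply: eq_bigr => i _.
  rewrite mulr_sumr -big_split /=; apply: eq_bigr => j _.
  rewrite mulr_sumr -big_split /=; apply: eq_bigr => k _.
  rewrite mulr_sumr -big_split /=; apply: eq_bigr => l _.
  by rewrite !mxE !mulrDl !mulrA.
- move=> y a u v w; rewrite /jeth mulr_sumr -big_split /=; apply: eq_bigr => i _.
  rewrite mulr_sumr -big_split /=; apply: eq_bigr => j _.
  rewrite mulr_sumr -big_split /=; apply: eq_bigr => k _.
  rewrite mulr_sumr -big_split /=; apply: eq_bigr => l _.
  by rewrite !mxE !mulrDr !mulrDl !mulrA [w i j * a]mulrC.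
- move=> y Uy u v; rewrite /jeth exchange_big_pairs.
  apply: eq_bigr => k _; apply: eq_bigr => l _.
  apply: eq_bigr => i _; apply: eq_bigr => j _.
  by rewrite (schwarz (dmx i j) (dmx k l) oU srho Uy) (mulrC (v k l) (u i j)).
- move=> y Uy u v w.
  have TE u' v' : jetT y u' v' w = \sum_k \sum_l w k l *
      'D_v' (fun y => 'D_u' (fun y => 'D_(dmx k l) rho y : R^o) y : R^o) y.
    rewrite /jetT exchange_big_pairs; apply: eq_bigr => k _; apply: eq_bigr => l _.
    transitivity (w k l * \sum_i \sum_j v' i j * 'D_(dmx i j)
        (fun y => 'D_u' (fun y => 'D_(dmx k l) rho y : R^o) y : R^o) y); last first.
      by apply: congr1; apply: esym; apply: derive_coord; exact: d2.
    rewrite mulr_sumr; apply: eq_bigr => i _.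
    rewrite mulr_sumr; apply: eq_bigr => j _.
    rewrite (mulrC (v' i j)) -mulrA; do 2!apply: congr1.
    exact: (schwarz _ _ oU (s1 (dmx k l)) Uy).
  rewrite !TE; apply: eq_bigr => k _; apply: eq_bigr => l _; apply: congr1.
  exact: (schwarz _ _ oU (s1 (dmx k l)) Uy).
- move=> y Uy u v w; rewrite /jetT exchange_big_pairs.
  apply: eq_bigr => k _; apply: eq_bigr => l _.
  apply: eq_bigr => i _; apply: eq_bigr => j _.
  rewrite (mulrC (w k l) (v i j)); apply: congr1; apply: near_eq_derive.
  have nU : \forall z \near y, U z by apply: open_nbhs_nbhs.
  by apply: filterS nU => z; exact: schwarz.
- move=> y Uy v.
  apply: (@eq_has_diff _ _ _ _ _ _ (fun Y => esym (hE y Y v Uy))).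
  apply: has_diff_sum => i; apply: has_diff_sum => j; apply: has_diffZ.
  exact/has_diff_derive/d1.
- move=> y Uy u v; do 4!(apply: has_diff_sum => ?); apply: has_diffZ.
  exact/has_diff_derive/d2.
- move=> y My Uy; case: def => _ _ _ /(_ y Uy My)[v Dv].
  by exists v; rewrite jetNE.
- move=> x Mx Ux F dF Y hF Fx0; rewrite jetNE // => NY.
  have [_ _ zM /(_ x Ux Mx)[w Dw]] := def.
  have rx : rho x = 0 by apply/(zM x Ux).
  have [r r0 hr] := level_curves oU srho Ux rx Dw.
  pose a := r / 2 / (1 + `|Y|).
  have Y1 : 0 < 1 + `|Y| by rewrite ltr_pwDl.
  have a0 : 0 < a by rewrite !divr_gt0.
  have aY : `|a *: Y| < r.
    rewrite normrZ gtr0_norm // (@le_lt_trans _ _ (a * (1 + `|Y|))) //.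
      by rewrite ler_wpM2l ?ltW // ltrDr.
    by rewrite divfK ?gt_eqF // ltr_pdivrMr // mulr2n mulrDr mulr1 ltrDr.
  have [c [c0 hc c' _]] := hr _ aY.
  have DaY : 'D_(a *: Y) rho x = 0.
    by rewrite deriveE ?linearZ /= -?deriveE ?NY ?scaler0 //; exact: drho.
  have dc := c' DaY; rewrite -c0 in hF.
  have dFc := has_diff_curve hF dc.
  have cc : {for (0 : R), continuous c}.
    by have [d _] := dc; apply/differentiable_continuous/derivable1_diffP.
  have nI : \forall t \near (0 : R), -1 <= t <= 1.
    have : \forall t \near (0 : R), `|t| < 1 by exact: nbhs0_lt.
    by apply: filterS => t; rewrite -ler_norml => /ltW.
  have nF : \forall t \near (0 : R), F (c t) <= F (c 0).
    have : \forall t \near (0 : R), M (c t) -> F (c t) <= F x.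
      by move: Fx0; rewrite -c0 => /cc.
    move=> h; apply: filterS2 h nI => t h /hc[Uc rc _].
    by rewrite c0; apply: h; apply/(zM _ Uc).
  have : dF (a *: Y) = 0 by exact: derive_at_max dFc nF.
  case: hF => dF1 dF2; rewrite -!dF2 deriveE // linearZ /= -deriveE // => /eqP.
  by rewrite scaler_eq0 gt_eqF //= => /eqP.
- move=> x Mx Ux O nO.
  have [_ _ zM /(_ x Ux Mx)[w Dw]] := def.
  have rx : rho x = 0 by apply/(zM x Ux).
  pose U' := U `&` O^°.
  have oU' : open U' by apply: openI => //; exact: open_interior.
  have sU' : smooth U' rho by apply: smooth_subset srho => y [].
  have Ux' : U' x by [].
  have [r r0 hr] := level_curves oU' sU' Ux' rx Dw.
  have nU : \forall z \near x, U z by apply: open_nbhs_nbhs.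
  have nr : \forall z \near x, `|z - x| < r.
    have : \forall z \near x, ball x r z by exact: nbhsx_ballx.
    by apply: filterS => z; rewrite -ball_normE /ball_ /= distrC.
  apply: filterS2 nU nr => y Uy yr My F dF hF.
  have [c [c0 hc _ c1]] := hr _ yr.
  have {}c1 : c 1 = y.
    by rewrite c1; rewrite addrC subrK //; apply/(zM y Uy).
  have dFc (t : R) : 0 <= t <= 1 -> is_derive t (1 : R) (fun t => F (c t) : R^o) 0.
    move=> /andP[t0 t1].
    have [|[Uc Oc] rc [v dc Dv]] := hc t.
      by rewrite t1 andbT (le_trans _ t0) // lerN10.
    have Mc : M (c t) by apply/(zM _ Uc).
    have [hF1 /(_ v)] := hF _ Mc (interior_subset Oc).
    by rewrite jetNE // => <- //; exact: has_diff_curve hF1 dc.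
  have [||t _] := @MVT_segment _ (fun t => F (c t)) (fun=> 0) 0 1 ler01.
  - by move=> t; rewrite in_itv /= => /andP[a b]; apply: dFc; rewrite !ltW.
  - apply: derivable_within_continuous => s; rewrite in_itv /= => hs.
    by case: (dFc _ hs).
  - by rewrite c0 c1 mul0r => /eqP; rewrite subr_eq0 => /eqP.
Qed.
End Jets.

(** * Decomposition of a symmetric form along the horizontal space *)

Section Linear.
Variables (R : realType) (V : lmodType R).

Definition linear_form (f : V -> R) :=
  forall a u v, f (a *: u + v) = a * f u + f v.

Lemma lfD f : linear_form f -> forall u v, f (u + v) = f u + f v.
Proof. by move=> h u v; have := h 1 u v; rewrite scale1r mul1r. Qed.
Lemma lf0 f : linear_form f -> f 0 = 0.
Proof. by move=> h; apply: (addrI (f 0)); rewrite -lfD // !addr0. Qed.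
Lemma lfZ f : linear_form f -> forall a u, f (a *: u) = a * f u.
Proof. by move=> h a u; rewrite -[a *: u]addr0 h lf0 // addr0. Qed.
Lemma lfN f : linear_form f -> forall u, f (- u) = - f u.
Proof. by move=> h u; rewrite -scaleN1r lfZ // mulN1r. Qed.
Definition lfE f (h : linear_form f) := (lfD h, lfZ h, lfN h, lf0 h).

Record quaternionic_triple (A B C : V -> V) : Prop := {
  qtA : forall a u v, A (a *: u + v) = a *: A u + A v;
  qtB : forall a u v, B (a *: u + v) = a *: B u + B v;
  qtC : forall a u v, C (a *: u + v) = a *: C u + C v;
  qtAA : forall u, A (A u) = - u;
  qtBB : forall u, B (B u) = - u;
  qtCC : forall u, C (C u) = - u;
  qtAB : forall u, A (B u) = C u;
  qtBC : forall u, B (C u) = A u;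
  qtCA : forall u, C (A u) = B u;
  qtBA : forall u, B (A u) = - C u;
  qtCB : forall u, C (B u) = - A u;
  qtAC : forall u, A (C u) = - B u }.

Lemma lmD (f : V -> V) : (forall a u v, f (a *: u + v) = a *: f u + f v) ->
  forall u v, f (u + v) = f u + f v.
Proof. by move=> h u v; have := h 1 u v; rewrite !scale1r. Qed.
Lemma lm0 (f : V -> V) : (forall a u v, f (a *: u + v) = a *: f u + f v) ->
  f 0 = 0.
Proof. by move=> h; apply: (addrI (f 0)); rewrite -lmD // !addr0. Qed.
Lemma lmZ (f : V -> V) : (forall a u v, f (a *: u + v) = a *: f u + f v) ->
  forall a u, f (a *: u) = a *: f u.
Proof. by move=> h a u; rewrite -[a *: u]addr0 h lm0 // addr0. Qed.
Lemma lmN (f : V -> V) : (forall a u v, f (a *: u + v) = a *: f u + f v) ->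
  forall u, f (- u) = - f u.
Proof. by move=> h u; rewrite -scaleN1r lmZ // scaleN1r. Qed.

End Linear.

Section Pointwise.
Variables (R : realType) (V : lmodType R) (J1 J2 J3 : V -> V).
Hypothesis Jq : quaternionic_triple J1 J2 J3.
Variables (N : V -> R) (h : V -> V -> R).
Hypotheses (Nl : linear_form N) (hl : forall v, linear_form (h ^~ v))
  (hs : forall u v, h u v = h v u).
Variable w : V.

Let JE := (qtAA Jq, qtBB Jq, qtCC Jq, qtAB Jq, qtBC Jq, qtCA Jq, qtBA Jq,
  qtCB Jq, qtAC Jq).
Let JD := (lmD (qtA Jq), lmD (qtB Jq), lmD (qtC Jq)).
Let JZ := (lmZ (qtA Jq), lmZ (qtB Jq), lmZ (qtC Jq)).
Let JN := (lmN (qtA Jq), lmN (qtB Jq), lmN (qtC Jq)).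
Let NE := lfE Nl.
Let hlE v := (lfD (hl v), lfZ (hl v), lfN (hl v), lf0 (hl v)).
Let hr v : linear_form (h v).
Proof. by move=> a u u'; rewrite hs hl !(hs v). Qed.
Let hrE v := lfE (hr v).

Definition horizontal (X : V) :=
  [/\ N X = 0, N (J1 X) = 0, N (J2 X) = 0 & N (J3 X) = 0].

Lemma horizontal_J X : horizontal X ->
  [/\ horizontal (J1 X), horizontal (J2 X) & horizontal (J3 X)].
Proof.
by move=> [h0 h1 h2 h3]; split; split; rewrite ?JE ?NE ?h0 ?h1 ?h2 ?h3 ?oppr0.
Qed.

(** A vector with N(W) > 0 and N(J_s W) = 0, built from any [w] with N(w) != 0
    without inverting a quaternion: if N = Re nu for a quaternionic covector nu,
    it is w times the conjugate of nu(w).  As w is kept fixed while the point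
    varies, W is as differentiable as N. *)
Definition normal_vec : V :=
  N w *: w + N (J1 w) *: J1 w + N (J2 w) *: J2 w + N (J3 w) *: J3 w.
Definition normal_sq : R :=
  N w ^+ 2 + N (J1 w) ^+ 2 + N (J2 w) ^+ 2 + N (J3 w) ^+ 2.
Local Notation W := normal_vec.
Local Notation n := normal_sq.

Lemma normal_vecE :
  [/\ N W = n, N (J1 W) = 0, N (J2 W) = 0 & N (J3 W) = 0].
Proof.
by rewrite /normal_vec /normal_sq; split; rewrite ?(JD, JZ, JN, JE, NE); ring.
Qed.

Definition vert (u : V) : V :=
  n^-1 *: (N u *: W - N (J1 u) *: J1 W - N (J2 u) *: J2 W - N (J3 u) *: J3 W).
Definition hproj (u : V) : V := u - vert u.

Hypothesis n0 : n != 0.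

Lemma horizontal_hproj u : horizontal (hproj u).
Proof.
rewrite /horizontal /hproj /vert; move: normal_vecE n0.
move: normal_vec normal_sq => W n [a b c d] n0'.
by split; rewrite ?(JD, JZ, JN, JE, NE) a b c d; field.
Qed.

Lemma hproj_horizontal X : horizontal X -> hproj X = X.
Proof.
move=> [a b c d].
by rewrite /hproj /vert a b c d !scale0r !subr0 scaler0 subr0.
Qed.

Lemma hprojJ u : [/\ hproj (J1 u) = J1 (hproj u), hproj (J2 u) = J2 (hproj u)
  & hproj (J3 u) = J3 (hproj u)].
Proof.
rewrite /hproj /vert; move: normal_vec normal_sq => W n.
rewrite ?(JD, JZ, JN, JE, NE) ?scaleNr ?scalerN ?opprK.
split; congr (_ - _ *: _).
- by rewrite [RHS](ACl (2*1*4*3)).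
- by rewrite [RHS](ACl (3*4*1*2)).
- by rewrite [RHS](ACl (4*3*2*1)).
Qed.

Lemma hproj_lin a u v : hproj (a *: u + v) = a *: hproj u + hproj v.
Proof.
rewrite /hproj /vert; move: normal_vec normal_sq => W n.
rewrite !(JD, JZ, NE) [in RHS]scalerBr [RHS]addrACA -opprD; congr (_ - _).
rewrite (scalerA a n^-1) (mulrC a n^-1) -(scalerA n^-1 a) -scalerDr; congr (_ *: _).
rewrite !scalerBr !scalerA !scalerDl !opprD.
by rewrite !addrA [LHS](ACl (1*3*5*7*2*4*6*8)).
Qed.

(** The coefficients of N u, N (J_1 u), ... in [decompose].  Averaging v with its
    horizontal part shares the terms without horizontal component equally
    between u and v. *)
Definition mult0 v := n^-1 * h W (2^-1 *: (v + hproj v)).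
Definition mult1 v := - (n^-1 * h (J1 W) (2^-1 *: (v + hproj v))).
Definition mult2 v := - (n^-1 * h (J2 W) (2^-1 *: (v + hproj v))).
Definition mult3 v := - (n^-1 * h (J3 W) (2^-1 *: (v + hproj v))).

Lemma mult_horizontal X : horizontal X ->
  [/\ mult0 X = n^-1 * h W X, mult1 X = - (n^-1 * h (J1 W) X),
      mult2 X = - (n^-1 * h (J2 W) X) & mult3 X = - (n^-1 * h (J3 W) X)].
Proof.
move=> hX; rewrite /mult0 /mult1 /mult2 /mult3 hproj_horizontal //.
have -> : 2^-1 *: (X + X) = X; last by [].
by rewrite scalerDr -scalerDl (_ : 2^-1 + 2^-1 = 1) ?scale1r //; field.
Qed.

Lemma hprojK u : u = hproj u + n^-1 *:
  (N u *: W - N (J1 u) *: J1 W - N (J2 u) *: J2 W - N (J3 u) *: J3 W).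
Proof. by rewrite /hproj subrK. Qed.

(** Any symmetric form is its horizontal part plus terms that contain one of the
    factors N (J_a u), N (J_a v), which vanish on horizontal vectors. *)
Lemma decompose u v : h u v = h (hproj u) (hproj v)
  + (N u * mult0 v + N v * mult0 u) + (N (J1 u) * mult1 v + N (J1 v) * mult1 u)
  + (N (J2 u) * mult2 v + N (J2 v) * mult2 u)
  + (N (J3 u) * mult3 v + N (J3 v) * mult3 u).
Proof.
rewrite /mult0 /mult1 /mult2 /mult3.
have := hprojK u; have := hprojK v.
move: (hproj u) (hproj v) n0 => p q; move: normal_vec normal_sq => W n n0' ev eu.
move: ev eu.
move: (N u) (N (J1 u)) (N (J2 u)) (N (J3 u)) => a0 a1 a2 a3.
move: (N v) (N (J1 v)) (N (J2 v)) (N (J3 v)) => b0 b1 b2 b3 -> ->.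
move: (J1 W) (J2 W) (J3 W) => W1 W2 W3.
rewrite !(hlE, hrE).
rewrite ?(hs p W) ?(hs p W1) ?(hs p W2) ?(hs p W3).
rewrite ?(hs q W) ?(hs q W1) ?(hs q W2) ?(hs q W3).
by rewrite ?(hs W1 W) ?(hs W2 W) ?(hs W3 W) ?(hs W2 W1) ?(hs W3 W1) ?(hs W3 W2); field.
Qed.

Hypothesis hJ : forall X, horizontal X ->
  [/\ h X (J1 X) = 0, h X (J2 X) = 0 & h X (J3 X) = 0].

Lemma horizontalD X Y : horizontal X -> horizontal Y -> horizontal (X + Y).
Proof.
move=> [a b c d] [a' b' c' d'].
by split; rewrite ?JD !NE ?a ?b ?c ?d ?a' ?b' ?c' ?d' addr0.
Qed.

(** Polarising the quadratic conditions turns them into invariance. *)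
Lemma horizontal_invariant X Y : horizontal X -> horizontal Y ->
  [/\ h (J1 X) (J1 Y) = h X Y, h (J2 X) (J2 Y) = h X Y
    & h (J3 X) (J3 Y) = h X Y].
Proof.
move=> hX hY; have [hY1 hY2 hY3] := horizontal_J hY.
have [a _ _] := hJ (horizontalD hX hY1).
have [_ b _] := hJ (horizontalD hX hY2).
have [_ _ c] := hJ (horizontalD hX hY3).
have [a1 b1 c1] := hJ hX; have [a2 _ _] := hJ hY1; have [_ b2 _] := hJ hY2.
have [_ _ c2] := hJ hY3.
move: a a2 b b2 c c2; rewrite !(JD, JE) !(hlE, hrE) a1 b1 c1.
rewrite (hs (J1 Y) (J1 X)) (hs (J2 Y) (J2 X)) (hs (J3 Y) (J3 X)).
by move=> *; split; lra.
Qed.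

(** The invariant part of h agrees with h on horizontal vectors and is extended
    to the quaternionic line of W by invariance, starting from the values
    h(J_1 W, J_1 X) for X horizontal and h(J_1 W, J_1 W).  The values
    h(W, .) are of no use for this purpose: W is transversal to M, and they can
    be changed at will by the choice of the defining function. *)
Definition mixed_form X := h (J1 W) (J1 X).
Definition normal_value := h (J1 W) (J1 W).

Definition invariant_part u v :=
  h (hproj u) (hproj v)
  + n^-1 * (N u * mixed_form (hproj v) + N (J1 u) * mixed_form (J1 (hproj v))
    + N (J2 u) * mixed_form (J2 (hproj v)) + N (J3 u) * mixed_form (J3 (hproj v)))
  + n^-1 * (N v * mixed_form (hproj u) + N (J1 v) * mixed_form (J1 (hproj u))
    + N (J2 v) * mixed_form (J2 (hproj u)) + N (J3 v) * mixed_form (J3 (hproj u)))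
  + normal_value * n^-1 ^+ 2 * (N u * N v + N (J1 u) * N (J1 v) + N (J2 u) * N (J2 v)
    + N (J3 u) * N (J3 v)).

Definition transversal_part v := n^-1 * (h W (hproj v) - mixed_form (hproj v))
  + n^-1 ^+ 2 * (2^-1 * N v * (h W W - normal_value) - N (J1 v) * h W (J1 W)
      - N (J2 v) * h W (J2 W) - N (J3 v) * h W (J3 W)).

Lemma mixed_form_lin : linear_form mixed_form.
Proof. by move=> a u v; rewrite /mixed_form (qtA Jq) hr. Qed.

Lemma invariant_part_sym u v : invariant_part u v = invariant_part v u.
Proof. by rewrite /invariant_part (hs (hproj v)); ring. Qed.

Lemma invariant_part_lin v : linear_form (fun u => invariant_part u v).
Proof.
move=> a u u'; rewrite /invariant_part hproj_lin !(JD, JZ) !(NE, hlE).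
by rewrite !(lfE mixed_form_lin); ring.
Qed.

Lemma transversal_part_lin : linear_form transversal_part.
Proof.
move=> a u u'; rewrite /transversal_part hproj_lin !(JD, JZ) !(NE, hrE).
by rewrite !(lfE mixed_form_lin); ring.
Qed.

Lemma invariant_part_invariant u v :
  [/\ invariant_part (J1 u) (J1 v) = invariant_part u v,
      invariant_part (J2 u) (J2 v) = invariant_part u v
    & invariant_part (J3 u) (J3 v) = invariant_part u v].
Proof.
have [pu1 pu2 pu3] := hprojJ u; have [pv1 pv2 pv3] := hprojJ v.
have [i1 i2 i3] := horizontal_invariant (horizontal_hproj u) (horizontal_hproj v).
have bN := lfE mixed_form_lin.
split; rewrite /invariant_part ?pu1 ?pu2 ?pu3 ?pv1 ?pv2 ?pv3 ?i1 ?i2 ?i3.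
all: by rewrite !(JE, NE, bN); ring.
Qed.

Hypothesis beta_eq : forall X, horizontal X ->
  h (J2 W) (J2 X) = mixed_form X /\ h (J3 W) (J3 X) = mixed_form X.

(** The last bracket collects the defect of invariance on the span of the J_a W;
    it disappears in [hessian_form]. *)
Lemma normal_form u v : h u v = invariant_part u v
  + N u * transversal_part v + N v * transversal_part u
  + n^-1 ^+ 2 * ((h (J2 W) (J2 W) - normal_value) * (N (J2 u) * N (J2 v))
     + (h (J3 W) (J3 W) - normal_value) * (N (J3 u) * N (J3 v))
     + h (J1 W) (J2 W) * (N (J1 u) * N (J2 v) + N (J1 v) * N (J2 u))
     + h (J1 W) (J3 W) * (N (J1 u) * N (J3 v) + N (J1 v) * N (J3 u))
     + h (J2 W) (J3 W) * (N (J2 u) * N (J3 v) + N (J2 v) * N (J3 u))).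
Proof.
have hX x : horizontal x -> [/\ mixed_form (J1 x) = - h (J1 W) x,
    mixed_form (J2 x) = - h (J2 W) x & mixed_form (J3 x) = - h (J3 W) x].
  move=> hx; have [h1 h2 h3] := horizontal_J hx.
  rewrite -(proj1 (beta_eq h2)) -(proj2 (beta_eq h3)) /mixed_form !JE !hrE.
  by [].
have [u1 u2 u3] := hX _ (horizontal_hproj u).
have [v1 v2 v3] := hX _ (horizontal_hproj v).
rewrite /invariant_part /transversal_part u1 u2 u3 v1 v2 v3 /normal_value.
have := hprojK u; have := hprojK v.
move: (hproj u) (hproj v) n0 (mixed_form (hproj u)) (mixed_form (hproj v)) => p q.
move: normal_vec normal_sq => W n n0' bp bq ev eu; rewrite [in LHS]ev [in LHS]eu.
move: (N u) (N (J1 u)) (N (J2 u)) (N (J3 u)) => a0 a1 a2 a3.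
move: (N v) (N (J1 v)) (N (J2 v)) (N (J3 v)) => b0 b1 b2 b3.
move: (J1 W) (J2 W) (J3 W) => W1 W2 W3.
rewrite !(hlE, hrE).
rewrite ?(hs p W) ?(hs p W1) ?(hs p W2) ?(hs p W3).
rewrite ?(hs q W) ?(hs q W1) ?(hs q W2) ?(hs q W3).
by rewrite ?(hs W1 W) ?(hs W2 W) ?(hs W3 W) ?(hs W2 W1) ?(hs W3 W1) ?(hs W3 W2); field.
Qed.

End Pointwise.

(** * Rigidity of invariant forms *)

Section Rigidity.
Variables (R : realType) (V : lmodType R) (J1 J2 J3 : V -> V).
Hypothesis Jq : quaternionic_triple J1 J2 J3.
Variables (N : V -> R).
Hypothesis Nl : linear_form N.
Variable W : V.
Hypotheses (n0 : N W != 0)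
  (TW : [/\ N (J1 W) = 0, N (J2 W) = 0 & N (J3 W) = 0]).
Local Notation hor := (horizontal J1 J2 J3 N).

Let JE := (qtAA Jq, qtBB Jq, qtCC Jq, qtAB Jq, qtBC Jq, qtCA Jq, qtBA Jq,
  qtCB Jq, qtAC Jq).

Lemma horizontal_split u : exists p, horizontal J1 J2 J3 N p /\
  u = p + (N W)^-1 *: (N u *: W - N (J1 u) *: J1 W - N (J2 u) *: J2 W
                        - N (J3 u) *: J3 W).
Proof.
set v := _ *: _; exists (u - v); split; last by rewrite subrK.
have [a b c] := TW.
split; rewrite /v ?(lmD (qtA Jq), lmD (qtB Jq), lmD (qtC Jq)).
all: rewrite ?(lmN (qtA Jq), lmN (qtB Jq), lmN (qtC Jq)).
all: rewrite ?(lmZ (qtA Jq), lmZ (qtB Jq), lmZ (qtC Jq)).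
all: rewrite ?(lmD (qtA Jq), lmD (qtB Jq), lmD (qtC Jq)).
all: rewrite ?(lmN (qtA Jq), lmN (qtB Jq), lmN (qtC Jq)).
all: rewrite ?(lmZ (qtA Jq), lmZ (qtB Jq), lmZ (qtC Jq)).
all: rewrite ?(JE, lfE Nl) a b c; by field.
Qed.

(** The form of the decomposition used below: it suffices to test a linear form
    on horizontal vectors and on the quaternionic line of W. *)
Lemma linear_form_split (f : V -> R) : linear_form f ->
  (forall X, hor X -> f X = 0) -> f W = 0 -> f (J1 W) = 0 -> f (J2 W) = 0 ->
  f (J3 W) = 0 -> forall u, f u = 0.
Proof.
move=> fl fX f0 f1 f2 f3 u; have [p [hp ->]] := horizontal_split u.
by rewrite !(lfE fl) f0 f1 f2 f3 fX // !mulr0 !subr0 mulr0 addr0.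
Qed.

Let T u := N u = 0.
Let horT X : hor X -> T X. Proof. by case. Qed.

Section Invariant.
Variable B : V -> V -> R.
Hypotheses (Bl : forall v, linear_form (B ^~ v)) (Bs : forall u v, B u v = B v u)
  (Bi : forall u v, [/\ B (J1 u) (J1 v) = B u v, B (J2 u) (J2 v) = B u v
     & B (J3 u) (J3 v) = B u v]).

Lemma linear_form_r v : linear_form (B v).
Proof. by move=> a u u'; rewrite Bs Bl !(Bs v). Qed.

Lemma invariant_skew u : [/\ B u (J1 u) = 0, B u (J2 u) = 0 & B u (J3 u) = 0].
Proof.
have [a b c] : [/\ B u (J1 u) = - B u (J1 u), B u (J2 u) = - B u (J2 u)
    & B u (J3 u) = - B u (J3 u)].
  split.
  - by have [e _ _] := Bi u (J1 u); rewrite -{1}e JE (lfN (linear_form_r _)) Bs.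
  - by have [_ e _] := Bi u (J2 u); rewrite -{1}e JE (lfN (linear_form_r _)) Bs.
  - by have [_ _ e] := Bi u (J3 u); rewrite -{1}e JE (lfN (linear_form_r _)) Bs.
split; lra.
Qed.

Lemma invariant_skewM u v : [/\ B (J1 u) v = - B u (J1 v),
  B (J2 u) v = - B u (J2 v) & B (J3 u) v = - B u (J3 v)].
Proof.
have nr := lfN (linear_form_r _).
have [i1 _ _] := Bi u (J1 v); have [_ i2 _] := Bi u (J2 v).
have [_ _ i3] := Bi u (J3 v).
by rewrite -i1 -i2 -i3 !JE !nr !opprK.
Qed.

(** Invariance leaves a single free value on the quaternionic line of W. *)
Lemma invariant_normal : [/\ B (J1 W) (J1 W) = B W W, B (J2 W) (J2 W) = B W W
  & B (J3 W) (J3 W) = B W W] /\ [/\ B W (J1 W) = 0, B W (J2 W) = 0 & B W (J3 W) = 0]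
  /\ [/\ B (J1 W) (J2 W) = 0, B (J1 W) (J3 W) = 0 & B (J2 W) (J3 W) = 0].
Proof.
split; first by split; [case: (Bi W W) | case: (Bi W W) | case: (Bi W W)].
split; first exact: invariant_skew.
have [_ _ a] := invariant_skew (J1 W); have [b _ _] := invariant_skew (J2 W).
have [_ c _] := invariant_skew (J1 W).
have [d _ _] := invariant_skew (J2 W).
move: a b c d; rewrite !JE (lfN (linear_form_r _)) => a b c d.
split=> //.
  by apply/eqP; rewrite -oppr_eq0 c.
Qed.

Lemma invariant_eq0 : (forall X Z, hor X -> hor Z -> B X Z = 0) ->
  (forall X, hor X -> [/\ B X (J1 W) = 0, B X (J2 W) = 0 & B X (J3 W) = 0]) ->
  B W W = 0 -> forall u v, B u v = 0.
Proof.
move=> BX BXW BW.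
have [[a1 a2 a3] [[b1 b2 b3] [c1 c2 c3]]] := invariant_normal.
have BX0 X : hor X -> B X W = 0.
  move=> hX; have [<- _ _] := Bi X W.
  by have [h1 _ _] := horizontal_J Jq Nl hX; case: (BXW _ h1).
have Bv v : [/\ B W v = 0, B (J1 W) v = 0, B (J2 W) v = 0 & B (J3 W) v = 0].
  split; apply: linear_form_split; rewrite ?a1 ?a2 ?a3 ?b1 ?b2 ?b3 ?c1 ?c2 ?c3 ?BW //;
  try exact: linear_form_r; try by (rewrite Bs ?b1 ?b2 ?b3 ?c1 ?c2 ?c3).
  1-4: by move=> X hX; rewrite Bs; first [exact: BX0 | case: (BXW _ hX)].
move=> u v; apply: (linear_form_split (Bl v)); try by case: (Bv v).
move=> X hX; apply: linear_form_split; try by case: (BXW _ hX).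
- exact: linear_form_r.
- by move=> Z; exact: BX.
- exact: BX0.
Qed.

End Invariant.

Variable C : V -> V -> V -> R.
Hypotheses (Cl : forall u v, linear_form (fun Y => C Y u v))
  (Cl2 : forall Y v, linear_form (fun u => C Y u v))
  (Cs : forall Y u v, C Y u v = C Y v u)
  (Ci : forall Y, N Y = 0 -> forall u v, [/\ C Y (J1 u) (J1 v) = C Y u v,
     C Y (J2 u) (J2 v) = C Y u v & C Y (J3 u) (J3 v) = C Y u v])
  (Ct : forall X Y Z, N X = 0 -> N Y = 0 -> N Z = 0 -> C X Y Z = C Y X Z).

(** For X, Z horizontal, C(X, Z, J_s X) = C(Z, X, J_s X) = 0, since an invariant
    symmetric form vanishes on (X, J_s X); by polarisation and symmetry C is
    zero as soon as two arguments are horizontal.  The same exchange with J_s W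
    in place of one of the arguments reduces the remaining values to those on
    the quaternionic line of W, which [invariant_normal] and one more exchange
    make equal to zero.  All exchanges take place in ker N, which contains J_s W
    but not W. *)
Lemma prolongation_eq0 Y u v : N Y = 0 -> C Y u v = 0.
Proof.
have Cl3 Y' w' := linear_form_r (Cl2 Y') (Cs Y') w'.
have hJ X := @horizontal_J _ _ _ _ _ Jq _ Nl X.
have Sk Z v' : T Z -> _ := fun h => invariant_skew (Cl2 Z) (Cs Z) (Ci h) v'.
have SM Z x y : T Z -> _ := fun h => invariant_skewM (Cl2 Z) (Cs Z) (Ci h) x y.
have IN Z : T Z -> _ := fun h => invariant_normal (Cl2 Z) (Cs Z) (Ci h).
have E0 Z : T Z -> _ := fun h => invariant_eq0 (Cl2 Z) (Cs Z) (Ci h).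
have [T1 T2 T3] := TW.
have D X v' : hor X -> C X v' X = 0.
  move=> hX; have TX := horT hX; have [h1 h2 h3] := hJ X hX.
  have key Z : T Z -> [/\ C X Z (J1 X) = 0, C X Z (J2 X) = 0 & C X Z (J3 X) = 0].
    move=> TZ; have [a b c] := Sk _ X TZ.
    by rewrite !(Ct TX TZ) ?a ?b ?c //; exact: horT.
  have key2 Z : T Z -> [/\ C X (J1 Z) X = 0, C X (J2 Z) X = 0 & C X (J3 Z) X = 0].
    move=> TZ; have [a b c] := SM _ Z X TX; have [a' b' c'] := key _ TZ.
    by rewrite a b c a' b' c' oppr0.
  apply: (linear_form_split (f := fun v' => C X v' X)); first exact: Cl2.
  - move=> Z hZ; have [k1 k2 k3] := hJ Z hZ.
    have [a _ _] := key2 _ (horT k1); move: a; rewrite JE (lfN (Cl2 _ _)).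
    by move/eqP; rewrite oppr_eq0 => /eqP.
  - have [a _ _] := key2 _ T1; move: a; rewrite JE (lfN (Cl2 _ _)).
    by move/eqP; rewrite oppr_eq0 => /eqP.
  - by have [_ a _] := key2 _ T3; move: a; rewrite JE.
  - by have [_ _ a] := key2 _ T1; move: a; rewrite JE.
  - by have [a _ _] := key2 _ T2; move: a; rewrite JE.
have D1 X Z v' : hor X -> hor Z -> T v' -> C X v' Z = 0.
  move=> hX hZ Tv.
  have := D (X + Z) v' (horizontalD Jq Nl hX hZ).
  rewrite (lfD (Cl _ _)) !(lfD (Cl3 _ _)) !D // add0r addr0.
  by rewrite (Ct (horT hX) Tv (horT hZ)) (Ct (horT hZ) Tv (horT hX)) (Cs v' Z); lra.
have D2 X X' Z : hor X -> hor Z -> T X' -> C X' X Z = 0.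
  by move=> hX hZ TX'; rewrite (Ct TX' (horT hX) (horT hZ)) D1.
have XYY X : hor X -> C X W W = 0.
  move=> hX; have TX := horT hX; have [h1 h2 h3] := hJ X hX.
  have [[<- _ _] _] := IN _ TX.
  rewrite (Ct TX T1 T1).
  have [_ a _] := SM _ X (J1 W) T1.
  have [_ b _] := SM _ (J2 X) (J1 W) T1.
  move: b; rewrite !JE (lfN (Cl2 _ _)) (lfN (Cl3 _ _)) opprK.
  have [_ [_ [_ c _]]] := IN _ (horT h2).
  by rewrite (Ct T1 (horT h2) T3) c => /eqP; rewrite oppr_eq0 => /eqP.
have X0 X : hor X -> forall u v, C X u v = 0.
  move=> hX; have TX := horT hX; apply: E0 => //.
  - by move=> Z Z' hZ hZ'; exact: D1 (horT hZ).
  - by move=> Z hZ; rewrite !(Cs X Z) !D1.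
  - exact: XYY.
move=> TY.
suff : forall Y', T Y' -> C Y' W W = 0 -> C Y' u v = 0.
  move=> H; have R1 : C (J1 W) u v = 0.
    apply: H => //; have [[_ <- _] [_ [c _ _]]] := IN _ T1.
    rewrite (Ct T1 T2 T2) Cs.
    have [_ [_ [d _ _]]] := IN _ T2; by rewrite Cs d.
  have R2 : C (J2 W) u v = 0.
    apply: H => //; have [[<- _ _] [_ [c _ _]]] := IN _ T2.
    rewrite (Ct T2 T1 T1) Cs.
    have [_ [_ [d _ _]]] := IN _ T1; by rewrite d.
  have R3 : C (J3 W) u v = 0.
    apply: H => //; have [[<- _ _] [_ [c _ _]]] := IN _ T3.
    rewrite (Ct T3 T1 T1) Cs.
    have [_ [_ [_ d _]]] := IN _ T1; by rewrite d.
  have [p [hp ->]] := horizontal_split Y; rewrite TY.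
  by rewrite !(lfE (Cl _ _)) R1 R2 R3 X0 // mul0r !mulr0 !subr0 mulr0 addr0.
move=> Y' TY' YW; apply: E0 => //.
- by move=> X Z hX hZ; exact: D2.
- move=> X hX; split; rewrite (Ct TY' (horT hX)) // X0 //.
Qed.

End Rigidity.

(** * Third order consequences of the invariance of the Hessian *)

Section Diff.
Variables (R : realType) (n : nat).
Local Notation V := (Hspace R n).
Implicit Types (F G : V -> R^o) (f g : V -> V) (x : V).

(** Differentiability of functions and, entrywise, of vector fields, for
    expressions in which the derivative itself is irrelevant. *)
Definition dif F x := differentiable F x.
Definition vdif f x := forall i j, dif (fun y => f y i j) x.

Lemma dif_cst a x : dif (fun=> a) x.
Proof. exact: differentiable_cst. Qed.
Lemma difD F G x : dif F x -> dif G x -> dif (fun y => F y + G y) x.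
Proof. exact: differentiableD. Qed.
Lemma difM F G x : dif F x -> dif G x -> dif (fun y => F y * G y) x.
Proof. exact: differentiableM. Qed.
Lemma difN F x : dif F x -> dif (fun y => - F y) x.
Proof. exact: differentiableN. Qed.
Lemma difB F G x : dif F x -> dif G x -> dif (fun y => F y - G y) x.
Proof. by move=> hF /difN; exact: difD. Qed.
Lemma difV F x : F x != 0 -> dif F x -> dif (fun y => (F y)^-1) x.
Proof. by move=> F0 dF; exact: differentiableV. Qed.
Lemma dif_sum (I : finType) (F : I -> V -> R^o) x :
  (forall i, dif (F i) x) -> dif (fun y => \sum_i F i y) x.
Proof.
move=> h; have [//] := @has_diff_sum _ _ I F x (fun i Y => 'D_Y (F i) x)
  (fun i => has_diff_derive (h i)).
Qed.
Lemma difX F x k : dif F x -> dif (fun y => F y ^+ k) x.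
Proof.
move=> h; elim: k => [|k ih]; first exact: dif_cst.
rewrite (_ : (fun y => _) = fun y => F y * F y ^+ k); first exact: difM.
by apply/funext => y; rewrite exprS.
Qed.

Lemma vdif_cst a x : vdif (fun=> a) x.
Proof. by move=> i j; exact: dif_cst. Qed.
Lemma vdifD f g x : vdif f x -> vdif g x -> vdif (fun y => f y + g y) x.
Proof.
move=> hf hg i j; rewrite (_ : (fun y => _) = fun y => f y i j + g y i j).
  exact: difD.
by apply/funext => y; rewrite mxE.
Qed.
Lemma vdifN f x : vdif f x -> vdif (fun y => - f y) x.
Proof.
move=> hf i j; rewrite (_ : (fun y => _) = fun y => - f y i j).
  exact: difN.
by apply/funext => y; rewrite mxE.
Qed.
Lemma vdifZ F f x : dif F x -> vdif f x -> vdif (fun y => F y *: f y) x.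
Proof.
move=> hF hf i j; rewrite (_ : (fun y => _) = fun y => F y * f y i j).
  exact: difM.
by apply/funext => y; rewrite mxE.
Qed.

Lemma lf_delta (f : V -> R) : linear_form f ->
  forall u, f u = \sum_i \sum_j u i j * f (delta_mx i j).
Proof.
move=> fl u; rewrite {1}(matrix_sum_delta u).
have fs (I : finType) (g : I -> V) : f (\sum_i g i) = \sum_i f (g i).
  by apply: big_morph; [exact: lfD fl | exact: lf0 fl].
rewrite fs; apply: eq_bigr => i _; rewrite fs; apply: eq_bigr => j _.
exact: lfZ.
Qed.

Lemma vdif_lin (J : V -> V) f x :
  (forall a u v, J (a *: u + v) = a *: J u + J v) -> vdif f x ->
  vdif (fun y => J (f y)) x.
Proof.
move=> Jl hf i j.
have l : linear_form (fun u => J u i j) by move=> a u v; rewrite Jl !mxE.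
rewrite (_ : (fun y => _) = fun y => \sum_k \sum_l f y k l * J (delta_mx k l) i j).
  by do 2!(apply: dif_sum => ?); apply: difM; [exact: hf | exact: dif_cst].
by apply/funext => y; rewrite [LHS](lf_delta l).
Qed.

Lemma dif_form (N : V -> V -> R) f x : (forall y, linear_form (N y)) ->
  (forall v, dif (fun y => N y v) x) -> vdif f x -> dif (fun y => N y (f y)) x.
Proof.
move=> Nl dN hf.
rewrite (_ : (fun y => _) = fun y => \sum_k \sum_l f y k l * N y (delta_mx k l)).
  by do 2!(apply: dif_sum => ?); apply: difM.
by apply/funext => y; rewrite [LHS](lf_delta (Nl y)).
Qed.

Lemma dif_bilinear (h : V -> V -> V -> R) f g x :
  (forall y v, linear_form (fun u => h y u v)) ->
  (forall y u, linear_form (h y u)) ->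
  (forall u v, dif (fun y => h y u v) x) -> vdif f x -> vdif g x ->
  dif (fun y => h y (f y) (g y)) x.
Proof.
move=> hl hr dh hf hg; apply: (dif_form (N := fun y v => h y (f y) v)) => //.
by move=> v; apply: (dif_form (N := fun y u => h y u v)).
Qed.

End Diff.

Section Prolong.
Variables (R : realType) (n : nat).
Local Notation V := (Hspace R n).
Variables (M U : set V) (N : V -> V -> R) (h : V -> V -> V -> R)
  (T : V -> V -> V -> V -> R).
Hypothesis jet : hypersurface_jet M U N h T.
Variables J1 J2 J3 : V -> V.
Hypothesis Jq : quaternionic_triple J1 J2 J3.
Local Notation hor y := (horizontal J1 J2 J3 (N y)).
Hypothesis hJ : forall y, M y -> U y -> forall X, hor y X ->
  [/\ h y X (J1 X) = 0, h y X (J2 X) = 0 & h y X (J3 X) = 0].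
Hypothesis hdef : forall y, M y -> U y -> forall X, hor y X -> X != 0 ->
  h y X X != 0.
Variable w : V.
Local Notation nsq y := (normal_sq J1 J2 J3 (N y) w).
Local Notation W y := (normal_vec J1 J2 J3 (N y) w).
Local Notation P y := (hproj J1 J2 J3 (N y) w).

Let Nl y : linear_form (N y). Proof. by move=> a u v; exact: (jet_Nlin jet). Qed.
Let hl y v : linear_form (fun u => h y u v).
Proof. by move=> a u u'; exact: (jet_hlin jet). Qed.
Let hr y u : linear_form (h y u).
Proof. by move=> a v v'; exact: (jet_hlinr jet). Qed.
Let hs y : U y -> forall u v, h y u v = h y v u. Proof. exact: (jet_hsym jet). Qed.
Let JE := (qtAA Jq, qtBB Jq, qtCC Jq, qtAB Jq, qtBC Jq, qtCA Jq, qtBA Jq,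
  qtCB Jq, qtAC Jq).
Let dN x v : U x -> dif (fun y => N y v) x.
Proof. by move=> Ux; case: (jet_dN jet Ux v). Qed.
Let dh x u v : U x -> dif (fun y => h y u v) x.
Proof. by move=> Ux; case: (jet_dh jet Ux u v). Qed.

Lemma dif_normal_sq x : U x -> dif (fun y => nsq y) x.
Proof.
move=> Ux; rewrite /normal_sq.
by do 3!(apply: difD; last by apply: difX; exact: dN); apply: difX; exact: dN.
Qed.

Let dW x : U x -> vdif (fun y => W y) x.
Proof.
move=> Ux; rewrite /normal_vec.
do 3!(apply: vdifD; last by apply: vdifZ (dN _ Ux) (vdif_cst _ _)).
exact: vdifZ (dN _ Ux) (vdif_cst _ _).
Qed.

Let dJW x : U x -> [/\ vdif (fun y => J1 (W y)) x, vdif (fun y => J2 (W y)) x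
  & vdif (fun y => J3 (W y)) x].
Proof.
by move=> Ux; split; apply: vdif_lin (dW Ux);
  [exact: qtA Jq | exact: qtB Jq | exact: qtC Jq].
Qed.

Let dP x u : U x -> nsq x != 0 -> vdif (fun y => P y u) x.
Proof.
move=> Ux nx; have [d1 d2 d3] := dJW Ux.
rewrite /hproj /vert; apply: vdifD; first exact: vdif_cst.
apply/vdifN/vdifZ; first exact/difV/dif_normal_sq.
do 3!(apply: vdifD; last by apply/vdifN/vdifZ => //; exact: dN).
by apply: vdifZ (dW Ux); exact: dN.
Qed.

Let nearU x : U x -> nsq x != 0 -> \forall y \near x, U y /\ nsq y != 0.
Proof.
move=> Ux nx; have oU := jet_open jet.
have nU : \forall y \near x, U y by apply: open_nbhs_nbhs.
have nn : \forall y \near x, nsq y != 0.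
  have c : {for x, continuous (fun y => nsq y : R^o)}.
    exact/differentiable_continuous/dif_normal_sq.
  exact: (cvgr_neq0 _ c nx).
exact: filterS2 nU nn.
Qed.

Section AtPoint.
Variable x : V.
Hypotheses (Mx : M x) (Ux : U x) (nx : nsq x != 0).

Local Notation mlt f y v := (f J1 J2 J3 (N y) (h y) w v).

Let dmult v :
  [/\ dif (fun y => mlt (@mult0 R V) y v) x, dif (fun y => mlt (@mult1 R V) y v) x,
      dif (fun y => mlt (@mult2 R V) y v) x & dif (fun y => mlt (@mult3 R V) y v) x].
Proof.
have [d1 d2 d3] := dJW Ux.
have dg : vdif (fun y => 2^-1 *: (v + P y v)) x.
  apply: vdifZ; first exact: dif_cst.
  by apply: vdifD; [exact: vdif_cst | exact: dP].
have dn1 : dif (fun y => (nsq y)^-1) x by exact/difV/dif_normal_sq.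
have bl f : vdif f x -> dif (fun y => h y (f y) (2^-1 *: (v + P y v))) x.
  move=> df; apply: (dif_bilinear (h := h)) => // u u'; exact: dh.
split; [|apply: difN|apply: difN|apply: difN]; apply: difM => //; apply: bl => //.
exact: dW.
Qed.

(** If h vanishes along M on the horizontal projections of u and v, then by
    [decompose] h(u, v) is along M a combination of the functions N (J_a u) and
    N (J_a v).  These vanish at x, so their coefficients contribute only their
    values to the third derivative. *)
Lemma third_horizontal u v Y : hor x u -> hor x v -> N x Y = 0 ->
  (\forall y \near x, M y -> U y -> nsq y != 0 -> h y (P y u) (P y v) = 0) ->
  T x Y u v =
    (h x Y u * mlt (@mult0 R V) x v + h x Y v * mlt (@mult0 R V) x u)
  + (h x Y (J1 u) * mlt (@mult1 R V) x v + h x Y (J1 v) * mlt (@mult1 R V) x u)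
  + (h x Y (J2 u) * mlt (@mult2 R V) x v + h x Y (J2 v) * mlt (@mult2 R V) x u)
  + (h x Y (J3 u) * mlt (@mult3 R V) x v + h x Y (J3 v) * mlt (@mult3 R V) x u).
Proof.
move=> [u0 u1 u2 u3] [v0 v1 v2 v3] NY near0.
have [a0 a1 a2 a3] := dmult u; have [b0 b1 b2 b3] := dmult v.
have dNx z := jet_dN jet Ux z.
have H0 := has_diffD (has_diffM0 (dNx u) u0 b0) (has_diffM0 (dNx v) v0 a0).
have H1 := has_diffD (has_diffM0 (dNx (J1 u)) u1 b1)
                     (has_diffM0 (dNx (J1 v)) v1 a1).
have H2 := has_diffD (has_diffM0 (dNx (J2 u)) u2 b2)
                     (has_diffM0 (dNx (J2 v)) v2 a2).
have H3 := has_diffD (has_diffM0 (dNx (J3 u)) u3 b3)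
                     (has_diffM0 (dNx (J3 v)) v3 a3).
have H := has_diffB (jet_dh jet Ux u v) (has_diffD (has_diffD (has_diffD H0 H1) H2) H3).
apply/eqP; rewrite -subr_eq0; apply/eqP.
apply: (jet_tangent jet Mx Ux H _ NY).
apply: filterS2 near0 (nearU Ux nx) => y h0 [Uy ny] My.
rewrite (decompose (hl y) (hs Uy) ny u v) h0 // add0r; apply/eqP.
by rewrite subr_eq0.
Qed.

Let hsx := hs Ux.
Let hE v := lfE (hr x v).
Let hlE v := (lfD (hl x v), lfZ (hl x v), lfN (hl x v), lf0 (hl x v)).

(** A horizontal vector and its images under J_1, J_2, J_3 are orthogonal of the
    same length for h. *)
Lemma gram X : hor x X ->
  [/\ [/\ h x (J1 X) (J1 X) = h x X X, h x (J2 X) (J2 X) = h x X X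
    & h x (J3 X) (J3 X) = h x X X],
  [/\ h x (J1 X) X = 0, h x (J2 X) X = 0 & h x (J3 X) X = 0],
  [/\ h x (J1 X) (J2 X) = 0, h x (J1 X) (J3 X) = 0 & h x (J2 X) (J3 X) = 0] &
  [/\ h x (J2 X) (J1 X) = 0, h x (J3 X) (J1 X) = 0 & h x (J3 X) (J2 X) = 0]].
Proof.
move=> hX; have [h1 h2 h3] := horizontal_J Jq (Nl x) hX.
have [i1 i2 i3] := horizontal_invariant Jq (Nl x) (hl x) hsx (hJ Mx Ux) hX hX.
have [a1 a2 a3] := hJ Mx Ux hX; have [_ b2 b3] := hJ Mx Ux h1.
have [c1 _ _] := hJ Mx Ux h2.
move: b2 b3 c1; rewrite !JE !hE => /eqP; rewrite oppr_eq0 => /eqP b2 b3 c1.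
by split; split=> //; rewrite hsx.
Qed.

Let third_J X Y : hor x X -> N x Y = 0 ->
  [/\ T x Y X (J1 X) =
    h x Y X * mlt (@mult0 R V) x (J1 X) + h x Y (J1 X) * mlt (@mult0 R V) x X
  + h x Y (J1 X) * mlt (@mult1 R V) x (J1 X) - h x Y X * mlt (@mult1 R V) x X
  + h x Y (J2 X) * mlt (@mult2 R V) x (J1 X) - h x Y (J3 X) * mlt (@mult2 R V) x X
  + h x Y (J3 X) * mlt (@mult3 R V) x (J1 X) + h x Y (J2 X) * mlt (@mult3 R V) x X,
  T x Y X (J2 X) =
    h x Y X * mlt (@mult0 R V) x (J2 X) + h x Y (J2 X) * mlt (@mult0 R V) x X
  + h x Y (J1 X) * mlt (@mult1 R V) x (J2 X) + h x Y (J3 X) * mlt (@mult1 R V) x X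
  + h x Y (J2 X) * mlt (@mult2 R V) x (J2 X) - h x Y X * mlt (@mult2 R V) x X
  + h x Y (J3 X) * mlt (@mult3 R V) x (J2 X) - h x Y (J1 X) * mlt (@mult3 R V) x X
  & T x Y X (J3 X) =
    h x Y X * mlt (@mult0 R V) x (J3 X) + h x Y (J3 X) * mlt (@mult0 R V) x X
  + h x Y (J1 X) * mlt (@mult1 R V) x (J3 X) - h x Y (J2 X) * mlt (@mult1 R V) x X
  + h x Y (J2 X) * mlt (@mult2 R V) x (J3 X) + h x Y (J1 X) * mlt (@mult2 R V) x X
  + h x Y (J3 X) * mlt (@mult3 R V) x (J3 X) - h x Y X * mlt (@mult3 R V) x X].
Proof.
move=> hX NY; have [h1 h2 h3] := horizontal_J Jq (Nl x) hX.
have near0 : \forall y \near x, M y -> U y -> nsq y != 0 ->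
    [/\ h y (P y X) (P y (J1 X)) = 0, h y (P y X) (P y (J2 X)) = 0
      & h y (P y X) (P y (J3 X)) = 0].
  apply: filterS (nearU Ux nx) => y _ My Uy ny; have [-> -> ->] := hprojJ Jq (Nl y) w X.
  exact: (hJ My Uy (horizontal_hproj Jq (Nl y) ny X)).
split; rewrite third_horizontal //.
- rewrite !JE.
  move: (mult0 J1 J2 J3 (N x) (h x) w) (mult1 J1 J2 J3 (N x) (h x) w)
    (mult2 J1 J2 J3 (N x) (h x) w) (mult3 J1 J2 J3 (N x) (h x) w) => m0 m1 m2 m3.
  by rewrite !hE; ring.
- by apply: filterS near0 => y hy My Uy ny; case: hy.
- rewrite !JE.
  move: (mult0 J1 J2 J3 (N x) (h x) w) (mult1 J1 J2 J3 (N x) (h x) w)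
    (mult2 J1 J2 J3 (N x) (h x) w) (mult3 J1 J2 J3 (N x) (h x) w) => m0 m1 m2 m3.
  by rewrite !hE; ring.
- by apply: filterS near0 => y hy My Uy ny; case: hy.
- rewrite !JE.
  move: (mult0 J1 J2 J3 (N x) (h x) w) (mult1 J1 J2 J3 (N x) (h x) w)
    (mult2 J1 J2 J3 (N x) (h x) w) (mult3 J1 J2 J3 (N x) (h x) w) => m0 m1 m2 m3.
  by rewrite !hE; ring.
- by apply: filterS near0 => y hy My Uy ny; case: hy.
Qed.

(** The third derivative is known on (Y, X, J_s X) by [third_J].  With
    Y = J_a X it can be computed in two ways for a <> s, because T is
    symmetric in its outer arguments J_a X and J_s X; the difference is
    h(X, X) times a linear identity between the h(J_a W, J_b X). *)
Lemma mixed_form_invariant X : hor x X ->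
  h x (J2 (W x)) (J2 X) = h x (J1 (W x)) (J1 X) /\
  h x (J3 (W x)) (J3 X) = h x (J1 (W x)) (J1 X).
Proof.
have key Z : hor x Z ->
   [/\ h x (J1 (W x)) (J2 Z) - h x (J2 (W x)) (J1 Z) = 2 * h x (J3 (W x)) Z,
       h x (J2 (W x)) (J3 Z) - h x (J3 (W x)) (J2 Z) = 2 * h x (J1 (W x)) Z
     & h x (J3 (W x)) (J1 Z) - h x (J1 (W x)) (J3 Z) = 2 * h x (J2 (W x)) Z].
  move=> hZ; have [->|Z0] := eqVneq Z 0.
    rewrite (lm0 (qtA Jq)) (lm0 (qtB Jq)) (lm0 (qtC Jq)) !hE !subr0 mulr0.
    by split.
  have q0 := hdef Mx Ux hZ Z0.
  have [h1 h2 h3] := horizontal_J Jq (Nl x) hZ.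
  have [[g1 g2 g3] [k1 k2 k3] [l1 l2 l3] [m1 m2 m3]] := gram hZ.
  have hN Y : hor x Y -> N x Y = 0 by case.
  have [_ t12 t13] := third_J hZ (hN _ h1).
  have [t21 _ t23] := third_J hZ (hN _ h2).
  have [t31 t32 _] := third_J hZ (hN _ h3).
  have sym a b c : T x a b c = T x c b a.
    by rewrite (jet_Tsym jet Ux) (jet_Tsymr jet Ux) (jet_Tsym jet Ux).
  have [k k0 hk] : exists2 k, k != 0 & forall X, hor x X ->
      [/\ mlt (@mult1 R V) x X = - (k * h x (J1 (W x)) X),
          mlt (@mult2 R V) x X = - (k * h x (J2 (W x)) X)
        & mlt (@mult3 R V) x X = - (k * h x (J3 (W x)) X)].
    exists (nsq x)^-1; first by rewrite invr_eq0.
    by move=> X' hX'; have [_ a b c] := mult_horizontal (h x) w hX'.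
  have [mZ1 mZ2 mZ3] := hk _ hZ; have [_ mA2 mA3] := hk _ h1.
  have [mB1 _ mB3] := hk _ h2; have [mC1 mC2 _] := hk _ h3.
  move: (mult0 J1 J2 J3 (N x) (h x) w) (mult1 J1 J2 J3 (N x) (h x) w)
    (mult2 J1 J2 J3 (N x) (h x) w) (mult3 J1 J2 J3 (N x) (h x) w)
    t12 t13 t21 t23 t31 t32 mZ1 mZ2 mZ3 mA2 mA3 mB1 mB3 mC1 mC2 {hk}
    => m0' m1' m2' m3' t12 t13 t21 t23 t31 t32 mZ1 mZ2 mZ3 mA2 mA3 mB1 mB3 mC1 mC2.
  have := sym (J1 Z) Z (J2 Z); rewrite t12 t21.
  have := sym (J2 Z) Z (J3 Z); rewrite t23 t32.
  have := sym (J3 Z) Z (J1 Z); rewrite t31 t13.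
  rewrite g1 g2 g3 k1 k2 k3 l1 l2 l3 m1 m2 m3.
  rewrite mZ1 mZ2 mZ3 mA2 mA3 mB1 mB3 mC1 mC2 !mul0r.
  move: (h x Z Z) q0 => q q0.
  move: (J1 (W x)) (J2 (W x)) (J3 (W x)) => W1 W2 W3.
  move=> e1 e2 e3.
  have cancel a b : q * (k * a) = q * (k * b) -> a = b.
    by move/(mulfI q0)/(mulfI k0).
  by split; apply: cancel; move: e1 e2 e3; lra.
move=> hX; have [h1 h2 h3] := horizontal_J Jq (Nl x) hX.
have [_ _ e3] := key _ h2; have [e2 _ _] := key _ h3; have [_ e1 _] := key _ h1.
move: e1 e2 e3; rewrite !JE !hE; lra.
Qed.

End AtPoint.

Hypothesis hne : forall y, M y -> U y -> exists2 X, hor y X & X != 0.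

Local Notation B y := (invariant_part J1 J2 J3 (N y) (h y) w).
Local Notation th y := (transversal_part J1 J2 J3 (N y) (h y) w).
Local Notation cb y := (normal_value J1 J2 J3 (N y) (h y) w).

(** What remains of h after removing its invariant part, as given by
    [normal_form]. *)
Definition residual y u v := N y u * th y v + N y v * th y u
  + (nsq y)^-1 ^+ 2 * ((h y (J2 (W y)) (J2 (W y)) - cb y) * (N y (J2 u) * N y (J2 v))
     + (h y (J3 (W y)) (J3 (W y)) - cb y) * (N y (J3 u) * N y (J3 v))
     + h y (J1 (W y)) (J2 (W y)) * (N y (J1 u) * N y (J2 v) + N y (J1 v) * N y (J2 u))
     + h y (J1 (W y)) (J3 (W y)) * (N y (J1 u) * N y (J3 v) + N y (J1 v) * N y (J3 u))
     + h y (J2 (W y)) (J3 (W y)) * (N y (J2 u) * N y (J3 v) + N y (J2 v) * N y (J3 u))).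

Let residualE y u v : M y -> U y -> nsq y != 0 ->
  h y u v = B y u v + residual y u v.
Proof.
move=> My Uy ny.
rewrite (normal_form Jq (Nl y) (hl y) (hs Uy) ny (mixed_form_invariant My Uy ny) u v).
by rewrite /residual [RHS]addrA; congr (_ + _); rewrite [RHS]addrA.
Qed.

Section AtPoint.
Variable x : V.
Hypotheses (Mx : M x) (Ux : U x) (nx : nsq x != 0).

Let dn2 : dif (fun y => (nsq y)^-1) x. Proof. exact/difV/dif_normal_sq. Qed.

Let bl f g : vdif f x -> vdif g x -> dif (fun y => h y (f y) (g y)) x.
Proof. by move=> df dg; apply: (dif_bilinear (h := h)) => // u u'; exact: dh. Qed.

Let dbeta f : vdif f x -> dif (fun y => mixed_form J1 J2 J3 (N y) (h y) w (f y)) x.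
Proof.
move=> df; have [d1 d2 d3] := dJW Ux; apply: bl => //.
by apply: vdif_lin df; exact: qtA Jq.
Qed.

Let dcb : dif (fun y => cb y) x.
Proof. by have [d1 d2 d3] := dJW Ux; exact: bl. Qed.

Lemma dif_transversal_part v : dif (fun y => th y v) x.
Proof.
have [d1 d2 d3] := dJW Ux; have dp := dP v Ux nx; have dw := dW Ux.
rewrite /transversal_part; apply: difD.
  by apply: difM => //; apply: difB; [exact: bl | exact: dbeta].
apply: difM; first exact: difX.
do 3!(apply: difB; last by apply: difM; [exact: dN | exact: bl]).
apply: difM; last by apply: difB => //; exact: bl.
by apply: difM; [exact: dif_cst | exact: dN].
Qed.

(** The differential at x of the residual on (u, v) for u tangent and v
    horizontal: by these conditions no coefficient is differentiated. *)
Definition dresidual u v Y := h x Y u * th x v + h x Y v * th x u +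
    (nsq x)^-1 ^+ 2 *
    ((h x (J2 (W x)) (J2 (W x)) - cb x) * (N x (J2 u) * h x Y (J2 v))
     + (h x (J3 (W x)) (J3 (W x)) - cb x) * (N x (J3 u) * h x Y (J3 v))
     + h x (J1 (W x)) (J2 (W x)) *
         (N x (J1 u) * h x Y (J2 v) + h x Y (J1 v) * N x (J2 u))
     + h x (J1 (W x)) (J3 (W x)) *
         (N x (J1 u) * h x Y (J3 v) + h x Y (J1 v) * N x (J3 u))
     + h x (J2 (W x)) (J3 (W x)) *
         (N x (J2 u) * h x Y (J3 v) + h x Y (J2 v) * N x (J3 u))).

Let dres u v : N x u = 0 -> hor x v ->
  has_diff (fun y => residual y u v) x (dresidual u v).
Proof.
move=> u0 [v0 v1 v2 v3].
have [d1 d2 d3] := dJW Ux.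
have dNx z := jet_dN jet Ux z.
have c22 := (difB (bl d2 d2) dcb).
have c33 := (difB (bl d3 d3) dcb).
have c12 := (bl d1 d2).
have c13 := (bl d1 d3).
have c23 := (bl d2 d3).
have pr a b := has_diffM (dNx a) (dNx b).
have H0 := has_diffD (has_diffM0 (dNx u) u0 (dif_transversal_part v))
                     (has_diffM0 (dNx v) v0 (dif_transversal_part u)).
have H1 := has_diffM (has_diff_derive c22) (pr (J2 u) (J2 v)).
have H2 := has_diffM (has_diff_derive c33) (pr (J3 u) (J3 v)).
have H3 := has_diffM (has_diff_derive c12)
  (has_diffD (pr (J1 u) (J2 v)) (pr (J1 v) (J2 u))).
have H4 := has_diffM (has_diff_derive c13)
  (has_diffD (pr (J1 u) (J3 v)) (pr (J1 v) (J3 u))).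
have H5 := has_diffM (has_diff_derive c23)
  (has_diffD (pr (J2 u) (J3 v)) (pr (J2 v) (J3 u))).
have H := has_diffD H0 (has_diffM (has_diff_derive (difX 2 dn2))
  (has_diffD (has_diffD (has_diffD (has_diffD H1 H2) H3) H4) H5)).
by apply: eq_has_diff H => Y; rewrite v1 v2 v3 !(mulr0, mul0r, addr0, add0r).
Qed.

(** The invariant part satisfies many identities along M; each of them yields a
    value of the third derivative in terms of first order data of the residual
    alone. *)
Lemma third_residual (e : R) u v u' v' Y : N x u = 0 -> hor x v ->
  N x u' = 0 -> hor x v' -> N x Y = 0 ->
  (forall y, M y -> U y -> nsq y != 0 -> B y u v + e * B y u' v' = 0) ->
  T x Y u v + e * T x Y u' v' = dresidual u v Y + e * dresidual u' v' Y.
Proof.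
move=> u0 hv u0' hv' NY HB.
have H := has_diffB (has_diffD (jet_dh jet Ux u v) (has_diffZ e (jet_dh jet Ux u' v')))
  (has_diffD (dres u0 hv) (has_diffZ e (dres u0' hv'))).
apply/eqP; rewrite -subr_eq0; apply/eqP.
apply: (jet_tangent jet Mx Ux H _ NY).
apply: filterS (nearU Ux nx) => y [Uy ny] My; apply/eqP.
rewrite subr_eq0 (residualE u v My Uy ny) (residualE u' v' My Uy ny).
rewrite mulrDr addrACA (HB y My Uy ny) add0r.
by [].
Qed.

Let Binv y u v : M y -> U y -> nsq y != 0 -> _ := fun My Uy ny =>
  invariant_part_invariant Jq (Nl y) (hl y) (hs Uy) ny (hJ My Uy) u v.

Let Bskew y u : M y -> U y -> nsq y != 0 ->
  [/\ B y u (J1 u) = 0, B y u (J2 u) = 0 & B y u (J3 u) = 0].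
Proof.
move=> My Uy ny; apply: (invariant_skew Jq).
- exact: (invariant_part_lin Jq (Nl y) (hl y) (hs Uy)).
- exact: (invariant_part_sym _ _ _ _ (hs Uy)).
- by move=> a b; exact: Binv.
Qed.

Let BskewM y u v : M y -> U y -> nsq y != 0 -> [/\ B y (J1 u) v = - B y u (J1 v),
  B y (J2 u) v = - B y u (J2 v) & B y (J3 u) v = - B y u (J3 v)].
Proof.
move=> My Uy ny; apply: (invariant_skewM Jq).
- exact: (invariant_part_lin Jq (Nl y) (hl y) (hs Uy)).
- exact: (invariant_part_sym _ _ _ _ (hs Uy)).
- by move=> a b; exact: Binv.
Qed.

Let Br y u : U y -> linear_form (B y u).
Proof.
move=> Uy a v v'; rewrite !(invariant_part_sym _ _ _ _ (hs Uy) w u).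
exact: (invariant_part_lin Jq (Nl y) (hl y) (hs Uy)).
Qed.

Let hsx := hs Ux.

(** The identities B(J_a W, J_a X) = B(J_b W, J_b X) and
    B(J_a W, J_b X) = - B(J_b W, J_a X), differentiated along X, give relations
    between the numbers T(X, J_a W, J_b X).  By symmetry of T these numbers are
    also the derivatives along J_a W of h(X, J_b X), which are known because
    B(X, J_b X) = 0.  Comparison gives the five identities, multiplied by
    h(X, X). *)
Lemma normal_umbilic :
  [/\ h x (J2 (W x)) (J2 (W x)) = cb x, h x (J3 (W x)) (J3 (W x)) = cb x,
      h x (J1 (W x)) (J2 (W x)) = 0, h x (J1 (W x)) (J3 (W x)) = 0
    & h x (J2 (W x)) (J3 (W x)) = 0].
Proof.
have [X hX X0] := hne Mx Ux.
have q0 := hdef Mx Ux hX X0.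
have [h1 h2 h3] := horizontal_J Jq (Nl x) hX.
have [[g1 g2 g3] [k1 k2 k3] [l1 l2 l3] [m1 m2 m3]] := gram Mx Ux hX.
have [a1 a2 a3] := hJ Mx Ux hX.
have [nw0 nw1 nw2 nw3] := normal_vecE Jq (Nl x) w.
have sym a b c : T x a b c = T x b a c by exact: (jet_Tsym jet Ux).
have [b2 b3] := mixed_form_invariant Mx Ux nx hX.
have := mixed_form_invariant Mx Ux nx h1; have := mixed_form_invariant Mx Ux nx h2.
have := mixed_form_invariant Mx Ux nx h3.
rewrite !JE !(lfE (hr x _)) => -[c31 c32] [c21 c22] [c11 c12].
have NX Z : hor x Z -> N x Z = 0 by case.
(* the derivative of h(X, J_s X) along a tangent vector *)
have E1 Y : N x Y = 0 -> [/\ T x Y X (J1 X) = dresidual X (J1 X) Y,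
    T x Y X (J2 X) = dresidual X (J2 X) Y & T x Y X (J3 X) = dresidual X (J3 X) Y].
  move=> NY; split.
  - have := @third_residual 0 X (J1 X) X (J1 X) Y; rewrite !mul0r !addr0; apply=> //.
    + exact: NX. + exact: NX.
    by move=> y My Uy ny; rewrite mul0r addr0; case: (Bskew X My Uy ny).
  - have := @third_residual 0 X (J2 X) X (J2 X) Y; rewrite !mul0r !addr0; apply=> //.
    + exact: NX. + exact: NX.
    by move=> y My Uy ny; rewrite mul0r addr0; case: (Bskew X My Uy ny).
  - have := @third_residual 0 X (J3 X) X (J3 X) Y; rewrite !mul0r !addr0; apply=> //.
    + exact: NX. + exact: NX.
    by move=> y My Uy ny; rewrite mul0r addr0; case: (Bskew X My Uy ny).
have D12 := @third_residual (-1) (J1 (W x)) (J1 X) (J2 (W x)) (J2 X) X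
  nw1 h1 nw2 h2 (NX _ hX).
have D13 := @third_residual (-1) (J1 (W x)) (J1 X) (J3 (W x)) (J3 X) X
  nw1 h1 nw3 h3 (NX _ hX).
have S12 := @third_residual 1 (J1 (W x)) (J2 X) (J2 (W x)) (J1 X) X
  nw1 h2 nw2 h1 (NX _ hX).
have S13 := @third_residual 1 (J1 (W x)) (J3 X) (J3 (W x)) (J1 X) X
  nw1 h3 nw3 h1 (NX _ hX).
have S23 := @third_residual 1 (J2 (W x)) (J3 X) (J3 (W x)) (J2 X) X
  nw2 h3 nw3 h2 (NX _ hX).
have d12 : forall y, M y -> U y -> nsq y != 0 ->
    B y (J1 (W x)) (J1 X) + -1 * B y (J2 (W x)) (J2 X) = 0.
  by move=> y My Uy ny; have [-> -> _] := Binv (W x) X My Uy ny; rewrite mulN1r subrr.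
have d13 : forall y, M y -> U y -> nsq y != 0 ->
    B y (J1 (W x)) (J1 X) + -1 * B y (J3 (W x)) (J3 X) = 0.
  by move=> y My Uy ny; have [-> _ ->] := Binv (W x) X My Uy ny; rewrite mulN1r subrr.
have s12 : forall y, M y -> U y -> nsq y != 0 ->
    B y (J1 (W x)) (J2 X) + 1 * B y (J2 (W x)) (J1 X) = 0.
  move=> y My Uy ny; have [-> _ _] := BskewM (W x) (J2 X) My Uy ny.
  have [_ -> _] := BskewM (W x) (J1 X) My Uy ny.
  by rewrite !JE (lfN (Br _ Uy)) opprK mul1r addNr.
have s13 : forall y, M y -> U y -> nsq y != 0 ->
    B y (J1 (W x)) (J3 X) + 1 * B y (J3 (W x)) (J1 X) = 0.
  move=> y My Uy ny; have [-> _ _] := BskewM (W x) (J3 X) My Uy ny.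
  have [_ _ ->] := BskewM (W x) (J1 X) My Uy ny.
  by rewrite !JE (lfN (Br _ Uy)) opprK mul1r subrr.
have s23 : forall y, M y -> U y -> nsq y != 0 ->
    B y (J2 (W x)) (J3 X) + 1 * B y (J3 (W x)) (J2 X) = 0.
  move=> y My Uy ny; have [_ -> _] := BskewM (W x) (J3 X) My Uy ny.
  have [_ _ ->] := BskewM (W x) (J2 X) My Uy ny.
  by rewrite !JE (lfN (Br _ Uy)) opprK mul1r addNr.
have {}D12 := D12 d12; have {}D13 := D13 d13; have {}S12 := S12 s12.
have {}S13 := S13 s13; have {}S23 := S23 s23.
have [e11 e12 e13] := E1 _ nw1; have [e21 e22 e23] := E1 _ nw2.
have [e31 e32 e33] := E1 _ nw3.
have NE := lfE (Nl x).
have [NX0 NX1 NX2 NX3] := hX.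
have m0 : (nsq x)^-1 ^+ 2 * nsq x != 0 by rewrite mulf_neq0 // expf_neq0 // invr_eq0.
have fin c : h x X X * ((nsq x)^-1 ^+ 2 * nsq x * c) = 0 -> c = 0.
  move/eqP; rewrite mulf_eq0 (negbTE q0) /= mulf_eq0 (negbTE m0) /= => /eqP; exact.
move: D12 D13 S12 S13 S23.
rewrite !(sym X) e11 e12 e13 e21 e22 e23 e31 e32 e33 /dresidual.
move: (cb x) (th x) (W x) (nsq x) fin b2 b3 c11 c12 c21 c22 c31 c32
  nw0 nw1 nw2 nw3 => cbx thx W0 q fin b2 b3 c11 c12 c21 c22 c31 c32 nw0 nw1 nw2 nw3.
rewrite !JE !NE !(lfE (hr x _)) ?NX0 ?NX1 ?NX2 ?NX3 ?nw0 ?nw1 ?nw2 ?nw3.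
rewrite ?g1 ?g2 ?g3 ?k1 ?k2 ?k3 ?l1 ?l2 ?l3 ?m1 ?m2 ?m3 ?a1 ?a2 ?a3.
rewrite !(hsx X (J1 W0)) !(hsx X (J2 W0)) !(hsx X (J3 W0)).
rewrite !(mul0r, mulr0, mulNr, mulrN, opprK, oppr0, addr0, add0r) b2 b3.
have z12 : (h x (J1 W0) (J2 X) + h x (J2 W0) (J1 X)) * thx X = 0.
  by rewrite c31 addrN mul0r.
have z13 : (h x (J1 W0) (J3 X) + h x (J3 W0) (J1 X)) * thx X = 0.
  by rewrite -c22 addNr mul0r.
have z23 : (h x (J2 W0) (J3 X) + h x (J3 W0) (J2 X)) * thx X = 0.
  by rewrite c12 -c11 addrN mul0r.
move=> D12 D13 S12 S13 S23.
split; [apply/eqP; rewrite -subr_eq0; apply/eqP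
       |apply/eqP; rewrite -subr_eq0; apply/eqP|..]; apply: fin.
- by move: D12; lra.
- by move: D13; lra.
- by move: S12 z12; lra.
- by move: S13 z13; lra.
- by move: S23 z23; lra.
Qed.

Let dproj u : vdif (fun y => P y u) x. Proof. exact: dP. Qed.

Lemma dif_invariant_part u v : dif (fun y => B y u v) x.
Proof.
have dNx z := dN z Ux.
have part a b : dif (fun y => (nsq y)^-1 *
   (N y a * mixed_form J1 J2 J3 (N y) (h y) w (P y b)
    + N y (J1 a) * mixed_form J1 J2 J3 (N y) (h y) w (J1 (P y b))
    + N y (J2 a) * mixed_form J1 J2 J3 (N y) (h y) w (J2 (P y b))
    + N y (J3 a) * mixed_form J1 J2 J3 (N y) (h y) w (J3 (P y b)))) x.
  apply: difM => //.
  do 3!(apply: difD; last by apply: difM => //; apply: dbeta;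
    apply: vdif_lin => //; first [exact: qtA Jq | exact: qtB Jq | exact: qtC Jq]).
  by apply: difM => //; exact: dbeta.
rewrite /invariant_part; apply: difD; first apply: difD; first apply: difD.
- exact: bl.
- exact: part.
- exact: part.
apply: difM; first by apply: difM => //; exact: difX.
by do 3!(apply: difD; last exact: difM); exact: difM.
Qed.

End AtPoint.

(** This is the shape of the Hessian, on its zero set, of the product of a
    quadratic function with an arbitrary function. *)
Lemma hessian_form y u v : M y -> U y -> nsq y != 0 ->
  h y u v = B y u v + N y u * th y v + N y v * th y u.
Proof.
move=> My Uy ny; rewrite (residualE u v My Uy ny) /residual.
have [-> -> -> -> ->] := normal_umbilic My Uy ny.
by rewrite !subrr !mul0r !addr0 mulr0 addr0 addrA.
Qed.

(** C_Y = D_Y B - theta(Y) B satisfies the hypotheses of [prolongation_eq0]: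
    invariance is inherited from B, and on tangent vectors the derivative of
    [hessian_form] expresses C(X, Y, Z) as T(X, Y, Z) minus the symmetric sum of
    the products of h and theta. *)
Lemma invariant_part_derivative x u v Y : M x -> U x -> nsq x != 0 -> N x Y = 0 ->
  'D_Y (fun y => B y u v : R^o) x = th x Y * B x u v.
Proof.
move=> Mx Ux nx.
pose C Y u v := 'D_Y (fun y => B y u v : R^o) x - th x Y * B x u v.
suff : N x Y = 0 -> C Y u v = 0 by move=> h0 /h0 /eqP; rewrite subr_eq0 => /eqP.
have hD u' v' := has_diff_derive (dif_invariant_part Ux nx u' v').
have Bll y v' : U y -> linear_form (fun u' => B y u' v').
  by move=> Uy; exact: (invariant_part_lin Jq (Nl y) (hl y) (hs Uy)).
have Bsy y : U y -> forall u' v', B y u' v' = B y v' u'.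
  by move=> Uy; exact: (invariant_part_sym _ _ _ _ (hs Uy)).
have [nw0 nw1 nw2 nw3] := normal_vecE Jq (Nl x) w.
have nW : N x (W x) != 0 by rewrite nw0.
have TW : [/\ N x (J1 (W x)) = 0, N x (J2 (W x)) = 0 & N x (J3 (W x)) = 0] by [].
have thl := transversal_part_lin Jq (Nl x) (hl x) (hs Ux) w.
have nearB := nearU Ux nx.
apply: (prolongation_eq0 Jq (Nl x) nW TW (C := C)).
- move=> u' v' a Y1 Y2; rewrite /C derive_linear; last exact: dif_invariant_part.
  by rewrite thl; ring.
- move=> Y' v' a u1 u2; rewrite /C Bll //.
  have hl' := has_diffD (has_diffZ a (hD u1 v')) (hD u2 v').
  have -> : 'D_Y' (fun y => B y (a *: u1 + u2) v' : R^o) x =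
      'D_Y' (fun y => a * B y u1 v' + B y u2 v' : R^o) x.
    by apply: near_eq_derive; apply: filterS nearB => y [Uy _]; exact: Bll.
  by case: hl' => _ ->; ring.
- move=> Y' u' v'; rewrite /C (Bsy x Ux u' v'); congr (_ - _).
  by apply: near_eq_derive; apply: filterS nearB => y [Uy _]; exact: Bsy.
- move=> Y' NY' u' v'.
  have inv y : M y -> U y -> nsq y != 0 -> _ := fun My Uy ny =>
    invariant_part_invariant Jq (Nl y) (hl y) (hs Uy) ny (hJ My Uy) u' v'.
  have key u1 v1 : (forall y, M y -> U y -> nsq y != 0 -> B y u1 v1 = B y u' v') ->
      C Y' u1 v1 = C Y' u' v'.
    move=> e; rewrite /C e //; congr (_ - _); apply/eqP; rewrite -subr_eq0; apply/eqP.
    apply: (jet_tangent jet Mx Ux (has_diffB (hD u1 v1) (hD u' v')) _ NY').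
    by apply: filterS nearB => y [Uy ny] My; rewrite e // subrr.
  by split; apply: key => y My Uy ny; case: (inv y My Uy ny).
- move=> X Y' Z NX NY' NZ.
  have key X' Z' Z'' : N x X' = 0 -> N x Z' = 0 -> N x Z'' = 0 ->
      C X' Z' Z'' = T x X' Z' Z'' - h x X' Z' * th x Z'' - h x X' Z'' * th x Z'
       - h x Z' Z'' * th x X'.
    move=> n1 n2 n3.
    have dth1 := dif_transversal_part Ux nx Z'; have dth2 := dif_transversal_part Ux nx Z''.
    have H := has_diffB (has_diffB (jet_dh jet Ux Z' Z'') (has_diffD
      (has_diffM0 (jet_dN jet Ux Z') n2 dth2) (has_diffM0 (jet_dN jet Ux Z'') n3 dth1)))
      (hD Z' Z'').
    have := jet_tangent jet Mx Ux H _ n1; rewrite /C.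
    rewrite (hessian_form Z' Z'' Mx Ux nx) n2 n3 !mul0r !addr0.
    move=> e; rewrite (_ : 'D_X' _ x = T x X' Z' Z'' -
       (h x X' Z' * th x Z'' + h x X' Z'' * th x Z')); first by ring.
    apply/eqP; rewrite eq_sym -subr_eq0 e //.
    apply: filterS nearB => y [Uy ny] My.
    by rewrite (hessian_form Z' Z'' My Uy ny); ring.
  rewrite !key // (jet_Tsym jet Ux X Y') (hs Ux Y' X); ring.
Qed.

End Prolong.

(** * The local quadric *)

Section QuadricDiff.
Variables (R : realType) (n : nat).
Local Notation V := (Hspace R n).

Lemma has_diff_linear (f : V -> R^o) x : linear_form f -> has_diff f x f.
Proof.
move=> fl.
have hc i j : has_diff (fun y : V => y i j : R^o) x (fun Y => Y i j).
  split=> [|Y]; first exact: differentiable_coord.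
  rewrite deriveE; last exact: differentiable_coord.
  have l : linear (fun y : V => y i j : R^o) by move=> a u v; rewrite !mxE.
  pose lM := GRing.isLinear.Build _ _ _ _ _ l.
  pose L : {linear V -> R^o} := HB.pack (fun y : V => y i j : R^o) lM.
  rewrite -[X in 'd X _]/(L : V -> R^o) diff_lin //.
  by move=> y; apply: differentiable_continuous; exact: differentiable_coord.
have H : has_diff (fun y : V => \sum_i \sum_j f (delta_mx i j) * y i j : R^o) x
    (fun Y => \sum_i \sum_j f (delta_mx i j) * Y i j).
  by do 2!(apply: has_diff_sum => ?); apply: has_diffZ.
have e : forall y : V, \sum_i \sum_j f (delta_mx i j) * y i j = f y.
  move=> y; rewrite (lf_delta fl y); apply: eq_bigr => i _; apply: eq_bigr => j _.
  exact: mulrC.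
rewrite -(funext e); exact: H.
Qed.

Lemma has_diff_quadratic (b : V -> V -> R) x : (forall v, linear_form (b ^~ v)) ->
  (forall u v, b u v = b v u) ->
  has_diff (fun y => b y y : R^o) x (fun Y => 2 * b x Y).
Proof.
move=> bl bs; have br u : linear_form (b u) by move=> a v v'; rewrite bs bl !(bs u).
have hc i j : has_diff (fun y : V => y i j : R^o) x (fun Y => Y i j).
  by apply: has_diff_linear => a u v; rewrite !mxE.
have H : has_diff (fun y : V => \sum_i \sum_j y i j * b (delta_mx i j) y : R^o) x
    (fun Y => \sum_i \sum_j (Y i j * b (delta_mx i j) x + x i j * b (delta_mx i j) Y)).
  do 2!(apply: has_diff_sum => ?); apply: has_diffM; first exact: hc.
  exact: has_diff_linear.
have e : forall u v : V, \sum_i \sum_j u i j * b (delta_mx i j) v = b u v.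
  by move=> u v; rewrite -(lf_delta (bl v) u).
have -> : (fun y => b y y : R^o) =
    (fun y : V => \sum_i \sum_j y i j * b (delta_mx i j) y : R^o).
  by apply/funext => y; rewrite e.
apply: eq_has_diff H => Y.
rewrite (eq_bigr (fun i => \sum_j Y i j * b (delta_mx i j) x
    + \sum_j x i j * b (delta_mx i j) Y)) => [|i _]; last by rewrite big_split.
by rewrite big_split /= !e (bs Y x); ring.
Qed.

(** The factor 1/2 makes b the Hessian and b x + l the differential at x. *)
Definition quadric_fun (b : V -> V -> R) (l : V -> R) (c : R) (y : V) : R :=
  2^-1 * b y y + l y + c.

Record quaternionic_quadric (J1 J2 J3 : V -> V) (b : V -> V -> R)
    (l : V -> R) : Prop := {
  qq_lin : forall v, linear_form (b ^~ v);
  qq_sym : forall u v, b u v = b v u;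
  qq_inv : forall u v, [/\ b (J1 u) (J1 v) = b u v, b (J2 u) (J2 v) = b u v
    & b (J3 u) (J3 v) = b u v];
  qq_lf : linear_form l }.

Lemma has_diff_quadric J1 J2 J3 b l c x : quaternionic_quadric J1 J2 J3 b l ->
  has_diff (quadric_fun b l c : V -> R^o) x (fun Y => b x Y + l Y).
Proof.
move=> [bl bs _ ll].
have H := has_diffD (has_diffD (has_diffZ 2^-1 (has_diff_quadratic x bl bs))
  (has_diff_linear x ll)) (has_diff_cst x (c : R^o)).
by apply: eq_has_diff H => Y; rewrite addr0 mulrA mulVf ?mul1r // pnatr_eq0.
Qed.

End QuadricDiff.

Section LocalQuadric.
Variables (R : realType) (n : nat).
Local Notation V := (Hspace R n).
Variables (M U : set V) (N : V -> V -> R) (h : V -> V -> V -> R)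
  (T : V -> V -> V -> V -> R).
Hypothesis jet : hypersurface_jet M U N h T.
Variables J1 J2 J3 : V -> V.
Hypothesis Jq : quaternionic_triple J1 J2 J3.
Local Notation hor y := (horizontal J1 J2 J3 (N y)).
Hypothesis hJ : forall y, M y -> U y -> forall X, hor y X ->
  [/\ h y X (J1 X) = 0, h y X (J2 X) = 0 & h y X (J3 X) = 0].
Hypothesis hdef : forall y, M y -> U y -> forall X, hor y X -> X != 0 ->
  h y X X != 0.
Hypothesis hne : forall y, M y -> U y -> exists2 X, hor y X & X != 0.

Let Nl y : linear_form (N y). Proof. by move=> a u v; exact: (jet_Nlin jet). Qed.
Let hl y v : linear_form (fun u => h y u v).
Proof. by move=> a u u'; exact: (jet_hlin jet). Qed.
Let hr y u : linear_form (h y u).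
Proof. by move=> a v v'; exact: (jet_hlinr jet). Qed.
Let hs y : U y -> forall u v, h y u v = h y v u. Proof. exact: (jet_hsym jet). Qed.

Lemma nsq_gt0 y w : N y w != 0 -> normal_sq J1 J2 J3 (N y) w != 0.
Proof.
move=> nw; rewrite gt_eqF // /normal_sq.
do 3!(apply: ltr_wpDr; first exact: sqr_ge0).
by rewrite lt_neqAle eq_sym sqrf_eq0 nw sqr_ge0.
Qed.

(** By [invariant_part_derivative] the ratios of the values of B are constant
    along M; here they are normalised by B(X, X).  Divided by the same factor, N
    has the derivative B_x along M, since N (x) theta is compensated by the
    derivative of the factor; hence it is affine, and a quadratic function with
    this differential is constant along M. *)
Lemma local_quadric x : M x -> U x -> exists b l c,
  [/\ quaternionic_quadric J1 J2 J3 b l,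
      \forall y \near x, M y -> quadric_fun b l c y = 0,
      forall Y, b x Y + l Y = N x Y
    & forall X, hor x X -> b X X = h x X X].
Proof.
move=> Mx Ux.
have [w nw] := jet_neq0 jet Mx Ux; have nx := nsq_gt0 nw.
have [X hX X0] := hne Mx Ux.
pose B y := invariant_part J1 J2 J3 (N y) (h y) w.
pose th y := transversal_part J1 J2 J3 (N y) (h y) w.
pose nsq y := normal_sq J1 J2 J3 (N y) w.
have hess y u v : M y -> U y -> nsq y != 0 ->
    h y u v = B y u v + N y u * th y v + N y v * th y u.
  exact: (hessian_form jet Jq hJ hdef hne).
have dB y u v Y : M y -> U y -> nsq y != 0 -> N y Y = 0 ->
    'D_Y (fun y => B y u v : R^o) y = th y Y * B y u v.
  exact: (invariant_part_derivative jet Jq hJ hdef hne).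
have difB y u v : U y -> nsq y != 0 -> has_diff (fun y => B y u v : R^o) y
    (fun Y => 'D_Y (fun y => B y u v : R^o) y).
  by move=> Uy ny; apply: has_diff_derive; exact: (dif_invariant_part jet Jq).
have Bll y v : U y -> linear_form (fun u => B y u v).
  by move=> Uy; exact: (invariant_part_lin Jq (Nl y) (hl y) (hs Uy)).
have Bs y u v : U y -> B y u v = B y v u.
  by move=> Uy; exact: (invariant_part_sym _ _ _ _ (hs Uy)).
have Binv y u v : M y -> U y -> nsq y != 0 -> [/\ B y (J1 u) (J1 v) = B y u v,
    B y (J2 u) (J2 v) = B y u v & B y (J3 u) (J3 v) = B y u v].
  by move=> My Uy ny; exact: (invariant_part_invariant Jq (Nl y) (hl y) (hs Uy) ny (hJ My Uy)).
have BX0 : B x X X != 0.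
  have := hdef Mx Ux hX X0; rewrite (hess x X X Mx Ux nx).
  by have [-> _ _ _] := hX; rewrite !mul0r !addr0.
have nO : \forall y \near x, [/\ U y, nsq y != 0 & B y X X != 0].
  have nU : \forall y \near x, U y by apply: open_nbhs_nbhs; split=> //; exact: jet_open jet.
  have nn : \forall y \near x, nsq y != 0.
    have c : {for x, continuous (fun y => nsq y : R^o)}.
      exact/differentiable_continuous/(dif_normal_sq jet).
    exact: (cvgr_neq0 _ c nx).
  have nB : \forall y \near x, B y X X != 0.
    have c := has_diff_continuous (difB x X X Ux nx).
    exact: (cvgr_neq0 _ c BX0).
  by apply: filterS3 nU nn nB => y a b c; split.
have cstM (O : set V) : nbhs x O -> \forall y \near x, M y -> forall F : V -> R^o,
    (forall z, M z -> O z -> exists2 dF, has_diff F z dF &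
      forall Y, N z Y = 0 -> dF Y = 0) -> F y = F x.
  move=> nO'; have := jet_const jet Mx Ux nO'; apply: filterS => y hy My F hF.
  apply: (hy My F (fun z Y => 'D_Y F z)) => z Mz Oz.
  have [dF [d1 d2] d3] := hF z Mz Oz; split=> // Y NY.
  by rewrite d2 d3.
(* B is constant along M up to the factor B(X, X) *)
have step1 : \forall y \near x, M y -> forall u v,
    B y u v * (B y X X)^-1 = B x u v * (B x X X)^-1.
  have := cstM _ nO; apply: filterS => y hy My u v.
  apply: (hy My (fun y => B y u v * (B y X X)^-1)) => z Mz [Uz nz Bz].
  have H := has_diffM (difB z u v Uz nz) (@has_diffV _ _ (fun y => B y X X) z _ Bz (difB z X X Uz nz)).
  eexists; first exact: H.
  by move=> Y NY /=; rewrite !dB //; field.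
(* the rescaled conormal is affine along M *)
have step2 : \forall y \near x, M y -> forall v,
    N y v * (B x X X * (B y X X)^-1) = B x (y - x) v + N x v.
  have nO2 : \forall y \near x, [/\ U y, nsq y != 0, B y X X != 0 & M y -> forall u v,
    B y u v * (B y X X)^-1 = B x u v * (B x X X)^-1].
    by apply: filterS2 nO step1 => y [a b c] d; split.
  have := cstM _ nO2; apply: filterS => y hy My v.
  have lB := has_diff_linear _ (Bll x v Ux).
  have : N y v * (B x X X * (B y X X)^-1) - B x y v =
         N x v * (B x X X * (B x X X)^-1) - B x x v.
    apply: (hy My (fun y => N y v * (B x X X * (B y X X)^-1) - B x y v)).
    move=> z Mz [Uz nz Bz B1].
    have H := has_diffB (has_diffM (jet_dN jet Uz v)
      (has_diffZ (B x X X) (@has_diffV _ _ (fun y => B y X X) z _ Bz (difB z X X Uz nz)))) (lB z).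
    eexists; first exact: H.
    move=> Y NY /=; rewrite !dB // (hess z Y v Mz Uz nz) NY mul0r addr0.
    have := B1 Mz Y v.
    move=> /(congr1 (fun t => t * B x X X)); rewrite mulfVK // => <-; field.
    done.
  rewrite mulfV // mulr1 => e.
  rewrite (lfD (Bll x v Ux)) (lfN (Bll x v Ux)).
  by move/eqP: e; rewrite subr_eq => /eqP ->; ring.
pose l v := N x v - B x x v; pose c := 2^-1 * B x x x - N x x.
have bl := fun v => Bll x v Ux.
have bs : forall u v, B x u v = B x v u by move=> u v; exact: Bs.
have qq : quaternionic_quadric J1 J2 J3 (B x) l.
  split=> //; first by move=> u v; exact: Binv.
  by move=> a u v; rewrite /l (Nl x) (bs x (_ + _)) bl !(bs _ x); ring.
exists (B x), l, c; split=> //.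
- have nO3 : \forall y \near x, U y /\ (M y -> forall v,
    N y v * (B x X X * (B y X X)^-1) = B x (y - x) v + N x v).
    by apply: filterS2 nO step2 => y [a b d] e; split.
  have := cstM _ nO3; apply: filterS => y hy My.
  have -> : quadric_fun (B x) l c y = quadric_fun (B x) l c x.
    apply: (hy My (quadric_fun (B x) l c)) => z Mz [Uz e].
    exists (fun Y => B x z Y + l Y); first exact: has_diff_quadric qq.
    move=> Y NY; have := e Mz Y.
    by rewrite NY mul0r (lfD (bl Y)) (lfN (bl Y)) /l => ->; ring.
  by rewrite /quadric_fun /l /c; field.
- by move=> Y; rewrite /l; ring.
- move=> Z [hZ _ _ _]; rewrite (hess x Z Z Mx Ux nx) hZ.
  by rewrite !mul0r !addr0.
Qed.

(** Along M the differential of the quadratic function is a multiple of N, say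
    by a factor f; differentiating once more, b = f h on tangent vectors.  A
    single degenerate horizontal direction therefore gives f = 0, so that b
    vanishes on ker N, and then everywhere by invariance. *)
Lemma quadric_eq0 x b l c X : M x -> U x -> quaternionic_quadric J1 J2 J3 b l ->
  (\forall y \near x, M y -> quadric_fun b l c y = 0) ->
  hor x X -> X != 0 -> b X X = 0 ->
  [/\ forall u v, b u v = 0, forall v, l v = 0 & c = 0].
Proof.
move=> Mx Ux qq q0 hX X0 bX.
have [w nw] := jet_neq0 jet Mx Ux; have nx := nsq_gt0 nw.
have [bl bs binv ll] := qq.
have br u : linear_form (b u) by move=> a v v'; rewrite bs bl !(bs u).
have qx : quadric_fun b l c x = 0 by exact: (nbhs_singleton q0).
have nU : \forall y \near x, U y.
  by apply: open_nbhs_nbhs; split=> //; exact: jet_open jet.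
have tan : \forall y \near x, M y -> forall Y, N y Y = 0 -> b y Y + l Y = 0.
  apply: filterS2 nU (near_join q0) => y Uy nq My Y NY.
  exact: (jet_tangent jet My Uy (has_diff_quadric c y qq) nq NY).
have tanx Y : N x Y = 0 -> b x Y + l Y = 0 by move: (nbhs_singleton tan); apply.
(* w is transversal, and f = (b x w + l w) / N x w *)
have key Y v : N x Y = 0 -> N x v = 0 -> b Y v * N x w = (b x w + l w) * h x Y v.
  move=> NY Nv.
  have dl u : has_diff (fun z => b z u + l u : R^o) x (b ^~ u).
    apply: eq_has_diff (has_diffD (has_diff_linear x (bl u)) (has_diff_cst x (l u : R^o))).
    by move=> Y'; rewrite addr0.
  have H := has_diffB (has_diffM (dl v) (jet_dN jet Ux w))
                      (has_diffM (dl w) (jet_dN jet Ux v)).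
  have := jet_tangent jet Mx Ux H _ NY; rewrite Nv (tanx v Nv) mulr0 mul0r addr0 add0r.
  move=> e; apply/eqP; rewrite -subr_eq0 e //.
  apply: filterS tan => y ty My.
  have := ty My (N y w *: v - N y v *: w).
  rewrite !(lfE (Nl y)) !(lfE (br y)) !(lfE ll) => e'.
  have {}e' := e' (etrans (congr1 (fun t => t - _) (mulrC _ _)) (subrr _)).
  by rewrite -[RHS]e'; ring.
have d0 : b x w + l w = 0.
  have [NX _ _ _] := hX; have := key X X NX NX.
  rewrite bX mul0r => /esym/eqP; rewrite mulf_eq0 => /orP[/eqP //|].
  by rewrite (negbTE (hdef Mx Ux hX X0)).
have bT Y v : N x Y = 0 -> N x v = 0 -> b Y v = 0.
  move=> NY Nv; have := key Y v NY Nv; rewrite d0 mul0r => /eqP.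
  by rewrite mulf_eq0 (negbTE nw) orbF => /eqP.
have [nw0 nw1 nw2 nw3] := normal_vecE Jq (Nl x) w.
have b0 : forall u v, b u v = 0.
  apply: (invariant_eq0 Jq (Nl x) (W := normal_vec J1 J2 J3 (N x) w)) => //.
  - by rewrite nw0.
  - by move=> Y Z [NY _ _ _] [NZ _ _ _]; exact: bT.
  - by move=> Y [NY _ _ _]; rewrite !bT.
  - have [<- _ _] := binv (normal_vec J1 J2 J3 (N x) w) (normal_vec J1 J2 J3 (N x) w).
    exact: bT.
have l0 v : l v = 0.
  have lw : l w = 0 by move: d0; rewrite b0 add0r.
  have : l (v - (N x v / N x w) *: w) = 0.
    have := tanx (v - (N x v / N x w) *: w); rewrite b0 add0r; apply.
    by rewrite !(lfE (Nl x)) divfK // subrr.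
  by rewrite !(lfE ll) lw mulr0 subr0.
split=> //; move: qx; rewrite /quadric_fun b0 l0 // mulr0 !add0r; exact.
Qed.

End LocalQuadric.

(** * The complex structures of the flat space *)

Section JTriple.
Variables (R : realType) (n : nat).
Local Notation V := (Hspace R n).

Lemma quat_oppE (p : quat R) :
  (Req (- p) = - Req p) * (Imi (- p) = - Imi p) *
  (Imj (- p) = - Imj p) * (Imk (- p) = - Imk p).
Proof. by rewrite /Req /Imi /Imj /Imk !mxE. Qed.

Lemma imunitE (s : 'I_3) : (Req (imunit R s) = 0) *
  (Imi (imunit R s) = (s == 0)%:R) * (Imj (imunit R s) = (s == 1)%:R) *
  (Imk (imunit R s) = (s == 2)%:R).
Proof.
by case: s => [[|[|[|]]] p] //=; rewrite /Req /Imi /Imj /Imk /imunit !mxE.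
Qed.

Lemma coordq_inj (x y : V) : (forall a, coordq x a = coordq y a) -> x = y.
Proof. by move=> h; apply/row_matrixP. Qed.

Lemma coordqJ s (x : V) a : coordq (J s x) a = coordq x a * - imunit R s.
Proof. by rewrite /coordq /J rowK. Qed.

Lemma coordq_lin c (x y : V) a : coordq (c *: x + y) a = c *: (coordq x a : 'rV_4) + coordq y a.
Proof. by rewrite /coordq linearP. Qed.

Lemma quat_scaleE (c : R) (p : 'rV[R]_4) :
  (Req (c *: p) = c * Req p) * (Imi (c *: p) = c * Imi p) *
  (Imj (c *: p) = c * Imj p) * (Imk (c *: p) = c * Imk p).
Proof. by rewrite /Req /Imi /Imj /Imk !mxE. Qed.

Lemma quat_mulE (p q : quat R) : p * q = quat_mul p q. Proof. by []. Qed.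

Lemma J_triple : quaternionic_triple (@J R n 0) (J 1) (J 2).
Proof.
have lin s c (x y : V) : J s (c *: x + y) = c *: J s x + J s y.
  apply: coordq_inj => a; rewrite coordq_lin !coordqJ coordq_lin.
  by apply: quatP; rewrite !quat_mulE !(mkquatE, quat_addE, quat_scaleE, quat_oppE); ring.
have opp (x : V) a : coordq (- x) a = - coordq x a by rewrite /coordq linearN.
have E (i j : 'I_3) : ((i == j)%:R : R) = (val i == val j)%:R by [].
split; first exact: (lin 0); first exact: (lin 1); first exact: (lin 2).
all: move=> x; apply: coordq_inj => a; rewrite ?opp !coordqJ; move: (coordq x a) => q.
all: apply: quatP; rewrite ?quat_mulE !(mkquatE, quat_oppE, imunitE) !E /=; ring.
Qed.
End JTriple.

(** * The Levi forms of a qc hypersurface *)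

Section ContactUmbilic.
Variables (R : realType) (V : lmodType R) (J : 'I_3 -> V -> V).
Hypothesis Jq : quaternionic_triple (J 0) (J 1) (J 2).
Variables (H : V -> Prop) (h : V -> V -> R) (g : V -> R) (D : 'M[R]_3).
Hypotheses (HJ : forall s X, H X -> H (J s X))
  (hl : forall v, linear_form (h ^~ v)) (hs : forall u v, h u v = h v u)
  (g_gt0 : forall X, H X -> X != 0 -> 0 < g X)
  (gJ : forall s X, H X -> g (J s X) = g X).

Let JE := (qtAA Jq, qtBB Jq, qtCC Jq, qtAB Jq, qtBC Jq, qtCA Jq, qtBA Jq,
  qtCB Jq, qtAC Jq).
Let hr v : linear_form (h v).
Proof. by move=> a u u'; rewrite hs hl !(hs v). Qed.

(** The entry (u, v) is the value on (X, J_v X) of the differential of the form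
    N o J_u, expressed with the Hessian h. *)
Definition levi X : 'M[R]_3 :=
  \matrix_(u, v) (h (J v X) (J u X) - h X (J u (J v X))).

Hypothesis DA : forall X, H X -> D *m levi X = (2 * g X)%:M.

(** The matrix [levi X] is 2 g(X) times the inverse of D, so it is the same at X
    and at J_s X.  But its entry (u, v), u <> v, changes sign when X is replaced
    by J_u X, so it is zero; this is h(J_u X, J_v X) = h(X, J_u J_v X), and the
    right-hand side is skew in u and v. *)
Lemma contact_umbilic X : H X ->
  [/\ h X (J 0 X) = 0, h X (J 1 X) = 0 & h X (J 2 X) = 0] /\
  (X != 0 -> 0 < D 0 0 * h X X).
Proof.
move=> HX; have [->|X0] := eqVneq X 0.
  rewrite (lm0 (qtA Jq)) (lm0 (qtB Jq)) (lm0 (qtC Jq)) (lf0 (hr 0)).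
  by split.
have g0 : 2 * g X != 0 by rewrite mulf_neq0 ?pnatr_eq0 // gt_eqF // g_gt0.
have AE s : levi (J s X) = levi X.
  have e := DA (HJ s HX); rewrite gJ // -(DA HX) in e.
  pose E := (2 * g X)^-1 *: levi X.
  have DE : D *m E = 1%:M by rewrite /E -scalemxAr DA // scale_scalar_mx mulVf.
  have ED := mulmx1C DE.
  by rewrite -[LHS]mul1mx -ED -mulmxA e mulmxA ED mul1mx.
have entry s u v : h (J v (J s X)) (J u (J s X)) - h (J s X) (J u (J v (J s X)))
    = h (J v X) (J u X) - h X (J u (J v X)).
  by have := congr1 (fun A : 'M[R]_3 => A u v) (AE s); rewrite !mxE.
have e01 := entry 0 0 1; have e10 := entry 1 1 0.
have e02 := entry 0 0 2; have e20 := entry 2 2 0.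
have e12 := entry 1 1 2; have e21 := entry 2 2 1.
have e001 := entry 1 0 0; have e110 := entry 0 1 1; have e220 := entry 0 2 2.
have hlN v := lfN (hl v).
have [h0 h01 h02] : [/\ [/\ h X (J 0 X) = 0, h X (J 1 X) = 0 & h X (J 2 X) = 0],
    h (J 0 X) (J 1 X) = 0 & h (J 0 X) (J 2 X) = 0].
  move: e01 e10 e02 e20 e12 e21.
  do 4!rewrite ?JE ?(lmN (qtA Jq)) ?(lmN (qtB Jq)) ?(lmN (qtC Jq)).
  rewrite !(lfN (hr _)) !hlN ?(lfN (hr _)).
  rewrite ?(hs (J 1 X) (J 0 X)) ?(hs (J 2 X) (J 0 X)) ?(hs (J 2 X) (J 1 X)).
  rewrite ?(hs (J 0 X) X) ?(hs (J 1 X) X) ?(hs (J 2 X) X).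
  by move=> *; split; [split|..]; lra.
have h00 : h (J 0 X) (J 0 X) = h X X.
  move: e001 e110 e220.
  do 4!rewrite ?JE ?(lmN (qtA Jq)) ?(lmN (qtB Jq)) ?(lmN (qtC Jq)).
  by rewrite !(lfN (hr _)) !hlN ?(lfN (hr _)) => *; lra.
split=> // _.
have := congr1 (fun A : 'M[R]_3 => A 0 0) (DA HX).
rewrite !mxE eqxx mulr1n !big_ord_recl big_ord0 !mxE.
have -> : lift ord0 ord0 = 1 :> 'I_3 by apply: val_inj.
have -> : lift ord0 (lift ord0 ord0) = 2 :> 'I_3 by apply: val_inj.
rewrite [_ 0 ord0](_ : _ = D 0 0) //.
have [hx0 hx1 hx2] := h0; have gX := g_gt0 HX X0.
do 2!rewrite ?JE ?(lmN (qtA Jq)) ?(lmN (qtB Jq)) ?(lmN (qtC Jq)) ?(lfN (hr _)).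
rewrite h00 h01 h02 hx1 hx2 => e; move: gX; lra.
Qed.
End ContactUmbilic.

Section HorizontalSpace.
Variables (R : realType) (n : nat).
Local Notation V := (Hspace R n).
Local Notation J := (@J R n).
Local Notation Jq := (J_triple R n).
Local Notation hor N := (horizontal (J 0) (J 1) (J 2) N).

Lemma ord3P (P : 'I_3 -> Prop) : P 0 -> P 1 -> P 2 -> forall s, P s.
Proof.
move=> p0 p1 p2 [[|[|[|//]]] p].
- by rewrite (_ : Ordinal p = 0) //; apply: val_inj.
- by rewrite (_ : Ordinal p = 1) //; apply: val_inj.
- by rewrite (_ : Ordinal p = 2) //; apply: val_inj.
Qed.

Lemma J_linear s a (u v : V) : J s (a *: u + v) = a *: J s u + J s v.
Proof.
by elim/ord3P: s; [exact: qtA Jq a u v|exact: qtB Jq a u v|exact: qtC Jq a u v].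
Qed.

Lemma JJ s (v : V) : J s (J s v) = - v.
Proof.
by elim/ord3P: s; [exact: qtAA Jq v|exact: qtBB Jq v|exact: qtCC Jq v].
Qed.

Lemma J_anticomm s t (v : V) : s != t -> J s (J t v) = - J t (J s v).
Proof.
have := (qtAB Jq, qtBC Jq, qtCA Jq, qtBA Jq, qtCB Jq, qtAC Jq) => E.
by elim/ord3P: s; elim/ord3P: t => // _; rewrite !E ?opprK.
Qed.

Lemma horizontalP (N : V -> R) v :
  N v = 0 -> (forall s, N (J s v) = 0) -> hor N v.
Proof. by move=> h0 h; split. Qed.

Lemma horizontal_Js (N : V -> R) s v : linear_form N -> hor N v -> hor N (J s v).
Proof.
by move=> Nl hv; have [h0 h1 h2] := horizontal_J Jq Nl hv; elim/ord3P: s.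
Qed.

(** The inclusion of H in the horizontal space is an equality by dimension: the
    horizontal space is the kernel of a surjective linear map to the
    quaternions, of real dimension 4. *)
Lemma horizontal_subspace (N : V -> R) (H : {vspace V}) (w : V) :
  linear_form N -> N w != 0 -> \dim H = (4 * n)%N ->
  (forall v, v \in H -> hor N v) -> forall v, v \in H <-> hor N v.
Proof.
move=> Nl Nw dH sH v; split; first exact: sH.
pose F (v : V) : 'rV[R]_4 := mkquat (N v) (N (J 0 v)) (N (J 1 v)) (N (J 2 v)).
have Fl : linear F.
  move=> a u u'; apply: quatP; rewrite !(quat_addE, quat_scaleE) !mkquatE ?J_linear;
  by rewrite Nl.
pose FM := GRing.isLinear.Build _ _ _ _ F Fl.
pose FL : {linear V -> 'rV[R]_4} := HB.pack F FM.
pose f := linfun FL.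
have fE u : f u = F u by rewrite lfunE.
have kerP u : u \in lker f <-> hor N u.
  rewrite memv_ker fE; split=> [/eqP e|[h0 h1 h2 h3]].
    have := (congr1 (@Req R) e, congr1 (@Imi R) e, congr1 (@Imj R) e, congr1 (@Imk R) e).
    by rewrite /F !mkquatE /Req /Imi /Imj /Imk !mxE => -[[[a b] c] d]; split.
  apply/eqP/quatP; rewrite /F !mkquatE ?h0 ?h1 ?h2 ?h3;
  by rewrite /Req /Imi /Imj /Imk !mxE.
have n0 : normal_sq (J 0) (J 1) (J 2) N w != 0 by exact: nsq_gt0.
have [nw0 nw1 nw2 nw3] := normal_vecE Jq Nl w.
have surj : limg f = fullv.
  apply/eqP; rewrite eqEsubv subvf /=; apply/subvP => q _.
  pose k := (normal_sq (J 0) (J 1) (J 2) N w)^-1.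
  pose W := normal_vec (J 0) (J 1) (J 2) N w.
  pose u := (k * Req q) *: W - (k * Imi q) *: J 0 W - (k * Imj q) *: J 1 W
    - (k * Imk q) *: J 2 W.
  have -> : q = f u.
    rewrite fE /F /u {u}; move: nw0 nw1 nw2 nw3 n0; rewrite -/W /k {k}.
    clearbody W; move: (normal_sq _ _ _ _ _) => q0 nw0 nw1 nw2 nw3 q00.
    have JE := (qtAA Jq, qtBB Jq, qtCC Jq, qtAB Jq, qtBC Jq, qtCA Jq, qtBA Jq,
      qtCB Jq, qtAC Jq).
    have jD s a b : J s (a + b) = J s a + J s b by exact: lmD (J_linear s) a b.
    have jZ s a b : J s (a *: b) = a *: J s b by exact: lmZ (J_linear s) a b.
    have jN s a : J s (- a) = - J s a by exact: lmN (J_linear s) a.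
    rewrite !jD !jN !jZ !JE !(lfE Nl) nw0 nw1 nw2 nw3.
    by apply: quatP; rewrite mkquatE; field.
  exact: memv_img (memvf _).
have dK : \dim (lker f) = (4 * n)%N.
  have := limg_ker_dim f fullv; rewrite surj capfv !dimvf /= => e.
  have e4 : (\dim (lker f) + 1 * 4 = n.+1 * 4)%N by exact: e.
  by move: e4; rewrite mul1n mulSn addnC => /addnI ->; rewrite mulnC.
have HK : (H <= lker f)%VS by apply/subvP => u /sH; rewrite -kerP.
move=> hv; have /eqP -> : H == lker f by rewrite eqEdim HK dK dH leqnn.
exact/kerP.
Qed.
End HorizontalSpace.

Section QCStructure.
Variables (R : realType) (n : nat).
Local Notation V := (Hspace R n).
Local Notation J := (@J R n).
Local Notation Jq := (J_triple R n).
Local Notation hor N := (horizontal (J 0) (J 1) (J 2) N).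

(** The tangent space is defined through arbitrary local defining functions; rho
    vanishes along M, so its differential kills the vectors that are tangent
    for another one. *)
Lemma tangent_normal (M U : set V) (rho : V -> R^o) y v :
  defining_function M U rho -> M y -> U y -> tangent M y v ->
  jetN rho y v = 0.
Proof.
move=> def My Uy [U' [rho' [def' U'y D0]]].
have jet' := jet_defining def'.
have [oU srho zM _] := def.
have drho : has_diff rho y (fun Y => jetN rho y Y).
  split=> [|Y]; first exact: smooth_differentiable Uy.
  by rewrite (jetNE def).
apply: (jet_tangent jet' My U'y drho); last by rewrite (jetNE def').
have nU : \forall z \near y, U z by apply: open_nbhs_nbhs.
by apply: filterS nU => z Uz Mz; apply/(zM z Uz).
Qed.

Section Frame.
Variables (M U : set V) (N : V -> V -> R) (h : V -> V -> V -> R)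
  (T : V -> V -> V -> V -> R).
Hypothesis jet : hypersurface_jet M U N h T.

Let Nl y : linear_form (N y). Proof. by move=> a u v; exact: (jet_Nlin jet). Qed.

(** A one-form that vanishes on the horizontal spaces along M is a combination
    of N, N o J_1, N o J_2, N o J_3 with differentiable coefficients.  On
    horizontal vectors these four forms vanish, so d eta involves their
    derivatives but not those of the coefficients. *)
Lemma dform_horizontal (eta : V -> 'Hom(V, R^o)) x : M x -> U x ->
  (forall v, differentiable (fun y => eta y v : R^o) x) ->
  (\forall y \near x, M y -> forall v, hor (N y) v -> eta y v = 0) ->
  exists k : 'I_3 -> R, forall X Y, hor (N x) X -> hor (N x) Y ->
    dform eta x X Y = \sum_t k t * (h x Y (J t X) - h x X (J t Y)).
Proof.
move=> Mx Ux deta eta0.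
have [w nw] := jet_neq0 jet Mx Ux; have nx := nsq_gt0 (J 0) (J 1) (J 2) nw.
pose W y := normal_vec (J 0) (J 1) (J 2) (N y) w.
pose q y := normal_sq (J 0) (J 1) (J 2) (N y) w.
have dN v : dif (fun y => N y v) x by case: (jet_dN jet Ux v).
have dW : vdif W x.
  rewrite /W /normal_vec.
  do 3!(apply: vdifD; last by apply: vdifZ (dN _) (vdif_cst _ _)).
  exact: vdifZ (dN _) (vdif_cst _ _).
have etal y : linear_form (fun v => eta y v : R) by move=> a u v; rewrite linearP.
have dk (f : V -> V) : vdif f x -> dif (fun y => (q y)^-1 * eta y (f y)) x.
  move=> df; apply: difM; first exact/difV/(dif_normal_sq jet).
  exact: (dif_form (N := fun y v => eta y v)).
have dJ s : vdif (fun y => J s (W y)) x by apply: vdif_lin dW; exact: J_linear.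
pose k0 y := (q y)^-1 * eta y (W y).
pose k s y := (q y)^-1 * eta y (J s (W y)).
have nU : \forall y \near x, U y by apply: open_nbhs_nbhs; split=> //; exact: jet_open jet.
have nq : \forall y \near x, q y != 0.
  have c : {for x, continuous (fun y => q y : R^o)}.
    exact/differentiable_continuous/(dif_normal_sq jet).
  exact: (cvgr_neq0 _ c nx).
have D X Y : hor (N x) X -> N x Y = 0 -> 'D_Y (fun y => eta y X : R^o) x =
    h x Y X * k0 x - h x Y (J 0 X) * k 0 x - h x Y (J 1 X) * k 1 x
      - h x Y (J 2 X) * k 2 x.
  move=> [X0 X1 X2 X3] NY.
  have H := has_diffB (has_diff_derive (deta X)) (has_diffB (has_diffB (has_diffB
    (has_diffM0 (jet_dN jet Ux X) X0 (dk _ dW))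
    (has_diffM0 (jet_dN jet Ux (J 0 X)) X1 (dk _ (dJ 0))))
    (has_diffM0 (jet_dN jet Ux (J 1 X)) X2 (dk _ (dJ 1))))
    (has_diffM0 (jet_dN jet Ux (J 2 X)) X3 (dk _ (dJ 2)))).
  apply/eqP; rewrite -subr_eq0; apply/eqP; apply: (jet_tangent jet Mx Ux H _ NY).
  apply: filterS3 eta0 nU nq => y e0 Uy qy My.
  have := e0 My _ (horizontal_hproj Jq (Nl y) qy X).
  rewrite /hproj /vert -/(W y) -/(q y) => e.
  apply/eqP; rewrite subr_eq0; apply/eqP; move: e.
  rewrite !(lfE (etal y)) => /eqP; rewrite subr_eq0 => /eqP ->; ring.
exists (k ^~ x) => X Y hX hY; have [NX _ _ _] := hX; have [NY _ _ _] := hY.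
rewrite /dform (D Y X hY NX) (D X Y hX NY) (jet_hsym jet Ux X Y).
rewrite !big_ord_recl big_ord0.
have -> : lift ord0 ord0 = 1 :> 'I_3 by apply: val_inj.
have -> : lift ord0 (lift ord0 ord0) = 2 :> 'I_3 by apply: val_inj.
rewrite -[ord0]/(0 : 'I_3); ring.
Qed.

End Frame.

Section Umbilic.
Variables (M : set V) (S : qc_structure M).
Hypothesis SJ : forall x, M x -> forall s : 'I_3,
  exists2 f, f \in qc_Q S x &
    forall X : subvs_of (qc_H S x), vsval (f X) = J s (vsval X).
Variables (U : set V) (rho : V -> R^o).
Hypothesis def : defining_function M U rho.
Local Notation N := (jetN rho).
Local Notation h := (jeth rho).
Let jet := jet_defining def.
Let Nl y : linear_form (N y). Proof. by move=> a u v; exact: (jet_Nlin jet). Qed.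

(** H is contained in the tangent space and J_s-invariant, hence in the
    horizontal space. *)
Lemma qc_H_horizontal y v : M y -> U y -> v \in qc_H S y <-> hor (N y) v.
Proof.
move=> My Uy; have [w Nw] := jet_neq0 jet My Uy.
apply: (horizontal_subspace (Nl y) Nw (qc_H_dim S My)) => u uH.
have HT u' : u' \in qc_H S y -> N y u' = 0.
  by move=> hu; exact: tangent_normal def My Uy (qc_H_tangent My hu).
apply: horizontalP => [|s]; first exact: HT.
apply: HT; have [f _ fE] := SJ My s.
by have := fE (vsproj (qc_H S y) u); rewrite vsprojK // => <-; exact: subvsP.
Qed.

(** Write J_s = sum_t b_st I_t on H and d eta_t = sum_u k_tu (Levi form of index
    u), by [dform_horizontal].  Then 2 g(J_s X, J_v X) is the entry (s, v) of
    b k levi(X), and it is 2 g(X, X) for s = v and 0 otherwise: the J_s are skew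
    for g because the I_t are, and they satisfy the quaternion relations.  So
    [contact_umbilic] applies with D = b k. *)
Lemma qc_umbilic x : M x -> U x ->
  (forall X, hor (N x) X ->
     [/\ h x X (J 0 X) = 0, h x X (J 1 X) = 0 & h x X (J 2 X) = 0]) /\
  exists c, forall X, hor (N x) X -> X != 0 -> 0 < c * h x X X.
Proof.
move=> Mx Ux.
have [U' [eta [I [oU' U'x [etas Hf _ fr] _]]]] := qc_frame S Mx.
have [II [_ _ _] Qspan gI gd] := fr x Mx U'x.
pose H := qc_H S x; pose g := @qc_g _ _ _ S x.
have HP v : v \in H <-> hor (N x) v by exact: qc_H_horizontal.
have gl X Y Z a : g (a *: X + Y) Z = a * g X Z + g Y Z by exact: qc_g_linear.
have gs X Y : g X Y = g Y X by exact: qc_g_sym.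
have glf Z : linear_form (fun X => g X Z) by move=> a X Y; exact: gl.
have grf Z : linear_form (g Z).
  by move=> a X Y; rewrite gs gl !(gs Z).
have Isk s X Y : g (I s x X) Y = - g X (I s x Y).
  have e : I s x (I s x X) = - X.
    have := congr1 (fun f : 'End(subvs_of H) => f X) (II s).
    by rewrite comp_lfunE opp_lfunE id_lfunE.
  have gI' X' Y' : g (I s x X') (I s x Y') = g X' Y' by exact: gI.
  by rewrite -gI' e (lfN (glf _)).
have [k kP] : exists k : 'I_3 -> 'I_3 -> R, forall s X Y, hor (N x) X -> hor (N x) Y ->
    dform (eta s) x X Y = \sum_t k s t * (h x Y (J t X) - h x X (J t Y)).
  have ex s : exists ks : 'I_3 -> R, forall X Y, hor (N x) X -> hor (N x) Y ->
    dform (eta s) x X Y = \sum_t ks t * (h x Y (J t X) - h x X (J t Y)).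
    apply: (dform_horizontal jet Mx Ux).
      by move=> v; exact: smooth_differentiable (etas s v) _ U'x.
    have nU : \forall y \near x, U y.
      by apply: open_nbhs_nbhs; split=> //; exact: jet_open jet.
    have nU' : \forall y \near x, U' y by apply: open_nbhs_nbhs.
    apply: filterS2 nU nU' => y Uy U'y My v hv.
    have vH : v \in qc_H S y by apply/qc_H_horizontal.
    by have [_ ->] := (Hf y My U'y v).1 vH.
  by have [ks ksP] := choice ex; exists ks.
have exf (s : 'I_3) : exists f : 'End(subvs_of H), f \in qc_Q S x /\
    forall X, vsval (f X) = J s (vsval X).
  by have [f f1 f2] := SJ Mx s; exists f.
have [f fP] := choice exf.
have exb s : exists bs : 'I_3 -> R, f s = \sum_t bs t *: I t x.
  have [+ _] := fP s; rewrite Qspan.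
  rewrite !span_cons span_nil addv0 => /memv_addP[f1 /vlineP[a ->]].
  move=> [f2 /memv_addP[f3 /vlineP[a' ->] [f4 /vlineP[a'' ->] ->]] ->].
  exists (fun t => [:: a; a'; a'']`_t).
  rewrite !big_ord_recl big_ord0 addr0 /=.
  have -> : lift ord0 ord0 = 1 :> 'I_3 by apply: val_inj.
  by have -> : lift ord0 (lift ord0 ord0) = 2 :> 'I_3 by apply: val_inj.
have [b bP] := choice exb.
have fE s X : f s X = \sum_t b s t *: I t x X.
  by rewrite bP sum_lfunE; apply: eq_bigr => t _; rewrite lfunE.
have gsum (J0 : finType) (F : J0 -> subvs_of H) Z : g (\sum_i F i) Z = \sum_i g (F i) Z.
  by apply: (big_morph (fun X => g X Z)); [exact: lfD (glf Z) | exact: lf0 (glf Z)].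
have fsk s X Y : g (f s X) Y = - g X (f s Y).
  rewrite !fE gsum gs gsum -sumrN; apply: eq_bigr => t _.
  by rewrite !(lfZ (glf _)) Isk mulrN (gs X).
pose pr (X : V) : subvs_of H := vsproj H X.
have prK X : hor (N x) X -> vsval (pr X) = X by move=> /HP; exact: vsprojK.
have prJ s X : hor (N x) X -> pr (J s X) = f s (pr X).
  move=> hX; apply: val_inj; rewrite /= (proj2 (fP s)) !prK //.
  exact: horizontal_Js.
have ff s X : f s (f s X) = - X.
  by apply: (can_inj (@vsvalK _ _ H)); rewrite !(proj2 (fP s)) JJ linearN.
have ffN s t X : s != t -> f s (f t X) = - f t (f s X).
  move=> st; apply: (can_inj (@vsvalK _ _ H)).
  rewrite linearN -[X in - X]/(vsval (f t (f s X))).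
  by rewrite (proj2 (fP s)) !(proj2 (fP t)) (proj2 (fP s)) J_anticomm.
have gff s v X : g (f s X) (f v X) = (s == v)%:R * g X X.
  have [->|sv] := eqVneq s v.
    by rewrite fsk ff (lfN (grf _)) opprK mul1r.
  rewrite mul0r; have e : g (f s X) (f v X) = - g (f s X) (f v X).
    rewrite [LHS]fsk ffN // (lfN (grf _)) opprK.
    by have := fsk v X (f s X); rewrite (gs (f v X)) => ->; rewrite opprK.
  lra.
pose D : 'M[R]_3 := \matrix_(s, u) \sum_t b s t * k t u.
have DA X : hor (N x) X ->
    D *m levi J (h x) X = (2 * g (pr X) (pr X))%:M.
  move=> hX; apply/matrixP => s v; rewrite !mxE.
  transitivity (2 * g (f s (pr X)) (f v (pr X))); last first.
    by rewrite gff -mulr_natl; ring.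
  have hv := horizontal_Js v (Nl x) hX.
  rewrite -(prJ v X hX) fE gsum mulr_sumr.
  transitivity (\sum_t b s t * \sum_u k t u *
     (h x (J v X) (J u X) - h x X (J u (J v X)))).
    under eq_bigr do rewrite !mxE mulr_suml.
    rewrite exchange_big /=; apply: eq_bigr => t _; rewrite mulr_sumr.
    by apply: eq_bigr => u _; rewrite mulrA.
  apply: eq_bigr => t _; rewrite (lfZ (glf _)) mulrCA; congr (_ * _).
  by rewrite -(kP t X (J v X) hX hv) (gd t) !prK.
have hlx v : linear_form (fun u => h x u v).
  by move=> a u u'; exact: (jet_hlin jet).
have cu X : hor (N x) X -> _ := fun hX => contact_umbilic Jq
  (H := fun X => hor (N x) X) (fun s Y hY => horizontal_Js s (Nl x) hY)
  hlx (jet_hsym jet Ux) (g := fun X => g (pr X) (pr X)) _ _ DA hX.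
have {}cu X : hor (N x) X ->
   [/\ h x X (J 0 X) = 0, h x X (J 1 X) = 0 & h x X (J 2 X) = 0] /\
   (X != 0 -> 0 < D 0 0 * h x X X).
  move=> hX; apply: cu => //.
  - move=> Z hZ Z0; apply: qc_g_pos => //; apply: contraNneq Z0 => e.
    by rewrite -(prK Z hZ) e linear0.
  - by move=> s Z hZ; rewrite prJ // gff eqxx mul1r.
split=> [X /cu[]//|]; exists (D 0 0) => X hX; exact: (cu X hX).2.
Qed.

Lemma qc_horizontal_neq0 x : (1 <= n)%N -> M x -> U x ->
  exists2 X, hor (N x) X & X != 0.
Proof.
move=> n1 Mx Ux; exists (vpick (qc_H S x)).
  by apply/(qc_H_horizontal _ Mx Ux); exact: memv_pick.
rewrite vpick0 -dimv_eq0 (qc_H_dim S Mx) muln_eq0 /=.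
by case: (n) n1.
Qed.

End Umbilic.
End QCStructure.

(** * The global quadric and linear functions on the hypersurface *)

Section Global.
Variables (R : realType) (n : nat).
Local Notation V := (Hspace R n).
Local Notation J := (@J R n).
Local Notation Jq := (J_triple R n).
Local Notation hor N := (horizontal (J 0) (J 1) (J 2) N).
Local Notation quad := (quaternionic_quadric (J 0) (J 1) (J 2)).
Variable M : set V.
Hypotheses (n_gt0 : (1 <= n)%N) (M_qc : qc_hypersurface M).

Lemma qc_germ x : M x -> exists U N h T,
  [/\ hypersurface_jet M U N h T, U x,
    (forall y, M y -> U y -> forall X, hor (N y) X ->
       [/\ h y X (J 0 X) = 0, h y X (J 1 X) = 0 & h y X (J 2 X) = 0]),
    (forall y, M y -> U y -> exists c, forall X, hor (N y) X -> X != 0 ->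
       0 < c * h y X X)
  & (forall y, M y -> U y -> exists2 X, hor (N y) X & X != 0)].
Proof.
move=> Mx; have [emb [S SJ]] := M_qc; have [U [rho [def Ux]]] := emb x Mx.
exists U, (jetN rho), (jeth rho), (jetT rho); split.
- exact: jet_defining.
- exact: Ux.
- by move=> y My Uy; case: (qc_umbilic SJ def My Uy).
- by move=> y My Uy; case: (qc_umbilic SJ def My Uy).
- by move=> y My Uy; exact: (qc_horizontal_neq0 SJ def n_gt0 My Uy).
Qed.

Let hdefP (N : V -> R) (h : V -> V -> R) : (exists c, forall X, hor N X -> X != 0 ->
  0 < c * h X X) -> forall X, hor N X -> X != 0 -> h X X != 0.
Proof.
by move=> [c hc] X hX X0; apply: contraTneq (hc X hX X0) => ->; rewrite mulr0 ltxx.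
Qed.

Lemma quaternionic_quadric_comb b l b' l' a e : quad b l -> quad b' l' ->
  quad (fun u v => a * b u v + e * b' u v) (fun v => a * l v + e * l' v).
Proof.
move=> [bl bs bi ll] [bl' bs' bi' ll']; split.
- by move=> v k u u'; rewrite bl bl'; ring.
- by move=> u v; rewrite bs bs'.
- by move=> u v; have [-> -> ->] := bi u v; have [-> -> ->] := bi' u v.
- by move=> k u u'; rewrite ll ll'; ring.
Qed.

(** For a horizontal vector X the combination b'(X, X) q - b(X, X) q' of the two
    quadratic functions vanishes on M and is degenerate in the direction X, so
    [quadric_eq0] applies. *)
Lemma quadric_unique x b l c b' l' c' : M x -> quad b l -> quad b' l' ->
  (\forall y \near x, M y -> quadric_fun b l c y = 0) ->
  (\forall y \near x, M y -> quadric_fun b' l' c' y = 0) ->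
  (exists z Y, b' z Y + l' Y != 0) ->
  exists k, forall y, quadric_fun b l c y = k * quadric_fun b' l' c' y.
Proof.
move=> Mx qq qq' q0 q0' nz.
have [U [N [h [T [jet Ux hJ hd hne]]]]] := qc_germ Mx.
have hdef y : M y -> U y -> forall X, hor (N y) X -> X != 0 -> h y X X != 0.
  by move=> My Uy; apply: hdefP; exact: hd.
have [X hX X0] := hne x Mx Ux.
have bX : b' X X != 0.
  apply/eqP => bX; have [b0 l0 _] :=
    quadric_eq0 jet Jq hdef Mx Ux qq' q0' hX X0 bX.
  case: nz => z [Y].
  by rewrite b0 l0 addr0 eqxx.
have qc := quaternionic_quadric_comb (b' X X) (- b X X) qq qq'.
have fE y : quadric_fun (fun u v => b' X X * b u v + - b X X * b' u v)
    (fun v => b' X X * l v + - b X X * l' v) (b' X X * c + - b X X * c') y =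
    b' X X * quadric_fun b l c y - b X X * quadric_fun b' l' c' y.
  by rewrite /quadric_fun; ring.
have near0 : \forall y \near x, M y -> quadric_fun
   (fun u v => b' X X * b u v + - b X X * b' u v)
    (fun v => b' X X * l v + - b X X * l' v) (b' X X * c + - b X X * c') y = 0.
  by apply: filterS2 q0 q0' => y h1 h2 My; rewrite fE h1 // h2 // !mulr0 subrr.
have [b0 l0 c0] := quadric_eq0 jet Jq hdef Mx Ux qc near0 hX X0
  (ltac:(ring) : b' X X * b X X + - b X X * b' X X = 0).
exists (b X X / b' X X) => y.
have := fE y; rewrite {1}/quadric_fun b0 l0 c0 mulr0 !addr0 => /esym/eqP.
rewrite subr_eq0 => /eqP e; apply: (mulfI bX); rewrite e; field.
done.
Qed.

Hypotheses (M_neq0 : M !=set0) (M_conn : connected M).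

(** The set of points of M near which a given local equation q vanishes on M is
    open in M.  It is closed: near a limit point y there is a local equation q'
    too, both hold near some point of M, and [quadric_unique] there makes q a
    multiple of q'.  The sign of the equation is chosen so that its quadratic
    part is positive, not only definite, on the horizontal space at x. *)
Lemma global_quadric : exists x b l c, [/\ M x, quad b l,
    forall y, M y -> quadric_fun b l c y = 0,
    exists v, b x v + l v != 0
  & forall X, hor (fun v => b x v + l v) X -> X != 0 -> 0 < b X X].
Proof.
have [x Mx] := M_neq0.
have loc y : M y -> exists b l c, [/\ quad b l,
    \forall z \near y, M z -> quadric_fun b l c z = 0,
    exists v, b y v + l v != 0
    & forall X, hor (fun v => b y v + l v) X -> X != 0 -> 0 < b X X].
  move=> My; have [U [N [h [T [jet Uy hJ hd hne]]]]] := qc_germ My.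
  have hdef z : M z -> U z -> forall X, hor (N z) X -> X != 0 -> h z X X != 0.
    by move=> Mz Uz; apply: hdefP; exact: hd.
  have [b [l [c [qq q0 bN bh]]]] := local_quadric jet Jq hJ hdef hne My Uy.
  have [s hs] := hd y My Uy.
  have s0 : s != 0.
    have [X hX X0] := hne y My Uy.
    by apply: contraTneq (hs X hX X0) => ->; rewrite mul0r ltxx.
  exists (fun u v => s * b u v + 0 * b u v), (fun v => s * l v + 0 * l v), (s * c).
  have bN' v : s * b y v + 0 * b y v + (s * l v + 0 * l v) = s * N y v.
    by rewrite !mul0r !addr0 -mulrDr bN.
  split.
  - exact: quaternionic_quadric_comb.
  - apply: filterS q0 => z hz Mz; rewrite /quadric_fun !mul0r !addr0.
    by rewrite -[RHS](mulr0 s) -(hz Mz) /quadric_fun; ring.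
  - by have [v Nv] := jet_neq0 jet My Uy; exists v; rewrite bN' mulf_neq0.
  - move=> X hX X0; rewrite mul0r addr0.
    have z v : s * b y v + 0 * b y v + (s * l v + 0 * l v) = 0 -> N y v = 0.
      by rewrite bN' => /eqP; rewrite mulf_eq0 (negbTE s0) => /eqP.
    have hX' : hor (N y) X by case: hX => h0 h1 h2 h3; split; exact: z.
    by rewrite bh //; exact: hs.
have [b [l [c [qq q0 nz sg]]]] := loc x Mx.
exists x, b, l, c; split=> //.
pose A : set V := fun y => M y /\ \forall z \near y, M z -> quadric_fun b l c z = 0.
suff AM : A = M by move=> y My; have : A y by [rewrite AM]; case=> _ /nbhs_singleton; exact.
apply: M_conn.
- by exists x.
- exists [set y | M y -> quadric_fun b l c y = 0]°; first exact: open_interior.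
  by apply/seteqP; split=> y [].
- exists (closure A); first exact: closed_closure.
  apply/seteqP; split=> [y Ay|y [My cAy]]; first by split; [case: Ay | exact: subset_closure].
  split=> //; have [b' [l' [c' [qq' q0' nz' _]]]] := loc y My.
  have [z [[Mz z0] z0']] := cAy _ (near_join q0').
  have [k kP] : exists k, forall w, quadric_fun b l c w = k * quadric_fun b' l' c' w.
    apply: quadric_unique Mz qq qq' z0 z0' _; case: nz' => v nv.
    by exists y, v.
  by apply: filterS q0' => w hw Mw; rewrite kP hw // mulr0.
Qed.

Section Maximum.
Variables (b : V -> V -> R) (l : V -> R) (c : R) (y : V).
Hypotheses (qq : quad b l) (q0 : forall z, M z -> quadric_fun b l c z = 0).
Hypothesis (My : M y).

(** The differential of the equation vanishes on the tangent space at y; being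
    nonzero it has no other zeros, so Y is tangent and [jet_max] applies. *)
Lemma linear_max (L : V -> R) Y : (exists v, b y v + l v != 0) ->
  linear_form L -> (forall z, M z -> L z <= L y) -> b y Y + l Y = 0 -> L Y = 0.
Proof.
move=> [v nv] Ll Lmax dY.
have [U [N [h [T [jet Uy _ _ _]]]]] := qc_germ My.
have Nl : linear_form (N y) by move=> a u u'; exact: (jet_Nlin jet).
have [w Nw] := jet_neq0 jet My Uy.
have dl : linear_form (fun u => b y u + l u).
  move=> a u u'; rewrite (linear_form_r (qq_lin qq) (qq_sym qq)) (qq_lf qq); ring.
have NY : N y Y = 0.
  have tan u : N y u = 0 -> b y u + l u = 0.
    apply: (jet_tangent jet My Uy (has_diff_quadric c y qq)).
    apply: filterS (filterT : nbhs y setT) => z _; exact: q0.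
  have tu u : b y u + l u = N y u / N y w * (b y w + l w).
    have := tan (u - (N y u / N y w) *: w).
    rewrite !(lfE Nl) divfK // subrr => /(_ erefl).
    have -> : b y (u - (N y u / N y w) *: w) + l (u - (N y u / N y w) *: w) =
      (b y u + l u) - N y u / N y w * (b y w + l w).
      by rewrite -(lfZ dl) -(lfN dl) -(lfD dl).
    by move/eqP; rewrite subr_eq0 => /eqP.
  move: nv dY; rewrite (tu v) (tu Y) mulf_eq0 negb_or => /andP[_ dw].
  move/eqP; rewrite !mulf_eq0 (negbTE dw) orbF invr_eq0 (negbTE Nw) orbF.
  by move=> /eqP.
apply: (jet_max jet My Uy (has_diff_linear y Ll) _ NY).
by apply: filterS (filterT : nbhs y setT) => z _; exact: Lmax.
Qed.

(** This is used to see that M is not a single point. *)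
Lemma tangent_neq0 : exists2 X, X != 0 & forall L, linear_form L ->
  (forall z, M z -> L z <= L y) -> L X = 0.
Proof.
have [U [N [h [T [jet Uy _ _ hne]]]]] := qc_germ My.
have [X [NX _ _ _] X0] := hne y My Uy; exists X => // L Ll Lmax.
apply: (jet_max jet My Uy (has_diff_linear y Ll) _ NX).
by apply: filterS (filterT : nbhs y setT) => z _; exact: Lmax.
Qed.

End Maximum.

End Global.

(** * Quaternionic linear maps *)

Section RightMul.
Variables (R : realType) (n : nat).
Local Notation V := (Hspace R n).
Local Notation J := (@J R n).
Local Notation Jq := (J_triple R n).

(** Right multiplication by a quaternion, for which the J_s are the
    multiplications by -i, -j, -k. *)
Definition rmul (u : V) (q : quat R) : V :=
  Req q *: u - Imi q *: J 0 u - Imj q *: J 1 u - Imk q *: J 2 u.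

Lemma coordq_rmul u q a : coordq (rmul u q) a = coordq u a * q.
Proof.
have opp (x : V) : coordq (- x) a = - coordq x a by rewrite /coordq linearN.
have add (x y : V) : coordq (x + y) a = coordq x a + coordq y a by rewrite /coordq linearD.
have scal c (x : V) : coordq (c *: x) a = c *: (coordq x a : 'rV_4) by rewrite /coordq linearZ.
rewrite /rmul !(opp, add, scal) !coordqJ; move: (coordq u a) => p.
have E (i j : 'I_3) : ((i == j)%:R : R) = (val i == val j)%:R by [].
apply: quatP; rewrite ?(quat_addE, quat_oppE, quat_scaleE) !quat_mulE;
  rewrite ?(mkquatE, quat_addE, quat_oppE, quat_scaleE) !imunitE !E /=; ring.
Qed.

Lemma coordqD (x y : V) a : coordq (x + y) a = coordq x a + coordq y a.
Proof. by rewrite /coordq linearD. Qed.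

Lemma coordqZ c (x : V) a : coordq (c *: x) a = c *: (coordq x a : 'rV_4).
Proof. by rewrite /coordq linearZ. Qed.

Lemma coordqN (x : V) a : coordq (- x) a = - coordq x a.
Proof. by rewrite /coordq linearN. Qed.

Definition J_linear_map (f : V -> V) :=
  (forall a u v, f (a *: u + v) = a *: f u + f v) /\
  forall s u, f (J s u) = J s (f u).

Lemma J_linear_rmul f : J_linear_map f -> forall u q, f (rmul u q) = rmul (f u) q.
Proof.
move=> [fl fJ] u q; rewrite /rmul.
by rewrite !(lmD fl) !(lmN fl) !(lmZ fl) !fJ.
Qed.

Definition unitq (j : 'I_n.+1) : V := \matrix_a ((a == j)%:R : quat R).

Lemma coordq_unitq j a : coordq (unitq j) a = (a == j)%:R.
Proof. by rewrite /coordq /unitq rowK. Qed.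

Lemma coordq_sum (I : finType) (F : I -> V) a :
  coordq (\sum_i F i) a = \sum_i coordq (F i) a.
Proof. by rewrite /coordq linear_sum. Qed.

Lemma unitq_sum (x : V) : x = \sum_j rmul (unitq j) (coordq x j).
Proof.
apply: coordq_inj => a; rewrite coordq_sum (bigD1 a) //= big1 ?addr0.
  by rewrite coordq_rmul coordq_unitq eqxx mul1r.
by move=> j ja; rewrite coordq_rmul coordq_unitq eq_sym (negbTE ja) mul0r.
Qed.

Definition quat_matrix (f : V -> V) : 'M[quat R]_n.+1 :=
  \matrix_(i, j) coordq (f (unitq j)) i.

Lemma quat_matrixE f x : J_linear_map f -> colq (f x) = quat_matrix f *m colq x.
Proof.
move=> Jf; apply/colP => i; rewrite !mxE {1}(unitq_sum x).
have -> : f (\sum_j rmul (unitq j) (coordq x j)) = \sum_j f (rmul (unitq j) (coordq x j)).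
  by apply: big_morph; [exact: lmD Jf.1 | exact: lm0 Jf.1].
rewrite coordq_sum; apply: eq_bigr => j _.
by rewrite J_linear_rmul // coordq_rmul !mxE.
Qed.

Lemma quat_matrixM f g : J_linear_map f -> cancel g f ->
  quat_matrix f *m quat_matrix g = 1%:M.
Proof.
move=> Jf fg; apply/matrixP => i j; rewrite !mxE.
have := quat_matrixE (g (unitq j)) Jf; rewrite fg => /colP /(_ i).
rewrite !mxE coordq_unitq => ->; apply: eq_bigr => k _.
by rewrite !mxE.
Qed.

(** A real linear map that commutes with the J_s is linear for right
    multiplication by quaternions, hence given by a matrix acting on the left;
    the factor omega can be taken to be 1. *)
Lemma J_linear_affine f g (q0 : V) : J_linear_map f -> J_linear_map g ->
  cancel f g -> cancel g f -> quaternionic_affine (fun x => f x + q0).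
Proof.
move=> Jf Jg fK gK.
exists (quat_matrix f), 1, q0; split.
- by exists (quat_matrix g); split; apply: quat_matrixM.
- rewrite /normsq [1]/(quat_one R) !mkquatE; ring.
- move=> x; rewrite -quat_matrixE //.
  have -> : conjq (1 : quat R) = 1.
    by apply: quatP; rewrite /conjq [1]/(quat_one R) !mkquatE ?oppr0.
  apply/colP => i; rewrite !mxE mulr1.
  by rewrite /coordq linearD.
Qed.

(** The quaternionic covector with real part f; it is linear for right
    multiplication by quaternions ([qform_rmul]). *)
Definition qform (f : V -> R) (v : V) : quat R :=
  mkquat (f v) (f (J 0 v)) (f (J 1 v)) (f (J 2 v)).

Lemma qform_lin f a (u v : V) : linear_form f ->
  qform f (a *: u + v) = a *: (qform f u : 'rV_4) + qform f v.
Proof.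
move=> fl; apply: quatP; rewrite !(quat_addE, quat_scaleE) !mkquatE ?J_linear;
by rewrite fl.
Qed.

Lemma qformD f u v : linear_form f -> qform f (u + v) = qform f u + qform f v.
Proof. by move=> fl; have := qform_lin 1 u v fl; rewrite !scale1r. Qed.

Lemma qform_zero f : linear_form f -> qform f 0 = 0.
Proof.
by move=> fl; have := qformD 0 0 fl; rewrite addr0 => /eqP;
  rewrite -subr_eq0 opprD addrA subrr sub0r oppr_eq0 => /eqP.
Qed.

Lemma qformZ f a u : linear_form f -> qform f (a *: u) = a *: (qform f u : 'rV_4).
Proof. by move=> fl; have := qform_lin a u 0 fl; rewrite addr0 qform_zero // addr0. Qed.

Lemma qformN f u : linear_form f -> qform f (- u) = - qform f u.
Proof. by move=> fl; have := qformZ (-1) u fl; rewrite !scaleN1r. Qed.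

Lemma qform_sum (I : finType) (F : I -> V) f : linear_form f ->
  qform f (\sum_i F i) = \sum_i qform f (F i).
Proof.
move=> fl; apply: (big_morph (qform f)) => [u v|]; first exact: qformD.
exact: qform_zero.
Qed.

Lemma qform_rmul f v q : linear_form f -> qform f (rmul v q) = qform f v * q.
Proof.
move=> fl.
have JE := (qtAA Jq, qtBB Jq, qtCC Jq, qtAB Jq, qtBC Jq, qtCA Jq, qtBA Jq,
      qtCB Jq, qtAC Jq).
have jD s a b : J s (a + b) = J s a + J s b by exact: lmD (J_linear s) a b.
have jZ s a b : J s (a *: b) = a *: J s b by exact: lmZ (J_linear s) a b.
have jN s a : J s (- a) = - J s a by exact: lmN (J_linear s) a.
by apply: quatP; rewrite quat_mulE /qform /rmul !mkquatE;
  rewrite ?(jD, jN, jZ) ?JE !(lfE fl); ring.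
Qed.

Lemma qform0 f v : qform f v = 0 <-> [/\ f v = 0, f (J 0 v) = 0, f (J 1 v) = 0 & f (J 2 v) = 0].
Proof.
split=> [e|[h0 h1 h2 h3]].
  have := (congr1 (@Req R) e, congr1 (@Imi R) e, congr1 (@Imj R) e, congr1 (@Imk R) e).
  by rewrite /qform !mkquatE /Req /Imi /Imj /Imk !mxE => -[[[a b] c] d]; split.
apply: quatP; rewrite /qform !mkquatE ?h0 ?h1 ?h2 ?h3;
by rewrite /Req /Imi /Imj /Imk !mxE.
Qed.

End RightMul.

(** * Hermitian normal form of a quadric *)

Section GramSchmidt.
Variables (R : realType) (n : nat).
Local Notation V := (Hspace R n).
Local Notation J := (@J R n).
Local Notation Jq := (J_triple R n).
Local Notation hor N := (horizontal (J 0) (J 1) (J 2) N).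
Variables (b : V -> V -> R) (N : V -> R) (w : V).
Hypotheses (bl : forall v, linear_form (b ^~ v)) (bs : forall u v, b u v = b v u)
  (bi : forall u v, [/\ b (J 0 u) (J 0 v) = b u v, b (J 1 u) (J 1 v) = b u v
    & b (J 2 u) (J 2 v) = b u v])
  (Nl : linear_form N) (Nw : N w != 0)
  (b_gt0 : forall X, hor N X -> X != 0 -> 0 < b X X).

Let br u : linear_form (b u). Proof. exact: linear_form_r bl bs u. Qed.

(** The quaternionic Hermitian form whose real part is the invariant form b. *)
Definition hermitian (u v : V) : quat R := qform (b u) v.
Local Notation beta := hermitian.

Lemma conjq0 : conjq (0 : quat R) = 0.
Proof.
by apply: quatP; rewrite /conjq !mkquatE /Req /Imi /Imj /Imk !mxE ?oppr0.
Qed.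

Lemma normsq_conj (q : quat R) : normsq q = Req (conjq q * q).
Proof. by rewrite quat_mulE /normsq /conjq !mkquatE; ring. Qed.

Lemma hermitian_conj u v : beta v u = conjq (beta u v).
Proof.
have [s0 s1 s2] := invariant_skewM Jq bl bs bi u v.
apply: quatP; rewrite /conjq /hermitian /qform !mkquatE //.
- by rewrite bs s0.
- by rewrite bs s1.
- by rewrite bs s2.
Qed.

Lemma hermitianE u v p q : b (rmul u p) (rmul v q) = Req (conjq p * beta u v * q).
Proof.
rewrite -mulrA -qform_rmul //; move: (rmul v q) => v'.
have [s0 s1 s2] := invariant_skewM Jq bl bs bi u v'.
rewrite /rmul !(lfD (bl _)) !(lfN (bl _)) !(lfZ (bl _)) s0 s1 s2.
by rewrite quat_mulE /conjq /qform !mkquatE; ring.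
Qed.

Lemma hermitian_self u : beta u u = mkquat (b u u) 0 0 0.
Proof.
have [s0 s1 s2] := invariant_skew Jq bl bs bi u.
by rewrite /hermitian /qform s0 s1 s2.
Qed.

(** Gram-Schmidt in the form of a dimension count: being horizontal and
    orthogonal to the first k vectors amounts to k + 1 quaternionic equations,
    which have a nonzero solution for k < n. *)
Lemma orthonormal_horizontal k : (k <= n)%N -> exists e : nat -> V,
  (forall a, (a < k)%N -> hor N (e a)) /\
  forall a c, (a < k)%N -> (c < k)%N -> beta (e a) (e c) = (a == c)%:R.
Proof.
elim: k => [_|k ih kn]; first by exists (fun=> 0); split.
have [e [eh eo]] := ih (ltnW kn).
pose F (v : V) : 'M[R]_(k.+1, 4) :=
  \matrix_(i < k.+1) (if (i : nat) is j.+1 then beta (e j) v else qform N v).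
have Fl : linear F.
  move=> a u v; apply/row_matrixP => i; rewrite linearP /= !rowK.
  by case: (i : nat) => [|j]; apply: qform_lin.
pose FM := GRing.isLinear.Build _ _ _ _ F Fl.
pose FL : {linear V -> 'M[R]_(k.+1, 4)} := HB.pack F FM.
pose f := linfun FL.
have fE u : f u = F u by rewrite lfunE.
have [u uK u0] : exists2 u, u \in lker f & u != 0.
  exists (vpick (lker f)); first exact: memv_pick.
  rewrite vpick0; apply/eqP => k0.
  have := limg_ker_dim f fullv; rewrite capfv k0 dimv0 add0n => e1.
  have e2 : (\dim (limg f) <= k.+1 * 4)%N.
    by rewrite (leq_trans (dimvS (subvf _))) // dimvf.
  have e3 : (\dim (fullv : {vspace V}) = n.+1 * 4)%N by rewrite dimvf.
  move: e2; rewrite e1 e3 leq_mul2r /= => e2.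
  by move: kn; rewrite ltnNge -ltnS e2.
move: uK; rewrite memv_ker fE => /eqP Fu.
have rowF i : row i (F u) = 0 by rewrite Fu linear0.
have hu : hor N u by have := rowF ord0; rewrite rowK => /qform0.
have eu a : (a < k)%N -> beta (e a) u = 0.
  by move=> ak; have := rowF (lift ord0 (Ordinal ak)); rewrite rowK lift0.
have bu := b_gt0 hu u0.
pose r := (Num.sqrt (b u u))^-1.
have r2 : r * r * b u u = 1.
  by rewrite /r -invfM -expr2 sqr_sqrtr ?ltW // mulVf // gt_eqF.
have betaZ a x y : beta x (a *: y) = a *: (beta x y : 'rV_4).
  rewrite /hermitian; have := qform_lin a y 0 (br x); rewrite addr0 => ->.
  by rewrite (_ : qform (b x) 0 = 0) ?addr0 //; apply/qform0;
    rewrite !(lm0 (J_linear _)) (lf0 (br _)).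
have er a : (a < k)%N -> beta (e a) (r *: u) = 0.
  by move=> ak; rewrite betaZ eu // scaler0.
exists (fun a => if (a < k)%N then e a else r *: u); split=> [a ak|a c].
  case: ifP => [|_]; first exact: eh.
  have [h0 h1 h2 h3] := hu.
  by split; rewrite ?(lmZ (J_linear _)) (lfZ Nl) ?h0 ?h1 ?h2 ?h3 mulr0.
rewrite !ltnS => ak ck.
case: ifP => ak'; case: ifP => ck'.
- exact: eo.
- have -> : (a == c) = false by rewrite ltn_eqF // (leq_trans ak') // leqNgt ck'.
  exact: er.
- have -> : (a == c) = false by rewrite gtn_eqF // (leq_trans ck') // leqNgt ak'.
  by rewrite hermitian_conj er // conjq0.
- have -> : a = k by apply/eqP; rewrite eqn_leq ak leqNgt ak'.
  have -> : c = k by apply/eqP; rewrite eqn_leq ck leqNgt ck'.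
  rewrite eqxx hermitian_self (lfZ (br _)) (lfZ (bl _)) mulrA r2.
  by [].
Qed.

(** An orthonormal frame e_0, ..., e_(n-1) of the horizontal space is completed
    by the vector orthogonal to it at which the covector of N is 1.  This last
    vector need not be positive for b; b0 is its square. *)
Lemma normal_coordinates : exists (Phi Psi : V -> V) (b0 : R),
  [/\ J_linear_map Phi, J_linear_map Psi, cancel Phi Psi, cancel Psi Phi
    & forall z, b (Psi z) (Psi z) = \sum_(a < n) normsq (q_ z a) + b0 * normsq (p_ z)
       /\ N (Psi z) = Req (p_ z)].
Proof.
have [e [eh eo]] := orthonormal_horizontal (leqnn n).
have n0 : normal_sq (J 0) (J 1) (J 2) N w != 0 by exact: nsq_gt0.
have [nw0 nw1 nw2 nw3] := normal_vecE Jq Nl w.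
pose W := (normal_sq (J 0) (J 1) (J 2) N w)^-1 *: normal_vec (J 0) (J 1) (J 2) N w.
have qW : qform N W = 1.
  rewrite qformZ //; apply: quatP; rewrite quat_scaleE /qform !mkquatE ?nw0 ?nw1 ?nw2 ?nw3;
  by rewrite ?mulr0 ?mulVf.
pose en := W - \sum_(a < n) rmul (e a) (beta (e a) W).
have qe a : (a < n)%N -> qform N (e a) = 0.
  by move=> an; apply/qform0; case: (eh a an).
have qen : qform N en = 1.
  rewrite qformD // qformN // qform_sum // qW big1 ?subr0 // => a _.
  by rewrite qform_rmul // qe // mul0r.
have been a : (a < n)%N -> beta (e a) en = 0.
  move=> an; rewrite /hermitian qformD // qformN // qform_sum //.
  rewrite (bigD1 (Ordinal an)) //= big1 ?addr0 => [|c ca].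
    by rewrite qform_rmul // -/(hermitian (e a) (e a)) eo // eqxx mul1r subrr.
  rewrite qform_rmul // -/(hermitian (e a) (e c)) eo //.
  have -> : (a == c) = false.
    by apply/negP => /eqP ac; move/eqP: ca; apply; apply: val_inj.
  by rewrite mul0r.
have eben a : (a < n)%N -> beta en (e a) = 0.
  by move=> an; rewrite hermitian_conj been // conjq0.
pose b0 := b en en.
pose E (a : 'I_n.+1) := if (a < n)%N then e a else en.
pose Psi (z : V) := \sum_a rmul (E a) (coordq z a).
pose Phi (v : V) : V := \matrix_a (if (a < n)%N then beta (e a) v else qform N v).
have EO (i : 'I_n) : E (widen_ord (leqnSn n) i) = e i by rewrite /E /= ltn_ord.
have EM : E ord_max = en by rewrite /E /= ltnn.
have rmulD u p q : rmul u (p + q) = rmul u p + rmul u q.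
  by apply: coordq_inj => a; rewrite coordqD !coordq_rmul mulrDr.
have rmulZ u a p : rmul u (a *: (p : 'rV_4)) = a *: rmul u p.
  apply: coordq_inj => i; rewrite coordqZ !coordq_rmul.
  by apply: quatP; rewrite quat_scaleE !quat_mulE !mkquatE !quat_scaleE; ring.
have PsiJ : J_linear_map Psi.
  split=> [a u v|s u].
    rewrite /Psi scaler_sumr -big_split; apply: eq_bigr => i _ /=.
    by rewrite coordq_lin rmulD rmulZ.
  apply: coordq_inj => i; rewrite coordqJ !coordq_sum mulr_suml.
  by apply: eq_bigr => j _; rewrite !coordq_rmul coordqJ mulrA.
have cPhi v i : coordq (Phi v) i = if (i < n)%N then beta (e i) v else qform N v.
  by rewrite /coordq /Phi rowK.
have PhiJ : J_linear_map Phi.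
  split=> [a u v|s u]; apply: coordq_inj => i.
    rewrite coordq_lin !cPhi; case: ifP => _; exact: qform_lin.
  have rJ : J s u = rmul u (- imunit R s).
    by apply: coordq_inj => j; rewrite coordqJ coordq_rmul.
  by rewrite coordqJ !cPhi rJ; case: ifP => _; exact: qform_rmul.
have PsiK : cancel Psi Phi.
  move=> z; apply: coordq_inj => i; rewrite cPhi /Psi.
  case: ifP => ilt.
    rewrite /hermitian qform_sum // (bigD1 i) //= big1 ?addr0 => [|c ci].
      by rewrite qform_rmul // -/(hermitian (e i) (E i)) /E ilt eo // eqxx mul1r.
    rewrite qform_rmul // -/(hermitian (e i) (E c)) /E; case: ifP => clt.
      rewrite eo //; have -> : (i == c :> nat) = false.
        by apply/negP => /eqP ic; move/eqP: ci; apply; apply: val_inj.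
      by rewrite mul0r.
    by rewrite been // mul0r.
  have -> : i = ord_max.
    by apply: val_inj; apply/eqP; rewrite eqn_leq -ltnS ltn_ord /= leqNgt ilt.
  rewrite qform_sum // big_ord_recr /= big1 ?add0r => [|a _].
    by rewrite EM qform_rmul // qen mul1r.
  by rewrite EO qform_rmul // qe // mul0r.
have PhiK : cancel Phi Psi.
  pose PM := GRing.isLinear.Build _ _ _ _ Psi PsiJ.1.
  pose PL : {linear V -> V} := HB.pack Psi PM.
  have k0 : lker (linfun PL) == 0%VS.
    by apply/lker0P => u v; rewrite !lfunE /= => /(can_inj PsiK).
  move=> v; have : v \in limg (linfun PL) by rewrite lker0_limgf // memvf.
  by move=> /memv_imgP[z _ ->]; rewrite lfunE /= PsiK.
exists Phi, Psi, b0; split=> // z.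
have bsum (F : 'I_n.+1 -> V) v : b (\sum_i F i) v = \sum_i b (F i) v.
  by apply: (big_morph (b ^~ v)); [exact: lfD (bl v) | exact: lf0 (bl v)].
have bdiag a : b (rmul (E a) (coordq z a)) (Psi z) =
    b (rmul (E a) (coordq z a)) (rmul (E a) (coordq z a)).
  rewrite /Psi bs bsum (bigD1 a) //= big1 ?addr0 // => c ca.
  rewrite hermitianE (_ : beta (E c) (E a) = 0) ?mulr0 ?mul0r; last first.
    have nca : (c == a :> nat) = false.
      by apply/negP => /eqP ic; move/eqP: ca; apply; apply: val_inj.
    rewrite /E; case: ifP => clt; case: ifP => alt.
    - by rewrite eo // nca.
    - exact: been.
    - exact: eben.
    - move: nca; have -> : val c = n.
        by apply/eqP; rewrite eqn_leq -ltnS ltn_ord /= leqNgt clt.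
      have -> : val a = n.
        by apply/eqP; rewrite eqn_leq -ltnS ltn_ord /= leqNgt alt.
      by rewrite eqxx.
  by rewrite /Req mxE.
split.
  rewrite {1}/Psi bsum (eq_bigr _ (fun a _ => bdiag a)) big_ord_recr /=; congr (_ + _).
    apply: eq_bigr => a _; rewrite EO hermitianE eo // eqxx mulr1 normsq_conj.
    by [].
  rewrite EM hermitianE hermitian_self normsq_conj -/b0 /p_.
  by move: (coordq z ord_max) => q; rewrite !quat_mulE /conjq !mkquatE; ring.
have -> : N (Psi z) = Req (qform N (Psi z)) by rewrite /qform mkquatE.
rewrite /Psi qform_sum // big_ord_recr /= big1 ?add0r => [|a _].
  by rewrite EM qform_rmul // qen mul1r.
by rewrite EO qform_rmul // qe // mul0r.
Qed.

End GramSchmidt.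

Section Classify.
Variables (R : realType) (n : nat).
Local Notation V := (Hspace R n).
Local Notation J := (@J R n).
Local Notation hor N := (horizontal (J 0) (J 1) (J 2) N).
Local Notation quad := (quaternionic_quadric (J 0) (J 1) (J 2)).

Definition sqnorm_q (z : V) : R := \sum_(a < n) normsq (q_ z a).

Definition parabolic_fun (z : V) : R := sqnorm_q z + Req (p_ z).
Definition sphere_fun (z : V) : R := sqnorm_q z + normsq (p_ z) - 1.
Definition hyperbolic_fun (z : V) : R := sqnorm_q z - normsq (p_ z) + 1.

(** Independent real scalings of the coordinates q and p. *)
Definition scale_qp (a g : R) (z : V) : V :=
  \matrix_i ((if (i < n)%N then a else g) *: row i z).

Lemma coordq_scale_qp a g z i : coordq (scale_qp a g z) i =
  (if (i < n)%N then a else g) *: (coordq z i : 'rV_4).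
Proof. by rewrite /coordq /scale_qp rowK. Qed.

Lemma scale_qp_linear a g : J_linear_map (scale_qp a g).
Proof.
split=> [k u v|s u]; apply: coordq_inj => i.
  rewrite coordq_scale_qp !coordq_lin !coordq_scale_qp scalerDr.
  by rewrite !scalerA [_ * k]mulrC.
rewrite coordq_scale_qp !coordqJ coordq_scale_qp; move: (coordq u i) (if _ then _ else _) => p k.
by apply: quatP; rewrite quat_scaleE !quat_mulE !mkquatE !quat_scaleE; ring.
Qed.

Lemma scale_qpK a g : a != 0 -> g != 0 -> cancel (scale_qp a g) (scale_qp a^-1 g^-1).
Proof.
move=> a0 g0 z; apply: coordq_inj => i; rewrite !coordq_scale_qp scalerA.
by case: ifP => _; rewrite mulVf // scale1r.
Qed.

Lemma normsqZ a (p : 'rV[R]_4) : normsq (a *: p : quat R) = a ^+ 2 * normsq (p : quat R).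
Proof. by rewrite /normsq !quat_scaleE; ring. Qed.

Lemma normsq_affine g d (p : quat R) : normsq (g *: (p : 'rV_4) + d *: (1 : quat R) : quat R) =
  g ^+ 2 * normsq p + 2 * g * d * Req p + d ^+ 2.
Proof. by rewrite /normsq !(quat_addE, quat_scaleE) !mkquatE; ring. Qed.

Lemma J_linear_comp (f g : V -> V) : J_linear_map f -> J_linear_map g ->
  J_linear_map (f \o g).
Proof.
move=> [fl fJ] [gl gJ]; split=> [a u v|s u] /=; first by rewrite gl fl.
by rewrite gJ fJ.
Qed.

(** In the coordinates of [normal_coordinates] centred at x the equation is
    sum |q_a|^2 + b0 |p|^2 + 2 Re p = 0.  For b0 = 0 this is the paraboloid, up to
    doubling p.  Otherwise multiplication by b0 gives
    b0 sum |q_a|^2 + |b0 p + 1|^2 = 1, so q is scaled by the square root of |b0| and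
    p replaced by b0 p + 1.  The existence of the point x on the quadric at which
    the differential does not vanish is what excludes other constants. *)
Lemma quadric_normal_form x b l c : quad b l -> quadric_fun b l c x = 0 ->
  (exists v, b x v + l v != 0) ->
  (forall X, hor (fun v => b x v + l v) X -> X != 0 -> 0 < b X X) ->
  exists (f g : V -> V) (q0 : V) (k : R),
  [/\ J_linear_map f, J_linear_map g, cancel f g, cancel g f &
   k != 0 /\
   [\/ forall y, parabolic_fun (f y + q0) = k * quadric_fun b l c y,
       forall y, sphere_fun (f y + q0) = k * quadric_fun b l c y
     | forall y, hyperbolic_fun (f y + q0) = k * quadric_fun b l c y]].
Proof.
move=> qq qx [w nw] bpos; have [bl bs bi ll] := qq.
have br u : linear_form (b u) by exact: linear_form_r bl bs u.
have Nl : linear_form (fun v => b x v + l v).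
  by move=> a u u'; rewrite br ll; ring.
have [Phi [Psi [b0 [PhiJ PsiJ PhiK PsiK form]]]] :=
  normal_coordinates bl bs bi Nl nw bpos.
have qE y : 2 * quadric_fun b l c y = sqnorm_q (Phi (y - x))
    + b0 * normsq (p_ (Phi (y - x))) + 2 * Req (p_ (Phi (y - x))).
  have [e1 e2] := form (Phi (y - x)); rewrite PhiK in e1 e2.
  rewrite -e1 -e2; move: qx; rewrite /quadric_fun.
  rewrite !(lfD (br _)) !(lfN (br _)) !(lfD (bl _)) !(lfN (bl _)).
  by rewrite !(lfD ll) !(lfN ll) (bs y x) => qx; lra.
pose F a g d y := scale_qp a g (Phi y) + (d *: unitq R ord_max - scale_qp a g (Phi x)).
have FE a g d y : F a g d y = scale_qp a g (Phi (y - x)) + d *: unitq R ord_max.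
  rewrite /F addrCA addrC; congr (_ + _).
  by rewrite (lmD PhiJ.1) (lmN PhiJ.1) (lmD (scale_qp_linear a g).1) (lmN (scale_qp_linear a g).1).
have qF a g d y i : q_ (F a g d y) i = a *: (q_ (Phi (y - x)) i : 'rV_4).
  rewrite FE /q_ coordqD coordqZ coordq_unitq coordq_scale_qp /= ltn_ord.
  have -> : (widen_ord (leqnSn n) i == ord_max) = false.
    by apply/negP => /eqP /(congr1 val) /= e; have := ltn_ord i; rewrite e ltnn.
  by rewrite scaler0 addr0.
have pF a g d y : p_ (F a g d y) = g *: (p_ (Phi (y - x)) : 'rV_4) + d *: (1 : quat R).
  by rewrite FE /p_ coordqD coordqZ coordq_unitq coordq_scale_qp ltnn eqxx.
have sF a g d y : sqnorm_q (F a g d y) = a ^+ 2 * sqnorm_q (Phi (y - x)).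
  rewrite /sqnorm_q mulr_sumr; apply: eq_bigr => i _.
  by rewrite qF normsqZ.
have fin a g d k : a != 0 -> g != 0 -> k != 0 ->
  [\/ forall y, parabolic_fun (F a g d y) = k * quadric_fun b l c y,
      forall y, sphere_fun (F a g d y) = k * quadric_fun b l c y
    | forall y, hyperbolic_fun (F a g d y) = k * quadric_fun b l c y] ->
  exists (f g : V -> V) (q0 : V) (k : R),
  [/\ J_linear_map f, J_linear_map g, cancel f g, cancel g f &
   k != 0 /\
   [\/ forall y, parabolic_fun (f y + q0) = k * quadric_fun b l c y,
       forall y, sphere_fun (f y + q0) = k * quadric_fun b l c y
     | forall y, hyperbolic_fun (f y + q0) = k * quadric_fun b l c y]].
  move=> a0 g0 k0 H.
  exists (scale_qp a g \o Phi), (Psi \o scale_qp a^-1 g^-1),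
    (d *: unitq R ord_max - scale_qp a g (Phi x)), k; split.
  - exact: J_linear_comp (scale_qp_linear a g) PhiJ.
  - exact: J_linear_comp PsiJ (scale_qp_linear _ _).
  - by apply: can_comp; [exact: scale_qpK | exact: PhiK].
  - apply: can_comp; first exact: PsiK.
    by have := scale_qpK (a := a^-1) (g := g^-1); rewrite !invrK !invr_eq0; apply.
  - by [].
(* F a g d scales q by a and replaces p by g p + d, in these coordinates *)
have [bn|bp|bz] := ltgtP b0 0.
- have m0 : 0 <= - b0 by rewrite oppr_ge0 ltW.
  apply: (fin (Num.sqrt (- b0)) b0 1 (- 2 * b0)).
  + by rewrite sqrtr_eq0 -ltNge oppr_gt0.
  + by rewrite lt_eqF.
  + by rewrite mulf_neq0 ?oppr_eq0 ?pnatr_eq0 // lt_eqF.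
  + apply: Or33 => y; rewrite /hyperbolic_fun sF pF normsq_affine sqr_sqrtr //.
    have -> : - 2 * b0 * quadric_fun b l c y = - b0 * (2 * quadric_fun b l c y) by ring.
    by rewrite qE; ring.
- apply: (fin (Num.sqrt b0) b0 1 (2 * b0)).
  + by rewrite sqrtr_eq0 -ltNge.
  + by rewrite gt_eqF.
  + by rewrite mulf_neq0 ?pnatr_eq0 // gt_eqF.
  + apply: Or32 => y; rewrite /sphere_fun sF pF normsq_affine sqr_sqrtr ?ltW //.
    have -> : 2 * b0 * quadric_fun b l c y = b0 * (2 * quadric_fun b l c y) by ring.
    by rewrite qE; ring.
- apply: (fin 1 2 0 2); rewrite ?oner_eq0 ?pnatr_eq0 //.
  apply: Or31 => y; rewrite /parabolic_fun sF pF qE bz quat_addE !quat_scaleE; ring.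
Qed.

End Classify.

(** * Compact hypersurfaces *)

Section Compact.
Variables (R : realType) (n : nat).
Local Notation V := (Hspace R n).
Local Notation J := (@J R n).
Local Notation quad := (quaternionic_quadric (J 0) (J 1) (J 2)).

Definition dotq (p q : quat R) : R :=
  Req p * Req q + Imi p * Imi q + Imj p * Imj q + Imk p * Imk q.

Lemma normsqD p q : normsq (p + q) = normsq p + 2 * dotq p q + normsq q.
Proof. by rewrite /normsq /dotq !quat_addE; ring. Qed.

Lemma normsqB p q : normsq (p - q) = normsq p - 2 * dotq p q + normsq q.
Proof. by rewrite /normsq /dotq !(quat_addE, quat_oppE); ring. Qed.

Lemma normsq_ge0 (p : quat R) : 0 <= normsq p.
Proof. by rewrite !addr_ge0 ?sqr_ge0. Qed.

Lemma normsq_eq0 (p : quat R) : normsq p = 0 -> p = 0.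
Proof.
have h (x : R) := sqr_ge0 x; rewrite /normsq => e.
by apply: quatP; rewrite /Req /Imi /Imj /Imk !mxE; apply/eqP; rewrite -sqrf_eq0;
  apply/eqP/le_anti; rewrite h andbT; have := (h (Req p), h (Imi p), h (Imj p), h (Imk p));
  move=> [[[]]]; rewrite /Req /Imi /Imj /Imk in e *; lra.
Qed.

Definition dot (u v : V) : R := \sum_a dotq (coordq u a) (coordq v a).

Definition dot_q (u v : V) : R := \sum_(a < n) dotq (q_ u a) (q_ v a).

Lemma q_D (u v : V) a : q_ (u + v) a = q_ u a + q_ v a.
Proof. exact: coordqD. Qed.
Lemma q_N (u : V) a : q_ (- u) a = - q_ u a.
Proof. exact: coordqN. Qed.
Lemma p_D (u v : V) : p_ (u + v) = p_ u + p_ v.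
Proof. exact: coordqD. Qed.
Lemma p_N (u : V) : p_ (- u) = - p_ u.
Proof. exact: coordqN. Qed.

Lemma sqnorm_qD u v : sqnorm_q (u + v) = sqnorm_q u + 2 * dot_q u v + sqnorm_q v.
Proof.
rewrite /sqnorm_q /dot_q mulr_sumr -!big_split /=; apply: eq_bigr => a _.
by rewrite q_D normsqD.
Qed.

Lemma sqnorm_qB u v : sqnorm_q (u - v) = sqnorm_q u - 2 * dot_q u v + sqnorm_q v.
Proof.
rewrite /sqnorm_q /dot_q mulr_sumr -sumrB -!big_split /=; apply: eq_bigr => a _.
by rewrite q_D q_N normsqB.
Qed.

Lemma dot_split u v : dot u v = dot_q u v + dotq (p_ u) (p_ v).
Proof. by rewrite /dot big_ord_recr. Qed.

Lemma sqnorm_split u : dot u u = sqnorm_q u + normsq (p_ u).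
Proof. by rewrite dot_split. Qed.

Lemma dotC u v : dot u v = dot v u.
Proof. by apply: eq_bigr => a _; rewrite /dotq; ring. Qed.

Lemma dot_lin v : linear_form (dot ^~ v).
Proof.
move=> k u u'; rewrite /dot mulr_sumr -big_split /=; apply: eq_bigr => a _.
by rewrite coordqD coordqZ /dotq !quat_addE !quat_scaleE; ring.
Qed.

Lemma dot_eq0 u : dot u u <= 0 -> u = 0.
Proof.
have e : dot u u = \sum_a normsq (coordq u a).
  by apply: eq_bigr => a _; rewrite /dotq /normsq; ring.
rewrite e => le0; apply: coordq_inj => a.
have /eqP : \sum_a normsq (coordq u a) = 0.
  by apply/le_anti; rewrite le0 sumr_ge0 // => b _; exact: normsq_ge0.
rewrite psumr_eq0 => [/allP /(_ a (mem_index_enum a)) /eqP /normsq_eq0 ->|b _].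
  by rewrite /coordq linear0.
exact: normsq_ge0.
Qed.

Variable M : set V.
Hypotheses (n_gt0 : (1 <= n)%N) (M_qc : qc_hypersurface M).
Hypotheses (M_neq0 : M !=set0) (M_compact : compact M).
Variables (b : V -> V -> R) (l : V -> R) (c : R).
Hypotheses (qq : quad b l) (q0 : forall z, M z -> quadric_fun b l c z = 0).
Variables (f g : V -> V) (t : V).
Hypotheses (Jf : J_linear_map f) (Jg : J_linear_map g).
Hypotheses (fK : cancel f g) (gK : cancel g f).
Let F y := f y + t.

Lemma max_image (L : V -> R) : linear_form L ->
  exists2 y, M y & forall x, M x -> L (F x) <= L (F y).
Proof.
move=> Ll; have Lfl : linear_form (fun y => L (f y)).
  by move=> a u v; rewrite Jf.1 Ll.
have cL : {within M, continuous (fun y => L (f y) : R^o)}.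
  apply: continuous_subspaceT => y; apply: differentiable_continuous.
  by have [] := has_diff_linear y Lfl.
have [y /set_mem My ymax] := compact_EVT_max M_neq0 M_compact cL.
exists y => // x Mx; rewrite !(lfD Ll) lerD2r.
by apply: ymax; exact: mem_set.
Qed.

Section Critical.
Variables (Q : V -> R) (k : R).
Hypotheses (k0 : k != 0) (QE : forall y, Q (F y) = k * quadric_fun b l c y).

(** For a quadratic function Q the difference Q (z + W) - Q (z - W) is twice the
    differential at z applied to W, so this is [linear_max] for the image of M,
    and no differential of Q has to be computed. *)
Lemma image_critical (L : V -> R) y W : M y -> linear_form L ->
  (forall x, M x -> L (F x) <= L (F y)) ->
  (exists W', Q (F y + W') != Q (F y - W')) ->
  Q (F y + W) = Q (F y - W) -> L W = 0.
Proof.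
move=> My Ll Lmax [W' nW'] eW.
have dQ Y : Q (F y + Y) - Q (F y - Y) = 2 * k * (b y (g Y) + l (g Y)).
  have FD : F y + Y = F (y + g Y) by rewrite /F (lmD Jf.1) gK addrAC.
  have FB : F y - Y = F (y - g Y) by rewrite /F (lmD Jf.1) (lmN Jf.1) gK addrAC.
  have bl := qq_lin qq; have bs := qq_sym qq; have br u := linear_form_r bl bs u.
  rewrite FD FB !QE /quadric_fun !(lfE (qq_lf qq)).
  rewrite !(lfD (bl _)) !(lfN (bl _)) !(lfD (br _)) !(lfN (br _)) (bs (g Y) y).
  by field.
have k2 : 2 * k != 0 by rewrite mulf_neq0 // pnatr_eq0.
have Lfl : linear_form (fun y => L (f y)) by move=> a u v; rewrite Jf.1 Ll.
have LW : L W = L (f (g W)) by rewrite gK.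
rewrite LW; apply: (linear_max n_gt0 M_qc qq q0 My _ Lfl).
- exists (g W'); apply: contra nW' => /eqP e.
  by rewrite -subr_eq0 dQ e mulr0.
- move=> x Mx; move: (Lmax x Mx); rewrite /F !(lfD Ll) lerD2r; exact.
- by apply: (mulfI k2); rewrite -dQ eW subrr mulr0.
Qed.

End Critical.

Lemma image_tangent y : M y -> exists2 W, W != 0 & forall L : V -> R, linear_form L ->
  (forall x, M x -> L (F x) <= L (F y)) -> L W = 0.
Proof.
move=> My; have [X X0 XL] := tangent_neq0 n_gt0 M_qc My.
exists (f X) => [|L Ll Lmax].
  apply: contra X0 => /eqP e.
  by apply/eqP/(can_inj fK); rewrite e (lm0 Jf.1).
apply: (XL (fun v => L (f v))) => [a u v|x Mx]; first by rewrite Jf.1 Ll.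
by move: (Lmax x Mx); rewrite /F !(lfD Ll) lerD2r; exact.
Qed.

(** The function Im_i p is not constant in the direction i of p, which is tangent
    to the paraboloid at each of its points: it has no critical point there. *)
Lemma compact_not_parabolic k : k != 0 ->
  ~ (forall y, parabolic_fun (F y) = k * quadric_fun b l c y).
Proof.
move=> k0 QE.
pose L (v : V) := Imi (p_ v).
have Ll : linear_form L by move=> a u v; rewrite /L /p_ coordqD coordqZ quat_addE quat_scaleE.
have [y My ymax] := max_image Ll.
pose W r : V := \matrix_a (if a == ord_max then r else 0 : quat R).
have pW r : p_ (W r) = r by rewrite /p_ /coordq rowK eqxx.
have dW u r : dot_q u (W r) = 0.
  rewrite /dot_q big1 // => i _; rewrite /q_ /coordq rowK.
  case: eqP => [/(congr1 val) /= e|_]; first by have := ltn_ord i; rewrite e ltnn.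
  by rewrite /dotq /Req /Imi /Imj /Imk !mxE !mulr0 !addr0.
have QD r z : parabolic_fun (z + W r) - parabolic_fun (z - W r) = 2 * Req r.
  rewrite /parabolic_fun sqnorm_qD sqnorm_qB dW !(p_D, p_N) pW.
  by rewrite !(quat_addE, quat_oppE); ring.
have := image_critical k0 QE (L := L) (W := W (mkquat 0 1 0 0)) My Ll ymax.
rewrite /L pW mkquatE => H.
have : (1 : R) = 0.
  apply: H.
  - exists (W 1); rewrite -subr_eq0 QD [1 : quat R]/(quat_one R) mkquatE.
    by rewrite mulr1 pnatr_eq0.
  - by apply/eqP; rewrite -subr_eq0 QD mkquatE mulr0.
by move/eqP; rewrite oner_eq0.
Qed.

(** The function Re q_1 has no critical point on the hyperboloid: the vector with
    q_1 = |p|^2 and last coordinate Re(q_1) p is tangent, and |p|^2 >= 1 there. *)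
Lemma compact_not_hyperbolic k : k != 0 ->
  ~ (forall y, hyperbolic_fun (F y) = k * quadric_fun b l c y).
Proof.
move=> k0 QE; pose a0 : 'I_n := Ordinal n_gt0.
pose L (v : V) := Req (q_ v a0).
have Ll : linear_form L by move=> a u v; rewrite /L /q_ coordqD coordqZ quat_addE quat_scaleE.
have [y My ymax] := max_image Ll.
have QD z u : hyperbolic_fun (z + u) - hyperbolic_fun (z - u) =
    4 * (dot_q z u - dotq (p_ z) (p_ u)).
  rewrite /hyperbolic_fun sqnorm_qD sqnorm_qB !(p_D, p_N) normsqD normsqB.
  ring.
set z := F y in ymax *.
have Qz : sqnorm_q z = normsq (p_ z) - 1.
  by have := QE y; rewrite q0 // mulr0 /hyperbolic_fun -/z; lra.
have sq0 : 0 <= sqnorm_q z by apply: sumr_ge0 => a _; exact: normsq_ge0.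
pose W : V := \matrix_a (if a == ord_max then Req (q_ z a0) *: (p_ z : 'rV_4)
  else if (a == 0%N :> nat) then mkquat (normsq (p_ z)) 0 0 0 else 0 : quat R).
have pW : p_ W = Req (q_ z a0) *: (p_ z : 'rV_4) by rewrite /p_ /coordq rowK eqxx.
have qW i : q_ W i = if i == a0 then mkquat (normsq (p_ z)) 0 0 0 else 0.
  rewrite /q_ /coordq rowK; case: eqP => [/(congr1 val) /= e|_ /=].
    by have := ltn_ord i; rewrite e ltnn.
  by [].
have := image_critical k0 QE (L := L) (W := W) My Ll ymax.
rewrite /L qW eqxx mkquatE -/z => H.
have : normsq (p_ z) = 0.
  apply: H.
  - exists z; rewrite -subr_eq0 QD.
    have -> : dot_q z z = sqnorm_q z.
      by apply: eq_bigr => a _; rewrite /dotq /normsq; ring.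
    have -> : dotq (p_ z) (p_ z) = normsq (p_ z) by rewrite /dotq /normsq; ring.
    by rewrite Qz addrAC subrr sub0r mulrN1 oppr_eq0 pnatr_eq0.
  - apply/eqP; rewrite -subr_eq0 QD /dot_q (bigD1 a0) //= big1 ?addr0.
      rewrite qW eqxx pW /dotq !mkquatE !quat_scaleE /normsq; apply/eqP; ring.
    move=> i /negbTE ia; rewrite qW ia.
    by rewrite /dotq /Req /Imi /Imj /Imk !mxE !mulr0 !addr0.
by move=> e; move: sq0; rewrite Qz e; lra.
Qed.

(** For s on the sphere let z be a maximum of <., s> on the image of M.  The
    vector s - <s, z> z is tangent at z, so <s, z>^2 = 1 and z is s or -s.  In the
    latter case <., s> <= -1 on the image, which is then the point -s; but M has
    nonzero tangent vectors. *)
Lemma compact_sphere k : k != 0 ->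
  (forall y, sphere_fun (F y) = k * quadric_fun b l c y) ->
  F @` M = @quadric_sphere R n.
Proof.
move=> k0 QE.
have sE z : sphere_fun z = dot z z - 1 by rewrite sqnorm_split.
have FM y : M y -> dot (F y) (F y) = 1.
  by move=> My; have := QE y; rewrite q0 // mulr0 sE => /eqP; rewrite subr_eq0 => /eqP.
have dr u : linear_form (dot u) by move=> a v v'; rewrite !(dotC u) dot_lin.
have dE := (fun w => lfD (dr w), fun w => lfN (dr w), fun w => lfZ (dr w),
  fun w => lfD (dot_lin w), fun w => lfN (dot_lin w), fun w => lfZ (dot_lin w)).
apply/seteqP; split=> [_ [y My <-]|s].
  by have := FM y My; rewrite sqnorm_split.
rewrite /quadric_sphere /= -[LHS]/(sqnorm_q s + normsq (p_ s)) -sqnorm_split => ss.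
have [y My ymax] := max_image (dot_lin s).
have QD z u : sphere_fun (z + u) - sphere_fun (z - u) = 4 * dot z u.
  by rewrite !sE !dE (dotC u z); ring.
have := image_critical k0 QE My (dot_lin s) ymax.
move: (FM y My) ymax; move ez: (F y) => z zz ymax crit.
have sz2 : dot (s - dot s z *: z) s = 0.
  apply: crit.
  - by exists z; rewrite -subr_eq0 QD zz mulr1 pnatr_eq0.
  - by apply/eqP; rewrite -subr_eq0 QD !dE zz (dotC s z) mulr1 subrr mulr0.
have : (dot s z - 1) * (dot s z + 1) = 0.
  by move: sz2; rewrite !dE ss (dotC z s) => e; rewrite mulrDr mulr1 mulrBl mul1r; lra.
move=> /eqP; rewrite mulf_eq0 => /orP[/eqP e|/eqP e].
- exists y => //; apply/eqP; rewrite eq_sym -subr_eq0; apply/eqP/dot_eq0.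
  rewrite ez !dE ss zz (dotC z s); lra.
- have cst x : M x -> F x = - s.
    move=> Mx; apply/eqP; rewrite -addr_eq0; apply/eqP/dot_eq0.
    have := ymax x Mx; move: (FM x Mx); move: (F x) => u uu.
    rewrite !dE ss uu (dotC z s) (dotC s u); lra.
  have [W W0 WL] := image_tangent My.
  case/eqP: W0; apply: dot_eq0; rewrite (WL (dot ^~ W)) //; first exact: dot_lin.
  by move=> x Mx; rewrite !cst.
Qed.

End Compact.

Theorem theorem1p1 (R : realType) (n : nat) (hn : (1 <= n)%N)
    (M : set (Hspace R n)) (M_neq0 : M !=set0) (M_conn : connected M)
    (M_qc : qc_hypersurface M) :
  (exists F : Hspace R n -> Hspace R n, quaternionic_affine F /\
     [\/ F @` M `<=` @quadric_parabolic R n,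
         F @` M `<=` @quadric_sphere R n
       | F @` M `<=` @quadric_hyperbolic R n]) /\
  (compact M ->
   exists F : Hspace R n -> Hspace R n, quaternionic_affine F /\
     F @` M = @quadric_sphere R n).
Proof.
have [x [b [l [c [Mx qq q0 nz pos]]]]] := global_quadric hn M_qc M_neq0 M_conn.
have [f [g [t [k [Jf Jg fK gK [k0 E]]]]]] := quadric_normal_form qq (q0 x Mx) nz pos.
have Faff := J_linear_affine t Jf Jg fK gK.
split=> [|M_compact]; exists (fun y => f y + t); split=> //.
  case: E => E; [apply: Or31|apply: Or32|apply: Or33] => _ [y My <-];
    have := E y; rewrite q0 // mulr0.
  - by [].
  - by move/eqP; rewrite subr_eq0 => /eqP.
  - by move/eqP; rewrite addr_eq0 => /eqP.
case: E => E.
- by case: (compact_not_parabolic hn M_qc M_neq0 M_compact qq q0 Jf gK k0 E).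
- exact: (compact_sphere hn M_qc M_neq0 M_compact qq q0 Jf fK gK k0 E).
- by case: (compact_not_hyperbolic hn M_qc M_neq0 M_compact qq q0 Jf gK k0 E).
Qed.
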